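(* Let $C$ be a nilpotent extension of a smooth proper curve $\overline C$ over a finite field, let $G$ be a connected split reductive group over $\mathbb Z$, and let $K\subset G(\mathbb A_C)$ be a compact open subgroup. (1) The action of the Hecke algebra $\mathcal H_{G,C,K}$ on $\mathbb C(\mathrm{Bun}_G(C,K))$ preserves the subspace of cuspidal functions, and for each $i\ge 0$ it preserves the subspace of $i$-cuspidal functions. (2) Let $C'\subset C$ be a closed embedding, where $C'$ is also a nilpotent extension of $\overline C$, and regard $\mathbb C(\mathrm{Bun}_G(C'))$ as a subspace of $\mathbb C(\mathrm{Bun}_G(C))$ via pull-back along the reduction map $\mathrm{Bun}_G(C)\to \mathrm{Bun}_G(C')$. Then $$\mathcal S_{\mathrm{cusp}}(\mathrm{Bun}_G(C'))=\mathbb C(\mathrm{Bun}_G(C'))\cap \mathcal S_{\mathrm{cusp}}(\mathrm{Bun}_G(C)).$$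
   Context: A nilpotent extension $C$ of $\overline C$ is a scheme of finite type whose associated reduced scheme is $\overline C$; $\mathcal N\subset\mathcal O_C$ is the nilradical. $F=F_C$ is the stalk of $\mathcal O_C$ at the general point. For a closed point $p$, $\mathcal O_p$ is the completed local ring of $C$ at $p$, $F_p$ is its total ring of fractions; $\mathbb A=\mathbb A_C$ is the restricted product of the $F_p$ with respect to the $\mathcal O_p$, and $\mathcal O=\prod_p\mathcal O_p\subset\mathbb A$. One has $F\subset\mathbb A$. $\mathcal N^i\mathbb A\subset\mathbb A$ and $\mathcal N^i_F\subset F$ denote the $i$-th powers of the nilradicals (for $i=0$ the whole rings). $\mathrm{Bun}_G(C,K)=G(F)\backslash G(\mathbb A)/K$ and $\mathrm{Bun}_G(C)=\mathrm{Bun}_G(C,G(\mathcal O))$ (isomorphism classes of generically trivial $G$-bundles on $C$). $\mathbb C(X)$ denotes the space of all complex-valued functions on the set $X$. $\mathcal H_{G,C,K}$ is the algebra (under convolution) of compactly supported $K$-biinvariant measures on $G(\mathbb A)$; it acts on $\mathbb C(\mathrm{Bun}_G(C,K))$ by $(h*f)(g)=\int_{G(\mathbb A)} f(gx)\,dh(x)$. Fix a split maximal torus $T$ and a Borel subgroup $B\supset T$ over $\mathbb Z$; a parabolic subgroup (over $\mathbb Z$) is standard if it contains $B$. For a standard parabolic $P$ with unipotent radical $U_P$ the constant term is $E_Pf(g)=\int_{u\in U_P(F)\backslash U_P(\mathbb A)}f(ug)\,du$ (Haar measure with $\mathrm{vol}(U_P(\mathcal O))=1$), $g\in G(\mathbb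 A)$. For $i\ge0$ let $U_P(\mathcal N^i\mathbb A)=\ker(U_P(\mathbb A)\to U_P(\mathbb A/\mathcal N^i\mathbb A))$, $U_P(\mathcal N^i_F)=\ker(U_P(F)\to U_P(F/\mathcal N_F^i))$ and $E_P^if(g)=\int_{u\in U_P(\mathcal N_F^i)\backslash U_P(\mathcal N^i\mathbb A)}f(ug)\,du$. A function $f$ on $\mathrm{Bun}_G(C,K)$ is cuspidal (resp. $i$-cuspidal) if $E_Pf\equiv0$ (resp. $E_P^if\equiv 0$) for every proper standard parabolic $P$. $\mathcal S_{\mathrm{cusp}}(\mathrm{Bun}_G(C,K))\subset\mathbb C(\mathrm{Bun}_G(C,K))$ is the subspace of cuspidal functions, and $\mathcal S_{\mathrm{cusp}}(\mathrm{Bun}_G(C))$ is the case $K=G(\mathcal O)$. *)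

(* Defs.v *)
From HB Require Import structures.
From mathcomp Require Import all_boot all_order all_algebra.
From mathcomp Require Import all_classical all_reals all_analysis.
From mathcomp Require Import complex.
Set Implicit Arguments.
Unset Strict Implicit.
Unset Printing Implicit Defensive.
Import Order.TTheory GRing.Theory Num.Theory.
Local Open Scope classical_set_scope.
Local Open Scope ring_scope.

(* Rings are [comPzRingType]s: commutative, the zero ring being allowed (it is
   the ring of sections over the empty set). *)

Definition invertible (A : comPzRingType) (a : A) := exists b : A, a * b = 1.

Definition ideal (A : comPzRingType) (I : set A) :=
  [/\ I 0, forall a b, I a -> I b -> I (a + b) & forall a b, I b -> I (a * b)].

Definition prime_ideal_set (A : comPzRingType) (I : set A) :=
  [/\ ideal I, ~ I 1 & forall a b, I (a * b) -> I a \/ I b].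

Definition ideal_gen (A : comPzRingType) (S : set A) : set A :=
  [set a | forall I, ideal I -> S `<=` I -> I a].

Fixpoint ideal_pow (A : comPzRingType) (I : set A) (n : nat) : set A :=
  if n is m.+1 then
    ideal_gen [set c | exists a b, [/\ I a, ideal_pow I m b & c = a * b]]
  else setT.

Definition nilradical (A : comPzRingType) : set A :=
  [set a | exists n : nat, a ^+ n = 0].

Definition nonunits (A : comPzRingType) : set A := [set a | ~ invertible a].

(* [A] is generated as a [k]-algebra by finitely many elements. *)
Definition fin_gen (k A : comPzRingType) (s : {rmorphism k -> A}) :=
  exists l : seq A, forall B : set A,
    (forall c, B (s c)) -> (forall a, a \in l -> B a) ->
    (forall a b, B a -> B b -> B (a + b)) ->
    (forall a b, B a -> B b -> B (a * b)) -> forall a, B a.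

Definition fin_gen_Z (A : comPzRingType) :=
  fin_gen (intmul (1 : A) : {rmorphism int -> A}).

Definition square_zero_ext (B C : comPzRingType) (q : {rmorphism B -> C}) :=
  (forall c, exists b, q b = c) /\
  (forall a b, q a = 0 -> q b = 0 -> a * b = 0).

Definition formally_smooth (k A : comPzRingType) (s : {rmorphism k -> A}) :=
  forall (B C : comPzRingType) (q : {rmorphism B -> C}), square_zero_ext q ->
  forall (b : {rmorphism k -> B}) (f : {rmorphism A -> C}),
    (forall c, f (s c) = q (b c)) ->
  exists g : {rmorphism A -> B},
    (forall a, q (g a) = f a) /\ (forall c, g (s c) = b c).

(* A presheaf of rings. A presheaf on the open sets extends to all subsets by
   [U |-> O (interior U)], so indexing the sections by arbitrary subsets is
   harmless; sheaf conditions and morphisms only see the open sets. *)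
Record ringedSpace := RingedSpace {
  rs_top :> topologicalType;
  sec : set rs_top -> comPzRingType;
  res : forall U V : set rs_top, V `<=` U -> {rmorphism sec U -> sec V};
  res_id : forall U (h : U `<=` U) s, res h s = s;
  res_comp : forall U V W (hV : V `<=` U) (hW : W `<=` V) (h : W `<=` U) s,
    res hW (res hV s) = res h s;
  rs_sheaf : forall (U : set rs_top) (P : set (set rs_top)),
    (forall V, P V -> open V) -> \bigcup_(V in P) V = U ->
    forall s : (forall V, sec V),
    (forall V W (hV : V `&` W `<=` V) (hW : V `&` W `<=` W),
       P V -> P W -> res hV (s V) = res hW (s W)) ->
    exists! t : sec U, forall V (h : V `<=` U), P V -> res h t = s V }.
Arguments res {r U V} _.

Section Affine.
Variable X : ringedSpace.

Definition inv_at (U : set X) (f : sec U) (x : X) :=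
  exists (V : set X) (h : V `<=` U), [/\ open V, V x & invertible (res h f)].

Definition basic_open (U : set X) (f : sec U) : set X :=
  [set x | U x /\ inv_at f x].

Lemma basic_open_sub (U : set X) (f : sec U) : basic_open f `<=` U.
Proof. by move=> x []. Qed.

(* [U] is affine: the canonical map from [U] to [Spec (O U)], which sends [x] to
   the prime ideal of the sections not invertible at [x], is bijective, is a
   homeomorphism, and identifies the sections on [D(f)] with [O(U)_f]. *)
Definition affine_open (U : set X) :=
  [/\ open U,
      (forall x, U x -> prime_ideal_set [set f : sec U | ~ inv_at f x]),
      (forall I : set (sec U), prime_ideal_set I ->
         exists! x, U x /\ I = [set f : sec U | ~ inv_at f x]),
      (forall V x, open V -> V `<=` U -> V x ->
         exists f : sec U, basic_open f x /\ basic_open f `<=` V)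
    & forall f : sec U,
        let r := res (@basic_open_sub U f) in
        (forall a, r a = 0 -> exists n, f ^+ n * a = 0) /\
        (forall b, exists n a, r a = r f ^+ n * b)].

End Affine.

Record scheme := Scheme {
  sch_rs :> ringedSpace;
  sch_affine : forall x : sch_rs, exists2 U : set sch_rs, affine_open U & U x }.

Record sch_mor (Y X : scheme) := SchMor {
  mor_fun :> Y -> X;
  mor_cont : continuous mor_fun;
  mor_com : forall U : set X, open U ->
    {rmorphism sec U -> sec (mor_fun @^-1` U)};
  mor_nat : forall (U V : set X) (oU : open U) (oV : open V) (h : V `<=` U)
    (h' : mor_fun @^-1` V `<=` mor_fun @^-1` U) (s : sec U),
    mor_com oV (res h s) = res h' (mor_com oU s);
  mor_local : forall (U : set X) (oU : open U) (s : sec U) (y : Y),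
    U (mor_fun y) -> inv_at (mor_com oU s) y -> inv_at s (mor_fun y) }.

Lemma mor_open (Y X : scheme) (f : sch_mor Y X) (U : set X) :
  open U -> open (f @^-1` U).
Proof. by move: U; apply/continuousP; exact: mor_cont. Qed.

Section Morphisms.

Program Definition mor_id (X : scheme) : sch_mor X X :=
  @SchMor X X id _ (fun U _ => (idfun : {rmorphism sec U -> sec U})) _ _.
Next Obligation. by move=> X x. Qed.
Next Obligation. by move=> X U V oU oV h h' s; congr (res _ s). Qed.
Next Obligation. by []. Qed.

Program Definition mor_comp (Z Y X : scheme) (f : sch_mor Y X)
    (g : sch_mor Z Y) : sch_mor Z X :=
  @SchMor Z X (f \o g) _
    (fun U oU => (mor_com g (mor_open f oU) \o mor_com f oU
                  : {rmorphism sec U -> sec (g @^-1` (f @^-1` U))})) _ _.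
Next Obligation.
by move=> Z Y X f g x; apply: continuous_comp; exact: mor_cont.
Qed.
Next Obligation.
move=> Z Y X f g U V oU oV h h' s /=.
have hf : f @^-1` V `<=` f @^-1` U by move=> y; exact: h.
by rewrite (mor_nat oU oV h hf) (mor_nat (mor_open f oU) (mor_open f oV) hf h').
Qed.
Next Obligation.
move=> Z Y X f g U oU s z Uz /= H.
apply: (@mor_local _ _ f U oU s) => //.
exact: (@mor_local _ _ g _ (mor_open f oU) (mor_com f oU s)).
Qed.

End Morphisms.

Definition closed_map (S T : topologicalType) (f : S -> T) :=
  forall Z, closed Z -> closed (f @` Z).

Definition closed_embedding (Y X : scheme) (f : sch_mor Y X) :=
  [/\ injective f, closed_map f
    & (* surjectivity of O_X -> f_* O_Y *)
      forall (U : set X) (s : sec (f @^-1` U)) (y : Y), open U -> U (f y) ->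
      exists (V : set X) (oV : open V) (h : f @^-1` V `<=` f @^-1` U)
             (t : sec V),
        [/\ V (f y), V `<=` U & mor_com f oV t = res h s]].

Definition reduced (X : scheme) :=
  forall (U : set X) (s : sec U) n, open U -> s ^+ n = 0 -> s = 0.

Definition finite_type_Z (X : scheme) :=
  compact [set: X] /\
  forall x : X, exists U, [/\ affine_open U, U x & fin_gen_Z (sec U)].

Record kScheme (k : comPzRingType) := KScheme {
  ks_sch :> scheme;
  ks_str : {rmorphism k -> sec [set: ks_sch]} }.

Section OverAField.
Variable k : fieldType.
Implicit Types X Z W : kScheme k.

Definition k_mor X Z (f : sch_mor X Z) :=
  forall c : k, mor_com f openT (ks_str Z c) = ks_str X c.

Definition str_on X (U : set X) : {rmorphism k -> sec U} :=
  (res (@subsetT _ U) \o @ks_str _ X : {rmorphism k -> sec U}).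

Definition finite_type X :=
  compact [set: X] /\
  forall x : X, exists U, [/\ affine_open U, U x & fin_gen (@str_on X U)].

Definition is_product X Z W (p : sch_mor W X) (q : sch_mor W Z) :=
  [/\ k_mor p, k_mor q &
    forall (S : kScheme k) (u : sch_mor S X) (v : sch_mor S Z),
      k_mor u -> k_mor v ->
    exists! w : sch_mor S W, [/\ k_mor w, mor_comp p w = u & mor_comp q w = v]].

Definition separated X :=
  forall W (p q : sch_mor W X), is_product p q ->
  forall d : sch_mor X W, mor_comp p d = mor_id X -> mor_comp q d = mor_id X ->
  closed_embedding d.

Definition universally_closed X :=
  forall Z W (p : sch_mor W X) (q : sch_mor W Z), is_product p q ->
  closed_map q.

Definition proper X := [/\ separated X, finite_type X & universally_closed X].

(* Locally finitely presented (over a field: finitely generated) and formally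
   smooth. *)
Definition smooth X := forall x : X, exists U,
  [/\ affine_open U, U x, fin_gen (@str_on X U)
    & formally_smooth (@str_on X U)].

End OverAField.

Definition irreducible (T : topologicalType) (Z : set T) :=
  Z !=set0 /\ forall Z1 Z2, closed Z1 -> closed Z2 ->
    Z `<=` Z1 `|` Z2 -> Z `<=` Z1 \/ Z `<=` Z2.

(* Krull dimension 1, through chains of irreducible closed subsets. *)
Definition dim_one (T : topologicalType) :=
  let irrc Z := closed Z /\ @irreducible T Z in
  (exists Z0 Z1, [/\ irrc Z0, irrc Z1 & Z0 `<` Z1]) /\
  ~ (exists Z0 Z1 Z2, [/\ irrc Z0, irrc Z1, irrc Z2, Z0 `<` Z1 & Z1 `<` Z2]).

Definition smooth_proper_curve (k : fieldType) (X : kScheme k) :=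
  [/\ smooth X, proper X, irreducible [set: X] & dim_one X].

(* [C] need not be a [k]-scheme, e.g. it may be a curve over [Z/p^n]; as [k] is
   finite, "of finite type" can be taken over [Z]. *)
Definition nilpotent_extension (Cbar C : scheme) (j : sch_mor Cbar C) :=
  [/\ finite_type_Z C, reduced Cbar, closed_embedding j
    & forall x, exists y, j y = x].

(* The rings below are given with the data and properties that determine them
   up to a unique isomorphism. *)

Record stalk (X : scheme) (x : X) := Stalk {
  st_ring :> comPzRingType;
  germ : forall U : set X, open U -> U x -> {rmorphism sec U -> st_ring};
  germ_res : forall (U V : set X) (oU : open U) (oV : open V)
    (Ux : U x) (Vx : V x) (h : V `<=` U) s,
    germ oV Vx (res h s) = germ oU Ux s;
  germ_surj : forall a, exists U (oU : open U) (Ux : U x) (s : sec U),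
    germ oU Ux s = a;
  germ_inj : forall (U : set X) (oU : open U) (Ux : U x) (s : sec U),
    germ oU Ux s = 0 ->
    exists V (h : V `<=` U), [/\ open V, V x & res h s = 0] }.

(* The inverse limit of the [S/m^n] for a local ring [S] with maximal ideal
   [m]; [cp_ker n] is the kernel of the projection to [S/m^n]. *)
Record completion (S : comPzRingType) := Completion {
  cp_ring :> comPzRingType;
  cp_map : {rmorphism S -> cp_ring};
  cp_ker : nat -> set cp_ring;
  cp_ideal : forall n, ideal (cp_ker n);
  cp_decr : forall n, cp_ker n.+1 `<=` cp_ker n;
  cp_level : forall n s, cp_ker n (cp_map s) <-> ideal_pow (@nonunits S) n s;
  cp_dense : forall n a, exists s, cp_ker n (a - cp_map s);
  cp_sep : forall a, (forall n, cp_ker n a) -> a = 0;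
  cp_complete : forall s : nat -> S,
    (forall n, ideal_pow (@nonunits S) n (s n.+1 - s n)) ->
    exists a, forall n, cp_ker n (a - cp_map (s n)) }.

Definition nonzerodivisor (A : comPzRingType) (a : A) :=
  forall b, a * b = 0 -> b = 0.

Record total_fractions (A : comPzRingType) := TotalFractions {
  tf_ring :> comPzRingType;
  tf_map : {rmorphism A -> tf_ring};
  tf_inj : injective tf_map;
  tf_unit : forall a, nonzerodivisor a -> invertible (tf_map a);
  tf_frac : forall z, exists a b, nonzerodivisor b /\ z * tf_map b = tf_map a }.

Definition closed_pt (X : scheme) := {p : X | closed [set p]}.

(* [ad_F], [ad_cp p], [ad_Fp p] and [ad_ring] are F, O_p, F_p and A. The
   inclusion [ad_diag] of F in A exists only if O_C has no embedded point. *)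
Record adelic_data (X : scheme) := AdelicData {
  ad_gen : X;
  ad_genP : closure [set ad_gen] = setT;
  ad_F : stalk ad_gen;
  ad_loc : forall p : closed_pt X, stalk (sval p);
  ad_cp : forall p, completion (ad_loc p);
  ad_Fp : forall p, total_fractions (ad_cp p);
  ad_ring : comPzRingType;
  ad_proj : forall p, {rmorphism ad_ring -> ad_Fp p};
  ad_proj_inj : forall a b, (forall p, ad_proj p a = ad_proj p b) -> a = b;
  ad_restricted : forall z : (forall p, ad_Fp p),
    (exists a, forall p, ad_proj p a = z p) <->
    finite_set [set p | ~ exists b, z p = tf_map (ad_Fp p) b];
  ad_diag : {rmorphism ad_F -> ad_ring};
  ad_diag_inj : injective ad_diag;
  ad_diagP : forall (U : set X) (oU : open U) (Ug : U ad_gen)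
    (p : closed_pt X) (Up : U (sval p)) (s : sec U),
    ad_proj p (ad_diag (germ ad_F oU Ug s)) =
    tf_map (ad_Fp p) (cp_map (ad_cp p) (germ (ad_loc p) oU Up s)) }.

Section AdeleTopology.
Variables (X : scheme) (D : adelic_data X).

Definition adele : Type := ad_ring D.
HB.instance Definition _ := GRing.ComPzRing.on adele.

Definition local_nbhd (p : closed_pt X) (n : nat) : set (ad_Fp D p) :=
  [set tf_map (ad_Fp D p) a | a in cp_ker n].

Definition adele_int : set adele :=
  [set a | forall p, exists b, ad_proj D p a = tf_map (ad_Fp D p) b].

(* Restricted product topology: the products of the [local_nbhd p (n p)], with
   [n p = 0] (that is, O_p) for almost all [p], are a basis at 0. *)
Definition adele_open (W : set adele) := forall x, W x ->
  exists n : closed_pt X -> nat, finite_set [set p | n p <> 0%N] /\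
    forall y : adele,
      (forall p, local_nbhd (n p) (ad_proj D p y - ad_proj D p x)) -> W y.

Lemma adele_openT : adele_open setT.
Proof.
move=> x _; exists (fun=> 0%N); split=> //.
by rewrite [X in finite_set X](_ : _ = set0)//; apply/seteqP; split.
Qed.

Lemma local_nbhdS p m n : (m <= n)%N -> @local_nbhd p n `<=` local_nbhd m.
Proof.
move=> /subnK <-; elim: (n - m)%N => // d IH z [a Ja <-].
by apply: IH; exists a => //; exact: cp_decr.
Qed.

Lemma adele_openI : setI_closed adele_open.
Proof.
move=> V W oV oW x [/oV[n [fn nV]] /oW[m [fm mW]]].
exists (fun p => maxn (n p) (m p)); split.
  apply: (@sub_finite_set _ _ ([set p | n p <> 0%N] `|` [set p | m p <> 0%N])).
    by move=> p /=; case: (n p) => [|?]; case: (m p) => [|?] // _;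
      [right|left|left].
  by rewrite finite_setU.
move=> y H; split; [apply: nV => p|apply: mW => p];
  apply: local_nbhdS (H p); by rewrite ?leq_maxl ?leq_maxr.
Qed.

Lemma adele_open_bigU (I : Type) (f : I -> set adele) :
  (forall i, adele_open (f i)) -> adele_open (\bigcup_i f i).
Proof.
move=> fo x [i _ /fo[n [fn H]]]; exists n; split=> // y Hy.
by exists i => //; exact: H.
Qed.

HB.instance Definition _ :=
  isOpenTopological.Build adele adele_openT adele_openI adele_open_bigU.

End AdeleTopology.

(* [r] is the map A_C -> A_{C'} induced by [f : C' -> C]: it comes from local
   maps F_p -> F'_p that are compatible with the comorphism of [f] and
   continuous. *)
Definition induced_map (X' X : scheme) (f : sch_mor X' X) (D' : adelic_data X')
    (D : adelic_data X) (r : {rmorphism adele D -> adele D'}) :=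
  forall (p' : closed_pt X') (p : closed_pt X), f (sval p') = sval p ->
  exists rp : {rmorphism ad_Fp D p -> ad_Fp D' p'},
  [/\ forall a, ad_proj D' p' (r a) = rp (ad_proj D p a),
      forall (U : set X) (oU : open U) (Up : U (sval p))
        (Up' : (f @^-1` U) (sval p')) (s : sec U),
        rp (tf_map (ad_Fp D p)
              (cp_map (ad_cp D p) (germ (ad_loc D p) oU Up s))) =
        tf_map (ad_Fp D' p') (cp_map (ad_cp D' p')
          (germ (ad_loc D' p') (mor_open f oU) Up' (mor_com f oU s)))
    & forall n z, local_nbhd n z -> local_nbhd n (rp z)].

Definition pts (A R : comPzRingType) := {rmorphism A -> R}.

Definition push (A R S : comPzRingType) (f : {rmorphism R -> S})
  (x : pts A R) : pts A S := (f \o x : {rmorphism A -> S}).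

Record affGroup := AffGroup {
  gring : comPzRingType;
  gmul : forall R, pts gring R -> pts gring R -> pts gring R;
  gone : forall R, pts gring R;
  ginv : forall R, pts gring R -> pts gring R;
  gmulA : forall R (x y z : pts gring R), gmul x (gmul y z) = gmul (gmul x y) z;
  gmul1g : forall R (x : pts gring R), gmul (gone R) x = x;
  gmulVg : forall R (x : pts gring R), gmul (ginv x) x = gone R;
  gmul_nat : forall (R S : comPzRingType) (f : {rmorphism R -> S})
    (x y : pts gring R), push f (gmul x y) = gmul (push f x) (push f y) }.

Section Groups.
Variable G : affGroup.

Definition subgroup (R : comPzRingType) (H : set (pts (gring G) R)) :=
  [/\ H (gone G R), forall x y, H x -> H y -> H (gmul x y)
    & forall x, H x -> H (ginv x)].

Definition normal_in (R : comPzRingType) (H P : set (pts (gring G) R)) :=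
  H `<=` P /\ forall p h, P p -> H h -> H (gmul (gmul p h) (ginv p)).

(* The closed subscheme defined by an ideal [I] of Z[G]. *)
Definition spts (I : set (gring G)) (R : comPzRingType) :
  set (pts (gring G) R) := [set x | forall a, I a -> x a = 0].

Definition closed_subgroup (I : set (gring G)) :=
  ideal I /\ forall R, subgroup (spts I (R := R)).

(* Smoothness over Z of the closed subscheme defined by [I]; finite
   presentation is [fin_gen_Z (gring G)]. *)
Definition smooth_sub (I : set (gring G)) :=
  fin_gen_Z (gring G) /\
  forall (B C : comPzRingType) (q : {rmorphism B -> C}), square_zero_ext q ->
  forall x : pts (gring G) C, spts I x ->
  exists y : pts (gring G) B, spts I y /\ push q y = x.

(* For a smooth G the fibre over an algebraically closed
    field K is the reduced algebraic group G(K) with its Zariski topology, and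
    a smooth closed subgroup of the fibre is a Zariski closed subgroup of
    G(K). *)

Section GeometricFibre.
Variable K : closedFieldType.
Let GK := pts (gring G) K.
Implicit Types H P : set GK.

Definition regular_fun (phi : GK -> K) :=
  exists s : seq (K * gring G), forall x, phi x = \sum_(c <- s) c.1 * x c.2.

Definition zclosed (Z : set GK) := exists Phi : set (GK -> K),
  Phi `<=` regular_fun /\ Z = [set x | forall phi, Phi phi -> phi x = 0].

Definition zconnected H := forall Z1 Z2, zclosed Z1 -> zclosed Z2 ->
  H `<=` Z1 `|` Z2 -> H `&` Z1 `&` Z2 = set0 -> H `<=` Z1 \/ H `<=` Z2.

Definition zsubgroup H := subgroup H /\ zclosed H.

Definition derived H : set GK := [set x | forall H', subgroup H' ->
  (forall a b, H a -> H b ->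
     H' (gmul (gmul (ginv a) (ginv b)) (gmul a b))) -> H' x].

Definition solvable_grp H := exists n : nat, iter n derived H `<=` [set gone G K].

(* Right translation by [g] is a (locally) unipotent operator on K[G]. *)
Definition unipotent_elt (g : GK) := forall phi, regular_fun phi ->
  exists n : nat, forall x,
    iter n (fun psi y => psi (gmul y g) - psi y) phi x = 0.

Definition unipotent_grp H := forall h, H h -> unipotent_elt h.

Definition is_unip_radical (P H : set GK) :=
  let cnu H' := [/\ zsubgroup H', zconnected H', normal_in H' P
                  & unipotent_grp H'] in
  cnu H /\ forall H', cnu H' -> H' `<=` H.

Definition connected_reductive :=
  zconnected [set: GK] /\ is_unip_radical setT [set gone G K].

Definition is_borel H :=
  let csc H' := [/\ zsubgroup H', zconnected H' & solvable_grp H'] in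
  csc H /\ forall H', csc H' -> H `<=` H' -> H' = H.

Definition is_parabolic P := zsubgroup P /\ exists2 H, is_borel H & H `<=` P.

Definition laurent r (phi : ('I_r -> K) -> K) :=
  exists s : seq (K * ('I_r -> int)), forall t, (forall i, t i != 0) ->
    phi t = \sum_(c <- s) c.1 * \prod_i t i ^ c.2 i.

(* [H] is isomorphic to some G_m^r, as an algebraic group. *)
Definition is_torus H := zsubgroup H /\
  exists (r : nat) (psi : ('I_r -> K) -> GK),
  let U := [set t : 'I_r -> K | forall i, t i != 0] in
  [/\ set_bij U H psi,
      forall s t, U s -> U t -> psi (fun i => s i * t i) = gmul (psi s) (psi t),
      forall phi, regular_fun phi -> laurent (phi \o psi)
    & forall l, laurent l -> exists2 phi, regular_fun phi &
        forall t, U t -> l t = phi (psi t)].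

Definition is_maximal_torus H :=
  is_torus H /\ forall H', is_torus H' -> H `<=` H' -> H' = H.

End GeometricFibre.

Definition reductive :=
  smooth_sub [set 0] /\ forall K : closedFieldType, connected_reductive K.

(* [T] is isomorphic to some G_m^r over Z and is fibrewise a maximal torus. *)
Definition split_maximal_torus (T : set (gring G)) :=
  [/\ closed_subgroup T,
      exists (r : nat) (chi : forall R, pts (gring G) R -> 'I_r -> R),
      [/\ forall (R S : comPzRingType) (f : {rmorphism R -> S}) x i,
            spts T x -> chi S (push f x) i = f (chi R x i),
          forall R x y i, spts T x -> spts T y ->
            chi R (gmul x y) i = chi R x i * chi R y i
        & forall R, set_bij (spts T (R := R))
            [set y | forall i, invertible (y i)] (chi R)]
    & forall K : closedFieldType, is_maximal_torus (spts T (R := K))].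

Definition borel_subgroup (B : set (gring G)) :=
  [/\ closed_subgroup B, smooth_sub B
    & forall K : closedFieldType, is_borel (spts B (R := K))].

Definition parabolic_subgroup (P : set (gring G)) :=
  [/\ closed_subgroup P, smooth_sub P
    & forall K : closedFieldType, is_parabolic (spts P (R := K))].

Definition unipotent_radical (P U : set (gring G)) :=
  [/\ closed_subgroup U, smooth_sub U,
      forall R, normal_in (spts U (R := R)) (spts P (R := R))
    & forall K : closedFieldType,
        is_unip_radical (spts P (R := K)) (spts U (R := K))].

(* Inclusion of closed subschemes is reversed on ideals. *)
Record std_parabolic (B : set (gring G)) := StdParabolic {
  sp_par : set (gring G);
  sp_rad : set (gring G);
  sp_parP : parabolic_subgroup sp_par;
  sp_std : sp_par `<=` B;
  sp_proper : sp_par <> [set 0];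
  sp_radP : unipotent_radical sp_par sp_rad }.

End Groups.

Section Adelic.
Variables (X : scheme) (D : adelic_data X) (G : affGroup).

HB.instance Definition _ := gen_eqMixin (pts (gring G) (adele D)).
HB.instance Definition _ := gen_choiceMixin (pts (gring G) (adele D)).

(* G(A) has the coarsest topology making all the functions in Z[G] continuous,
   i.e. the one given by any closed embedding of G in an affine space. *)
Definition apts := initial_topology
  ((fun x => (fun a => x a)) : pts (gring G) (adele D) ->
     prod_topology (fun _ : gring G => adele D)).
HB.instance Definition _ := Topological.on apts.
HB.instance Definition _ := isPointed.Build apts (gone G (adele D)).

Implicit Types (V Gam : set apts) (U : set (gring G)).

Definition GF : set apts := range (@push (gring G) _ _ (ad_diag D)).
Definition GO : set apts := [set x | forall a, adele_int (x a)].

Definition sub_A U : set apts := spts U (R := adele D).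
Definition sub_F U : set apts := push (ad_diag D) @` (spts U (R := ad_F D)).
Definition sub_O U : set apts := sub_A U `&` GO.

(* The kernel of U(R) -> U(R/N^i), N the nilradical of R. *)
Definition nil_kernel (R : comPzRingType) U (i : nat) :
    set (pts (gring G) R) :=
  [set x | spts U x /\
     forall a, ideal_pow (@nilradical R) i (x a - gone G R a)].

Definition sub_NA U i : set apts := nil_kernel U i (R := adele D).
Definition sub_NF U i : set apts := push (ad_diag D) @` (nil_kernel U i (R := ad_F D)).

Definition borelG := g_sigma_algebraType (@open apts).

Definition translL (g : apts) (A : set apts) : set apts := gmul g @` A.
Definition translR (A : set apts) (g : apts) : set apts :=
  (fun x => gmul x g) @` A.

Definition compact_open_subgroup (K : set apts) :=
  [/\ subgroup K, compact K & open K].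

Section Functions.
Variable R : realType.
Local Notation C := (complex R).

(* C(Bun_G(C,K)), as the (G(F),K)-invariant functions on G(A). *)
Definition Bun_fun (K : set apts) : set (apts -> C) :=
  [set f | forall gam g k, GF gam -> K k -> f (gmul (gmul gam g) k) = f g].

Definition Cintegral (mu : {measure set borelG -> \bar R}) (A : set apts)
    (f : apts -> C) : C :=
  Complex (\int[mu]_(x in A) complex.Re (f x))
          (\int[mu]_(x in A) complex.Im (f x)).

(* Integration over Gam \ V for a closed subgroup V of G(A) and a discrete
   cocompact subgroup Gam of V. A Haar measure on V is viewed as a Borel
   measure on G(A) carried by V, and the quotient measure (counting measure on
   Gam) is integrated over a relatively compact Borel set of representatives;
   the result does not depend on that set. *)
Record quotient_haar V Gam := QuotientHaar {
  qh_mu : {measure set borelG -> \bar R};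
  qh_carried : qh_mu (~` V) = 0%E;
  qh_nonzero : qh_mu V <> 0%E;
  qh_invariant : forall v (A : set borelG), V v -> measurable A ->
    qh_mu (translL v A) = qh_mu A;
  qh_compact : forall Z : set apts, compact Z -> (qh_mu Z < +oo)%E;
  qh_dom : set borelG;
  qh_dom_meas : measurable qh_dom;
  qh_dom_sub : qh_dom `<=` V;
  qh_dom_bounded : exists2 Z : set apts, compact Z & qh_dom `<=` Z;
  qh_domP : forall v, V v ->
    exists! d, qh_dom d /\ exists2 gam, Gam gam & v = gmul gam d }.

Definition quotient_integral V Gam (q : quotient_haar V Gam)
    (phi : apts -> C) : C := Cintegral (qh_mu q) (qh_dom q) phi.

(* The Haar measures used in E_P (normalized by vol(U_P(O)) = 1) and E_P^i. *)
Record haar_data (B : set (gring G)) := HaarData {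
  hd : forall P : std_parabolic B,
    quotient_haar (sub_A (sp_rad P)) (sub_F (sp_rad P));
  hd_normalized : forall P, qh_mu (hd P) (sub_O (sp_rad P)) = 1%E;
  hd_nil : forall (P : std_parabolic B) (i : nat),
    quotient_haar (sub_NA (sp_rad P) i) (sub_NF (sp_rad P) i) }.

Section Cusp.
Variables (B : set (gring G)) (H : haar_data B).

Definition constant_term (P : std_parabolic B) (f : apts -> C) (g : apts) : C :=
  quotient_integral (hd H P) (fun u => f (gmul u g)).

Definition constant_term_nil (i : nat) (P : std_parabolic B) (f : apts -> C)
    (g : apts) : C :=
  quotient_integral (hd_nil H P i) (fun u => f (gmul u g)).

Definition S_cusp (K : set apts) : set (apts -> C) :=
  [set f | Bun_fun K f /\ forall P g, constant_term P f g = 0].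

Definition S_cusp_nil (i : nat) (K : set apts) : set (apts -> C) :=
  [set f | Bun_fun K f /\ forall P g, constant_term_nil i P f g = 0].

End Cusp.

Definition jpos (nu : {charge set borelG -> \bar R}) :
    {measure set borelG -> \bar R} :=
  jordan_pos (projT2 (cid (projT2 (cid (Hahn_decomposition nu))))).
Definition jneg (nu : {charge set borelG -> \bar R}) :
    {measure set borelG -> \bar R} :=
  jordan_neg (projT2 (cid (projT2 (cid (Hahn_decomposition nu))))).

Definition charge_integral (nu : {charge set borelG -> \bar R})
    (f : apts -> C) : C :=
  Cintegral (jpos nu) setT f - Cintegral (jneg nu) setT f.

Definition compactly_supported (nu : {charge set borelG -> \bar R}) :=
  exists2 Z : set apts, compact Z &
    forall A : set borelG, measurable A -> A `&` Z = set0 -> nu A = 0%E.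

Definition biinvariant (K : set apts) (nu : {charge set borelG -> \bar R}) :=
  forall k (A : set borelG), K k -> measurable A ->
    nu (translL k A) = nu A /\ nu (translR A k) = nu A.

(* A complex measure is given by its real and imaginary parts. *)
Record hecke (K : set apts) := Hecke {
  hk_re : {charge set borelG -> \bar R};
  hk_im : {charge set borelG -> \bar R};
  hk_supp : compactly_supported hk_re /\ compactly_supported hk_im;
  hk_inv : biinvariant K hk_re /\ biinvariant K hk_im }.

Definition hecke_act (K : set apts) (h : hecke K) (f : apts -> C) : apts -> C :=
  fun g => charge_integral (hk_re h) (fun x => f (gmul g x))
         + Complex 0 1 * charge_integral (hk_im h) (fun x => f (gmul g x)).

End Functions.
End Adelic.
Arguments GO {X} D G _.

Definition pullback (X X' : scheme) (D : adelic_data X) (D' : adelic_data X')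
    (G : affGroup) (R : realType) (r : {rmorphism adele D -> adele D'})
    (f : apts D' G -> complex R) : apts D G -> complex R :=
  fun x => f (push r x).

(* Main.v *)
(** Functions on Bun_G are invariant under an open subgroup, so on a compact set
they take finitely many values and every integral below is a finite sum. In
particular a Hecke operator is a finite combination of right translations
[f => f (_ * x)], and these commute with the constant terms, which integrate
over left translations.

For (2), C' -> C is a homeomorphism (both spaces are irreducible of dimension
one) and the kernel of O_C -> O_C' is nilpotent, uniformly at all points. So
A_C -> A_C' is surjective with nilpotent kernel, and smoothness gives the
surjectivity of G(A_C) -> G(A_C') and of U_P(A_C) -> U_P(A_C'). It remains to see
that E_P of a pull-back is, up to a positive factor, the pull-back of E_P. If
[Gam] is countable with fundamental domain [dom] in V, then mu(Y) is the integral
over [dom] of [#{g in Gam | g u in Y}]. Decomposing V in double cosets of [Gam]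
and an open subgroup, this shows first that V is unimodular, and then, for
rho : V -> V' with rho(Gam) in Gam', that the integral over [dom] of
[#{g in Gam' | g rho(u) in Y}] is a right and left invariant function of Y, hence
a multiple of mu'. This does not need Gam -> Gam' to be surjective. *)
Require Import Defs.
From HB Require Import structures.
From mathcomp Require Import all_boot all_order all_algebra.
From mathcomp Require Import all_classical all_reals all_analysis.
From mathcomp Require Import complex ring measurable_realfun.
Set Implicit Arguments.
Unset Strict Implicit.
Unset Printing Implicit Defensive.
Import Order.TTheory GRing.Theory Num.Theory.
Local Open Scope classical_set_scope.
Local Open Scope ring_scope.

(** * Quotient rings and subrings *)

(** The rings F_p and A are known only through characterizing properties, so what is needed about
    them is drawn from one local fact: at a closed point p there is a section t that vanishes at p
    and is invertible at the general point. Some power of the maximal ideal lies in (t), and every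
    nonzerodivisor of the completed ring divides a power of t, so F_p is the completed ring with t
    inverted. This makes multiplication by an adele continuous, and it lets elements of F'_p be
    lifted with powers of t as denominators. Uniqueness of Haar measure is not invoked: two
    invariant set functions are compared on cosets of open subgroups, where all indices are finite.
    The normalization vol(U_P(O)) = 1 supplies the open subgroup of finite measure from which the
    comparison starts. Unfolding sums over Gam, which is countable because F consists of fractions
    over a finitely generated ring and a point of G is given by finitely many coordinates. The
    factor relating the two constant terms may depend on g, since the level group is conjugated by
    the image of g; cuspidality only needs it to be nonzero. *)

Section QuotientRing.
Variables (A : comPzRingType) (I : set A) (hI : ideal I).

Lemma idealD a b : I a -> I b -> I (a + b).
Proof. by case: hI => ? h ?; exact: h. Qed.
Lemma idealM a b : I b -> I (a * b).
Proof. by case: hI => ? ? h; exact: h. Qed.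
Lemma idealMl a b : I b -> I (b * a).
Proof. by rewrite mulrC; exact: idealM. Qed.
Lemma ideal0 : I 0. Proof. by case: hI. Qed.
Lemma idealN a : I a -> I (- a). Proof. by rewrite -mulN1r; exact: idealM. Qed.
Lemma idealB a b : I a -> I b -> I (a - b).
Proof. by move=> Ia Ib; apply: idealD => //; exact: idealN. Qed.

(** A choice that depends only on the coset of [a] as a set. Congruent elements get the same
    representative, so the quotient is a subtype of [A] with Leibniz equality. *)
Definition qrep (a : A) : A := xget 0 [set b | I (b - a)].

Lemma qrepP a : I (qrep a - a).
Proof.
rewrite /qrep; case: xgetP => //= /(_ a); rewrite /= subrr => H.
by case: (H ideal0).
Qed.

Lemma qrep_eq a b : I (a - b) -> qrep a = qrep b.
Proof.
move=> h; rewrite /qrep; congr xget; apply/seteqP; split => c /= hc.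
  by rewrite -(subrK a c) -addrA; apply: idealD.
rewrite -(subrK b c) -addrA; apply: idealD => //.
by rewrite -opprB; exact: idealN.
Qed.

Lemma qrepK a : qrep (qrep a) = qrep a.
Proof. by apply: qrep_eq; exact: qrepP. Qed.

Definition qring := {a : A | qrep a == a}.
Definition qpi (a : A) : qring := exist _ (qrep a) (introT eqP (qrepK a)).
HB.instance Definition _ := Choice.on qring.

Lemma qpi_val (x : qring) : qpi (val x) = x.
Proof. by apply: val_inj => /=; apply/eqP; exact: (valP x). Qed.

Lemma qpi_eq a b : qpi a = qpi b <-> I (a - b).
Proof.
split=> [[e]|h]; last by apply: val_inj; exact: qrep_eq.
have h1 := qrepP a; have h2 := qrepP b; rewrite e in h1.
by rewrite -(subrKA (qrep b)) addrC -[a - _]opprB; apply: idealB.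
Qed.

Lemma qpi_ind (P : qring -> Prop) : (forall a, P (qpi a)) -> forall x, P x.
Proof. by move=> h x; rewrite -(qpi_val x). Qed.

Definition qadd (x y : qring) := qpi (val x + val y).
Definition qmul (x y : qring) := qpi (val x * val y).
Definition qopp (x : qring) := qpi (- val x).

Lemma qaddE a b : qadd (qpi a) (qpi b) = qpi (a + b).
Proof.
apply/qpi_eq; rewrite /= opprD addrACA; apply: idealD; exact: qrepP.
Qed.
Lemma qoppE a : qopp (qpi a) = qpi (- a).
Proof. by apply/qpi_eq; rewrite /= -opprD; apply: idealN; exact: qrepP. Qed.
Lemma qmulE a b : qmul (qpi a) (qpi b) = qpi (a * b).
Proof.
apply/qpi_eq => /=.
rewrite -(subrKA (qrep a * b)) -mulrBr -mulrBl.
by apply: idealD; [apply: idealM|apply: idealMl]; exact: qrepP.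
Qed.

Lemma qaddA : associative qadd.
Proof.
elim/qpi_ind=> a; elim/qpi_ind=> b; elim/qpi_ind=> c.
by rewrite !qaddE addrA.
Qed.
Lemma qaddC : commutative qadd.
Proof. by elim/qpi_ind=> a; elim/qpi_ind=> b; rewrite !qaddE addrC. Qed.
Lemma qadd0 : left_id (qpi 0) qadd.
Proof. by elim/qpi_ind=> a; rewrite !qaddE add0r. Qed.
Lemma qaddN : left_inverse (qpi 0) qopp qadd.
Proof. by elim/qpi_ind=> a; rewrite qoppE !qaddE addNr. Qed.
HB.instance Definition _ := GRing.isZmodule.Build qring qaddA qaddC qadd0 qaddN.
Lemma qmulA : associative qmul.
Proof.
elim/qpi_ind=> a; elim/qpi_ind=> b; elim/qpi_ind=> c.
by rewrite !qmulE mulrA.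
Qed.
Lemma qmulC : commutative qmul.
Proof. by elim/qpi_ind=> a; elim/qpi_ind=> b; rewrite !qmulE mulrC. Qed.
Lemma qmul1 : left_id (qpi 1) qmul.
Proof. by elim/qpi_ind=> a; rewrite !qmulE mul1r. Qed.
Lemma qmulD : left_distributive qmul qadd.
Proof.
elim/qpi_ind=> a; elim/qpi_ind=> b; elim/qpi_ind=> c.
by rewrite (qaddE a b) !qmulE qaddE mulrDl.
Qed.
HB.instance Definition _ :=
  GRing.Zmodule_isComPzRing.Build qring qmulA qmulC qmul1 qmulD.

Lemma qpi_zmod : zmod_morphism qpi.
Proof. by move=> a b; symmetry; rewrite /GRing.add/= /GRing.opp/= qoppE qaddE. Qed.
Lemma qpi_monoid : monoid_morphism qpi.
Proof. by split=> // a b; symmetry; exact: qmulE. Qed.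
HB.instance Definition _ := GRing.isZmodMorphism.Build A qring qpi qpi_zmod.
HB.instance Definition _ := GRing.isMonoidMorphism.Build A qring qpi qpi_monoid.

Lemma quotient_ring : exists (Q : comPzRingType) (p : {rmorphism A -> Q}),
  (forall x, exists a, p a = x) /\ (forall a, p a = 0 <-> I a).
Proof.
exists qring, qpi; split=> [x|a]; first by exists (val x); exact: qpi_val.
by rewrite -(rmorph0 qpi) qpi_eq subr0.
Qed.

End QuotientRing.

(* A map out of a surjective image of [A] that is compatible with a morphism
   out of [A]. *)
Lemma factor_morphism (A Q B : comPzRingType) (p : {rmorphism A -> Q})
    (f : {rmorphism A -> B}) :
  (forall x, exists a, p a = x) -> (forall a, p a = 0 -> f a = 0) ->
  exists g : {rmorphism Q -> B}, forall a, g (p a) = f a.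
Proof.
move=> /choice[s sK] h.
have gp a : f (s (p a)) = f a.
  by apply/eqP; rewrite -subr_eq0 -rmorphB h// rmorphB sK subrr.
have add : zmod_morphism (f \o s).
  by move=> x y; rewrite -(sK x) -(sK y) -rmorphB /= !gp rmorphB.
have mul : monoid_morphism (f \o s).
  split; first by rewrite -(rmorph1 p) /= gp rmorph1.
  by move=> x y; rewrite -(sK x) -(sK y) -rmorphM /= !gp rmorphM.
pose g : {rmorphism Q -> B} := HB.pack (f \o s)
  (GRing.isZmodMorphism.Build _ _ _ add) (GRing.isMonoidMorphism.Build _ _ _ mul).
by exists g => a; exact: gp.
Qed.

Section Subring.
Variables (A : comPzRingType) (S : set A).
Hypothesis hS : [/\ S 1, forall a b, S a -> S b -> S (a - b)
  & forall a b, S a -> S b -> S (a * b)].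

Let sp : {pred A} := fun a => `[< S a >].
Fact sp_closed : subring_closed sp.
Proof.
case: hS => h1 hB hM; split=> [|a b /asboolP Sa /asboolP Sb|a b /asboolP Sa /asboolP Sb].
- exact/asboolP.
- by apply/asboolP; exact: hB.
- by apply/asboolP; exact: hM.
Qed.
HB.instance Definition _ := GRing.isSubringClosed.Build A sp sp_closed.
Let subr := {a : A | a \in sp}.
HB.instance Definition _ := SubChoice.on subr.
HB.instance Definition _ := GRing.SubChoice_isSubComPzRing.Build A sp subr sp_closed.

(** Turns a subset into a ring over which points can be formed, so that naturality along the
    inclusion applies. *)
Lemma subring_type : exists (B : comPzRingType) (i : {rmorphism B -> A}),
  injective i /\ range i = S.
Proof.
exists subr, (val : {rmorphism subr -> A}); split; first exact: val_inj.
apply/seteqP; split=> [_ [x _ <-]|a Sa]; first by exact/asboolP/(valP x).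
by exists (exist _ a (introT (asboolP _) Sa)).
Qed.
End Subring.

(** * Points of group schemes *)

Lemma rmorph_ext (A B : comPzRingType) (x y : {rmorphism A -> B}) :
  (forall a, x a = y a) -> x = y.
Proof.
case: x y => x [[x1] [x2]] [y [[y1] [y2]]] /= /funext e; subst y.
by rewrite (Prop_irrelevance x1 y1) (Prop_irrelevance x2 y2).
Qed.

Lemma lift_injective (A B C : comPzRingType) (i : {rmorphism B -> A})
    (f : {rmorphism C -> A}) :
  injective i -> (forall c, exists b, i b = f c) ->
  exists g : {rmorphism C -> B}, forall c, i (g c) = f c.
Proof.
move=> inj /choice[g gE].
have add : zmod_morphism g.
  by move=> x y; apply: inj; rewrite rmorphB !gE rmorphB.
have mul : monoid_morphism g.
  by split=> [|x y]; apply: inj; rewrite ?rmorphM ?rmorph1 !gE ?rmorphM ?rmorph1.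
pose h : {rmorphism C -> B} := HB.pack g
  (GRing.isZmodMorphism.Build _ _ _ add) (GRing.isMonoidMorphism.Build _ _ _ mul).
by exists h.
Qed.

Section Points.
Variable G : affGroup.

Lemma gmulgV (R : comPzRingType) (x : pts (gring G) R) :
  gmul x (ginv x) = gone G R.
Proof.
rewrite -[LHS]gmul1g -{1}(gmulVg (ginv x)) -gmulA [in X in gmul _ X]gmulA.
by rewrite gmulVg gmul1g gmulVg.
Qed.

Lemma gmulg1 (R : comPzRingType) (x : pts (gring G) R) : gmul x (gone G R) = x.
Proof. by rewrite -(gmulVg x) gmulA gmulgV gmul1g. Qed.

Lemma gmulKg (R : comPzRingType) (x y : pts (gring G) R) :
  gmul (ginv x) (gmul x y) = y.
Proof. by rewrite gmulA gmulVg gmul1g. Qed.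

Lemma gmulVKg (R : comPzRingType) (x y : pts (gring G) R) :
  gmul x (gmul (ginv x) y) = y.
Proof. by rewrite gmulA gmulgV gmul1g. Qed.

Lemma gmulgK (R : comPzRingType) (x y : pts (gring G) R) :
  gmul (gmul y x) (ginv x) = y.
Proof. by rewrite -gmulA gmulgV gmulg1. Qed.

Lemma gmulgVK (R : comPzRingType) (x y : pts (gring G) R) :
  gmul (gmul y (ginv x)) x = y.
Proof. by rewrite -gmulA gmulVg gmulg1. Qed.

Lemma ginv_uniq (R : comPzRingType) (x y : pts (gring G) R) :
  gmul x y = gone G R -> y = ginv x.
Proof. by move=> h; rewrite -(gmulKg x y) h gmulg1. Qed.

Lemma ginvK (R : comPzRingType) (x : pts (gring G) R) : ginv (ginv x) = x.
Proof. by symmetry; apply: ginv_uniq; rewrite gmulVg. Qed.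

Lemma ginvM (R : comPzRingType) (x y : pts (gring G) R) :
  ginv (gmul x y) = gmul (ginv y) (ginv x).
Proof.
by symmetry; apply: ginv_uniq; rewrite -gmulA [gmul y _]gmulA gmulgV gmul1g gmulgV.
Qed.

Lemma ginv1 (R : comPzRingType) : ginv (gone G R) = gone G R.
Proof. by symmetry; apply: ginv_uniq; rewrite gmul1g. Qed.

(** Naturality is an axiom for the product alone; the image of the unit is idempotent, hence equal
    to the unit. *)
Lemma push_one (R S : comPzRingType) (f : {rmorphism R -> S}) :
  push f (gone G R) = gone G S.
Proof.
have e : gmul (push f (gone G R)) (push f (gone G R)) = push f (gone G R).
  by rewrite -gmul_nat gmul1g.
by rewrite -[LHS](gmulKg (push f (gone G R))) e gmulVg.
Qed.

Lemma push_inv (R S : comPzRingType) (f : {rmorphism R -> S})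
  (x : pts (gring G) R) : push f (ginv x) = ginv (push f x).
Proof. by apply: ginv_uniq; rewrite -gmul_nat gmulgV push_one. Qed.

Section Comultiplication.
Variable R : comPzRingType.
Let T := (pts (gring G) R * pts (gring G) R)%type.

Let coord (pr : T -> pts (gring G) R) :
  exists X : pts (gring G) (T -> R), forall a p, X a p = pr p a.
Proof.
have add : zmod_morphism (fun a (p : T) => pr p a).
  by move=> a b; apply/funext => p; rewrite rmorphB.
have mul : monoid_morphism (fun a (p : T) => pr p a).
  by split=> [|a b]; apply/funext => p; rewrite ?rmorph1 ?rmorphM.
pose X : {rmorphism gring G -> (T -> R)} := HB.pack (fun a (p : T) => pr p a)
  (GRing.isZmodMorphism.Build _ _ _ add) (GRing.isMonoidMorphism.Build _ _ _ mul).
by exists X.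
Qed.

Let ev (p : T) : exists e : {rmorphism (T -> R) -> R}, forall f, e f = f p.
Proof.
have add : zmod_morphism (fun f : T -> R => f p) by [].
have mul : monoid_morphism (fun f : T -> R => f p) by [].
pose e : {rmorphism (T -> R) -> R} := HB.pack (fun f : T -> R => f p)
  (GRing.isZmodMorphism.Build _ _ _ add) (GRing.isMonoidMorphism.Build _ _ _ mul).
by exists e.
Qed.

(* Applying naturality to the universal pair of points, over the ring of
   functions of the pair, replaces the tensor product [Z[G] * Z[G]]. *)
Lemma gmul_formula (a : gring G) : exists s : seq (gring G * gring G),
  forall x y : pts (gring G) R, gmul x y a = \sum_(c <- s) x c.1 * y c.2.
Proof.
have [X XE] := coord fst; have [Y YE] := coord snd.
(* The image of the tensor square of Z[G] in the ring of functions of the pair. Both universal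
   points take their values in it. *)
pose S : set (T -> R) :=
  [set f | exists s : seq (gring G * gring G), f = \sum_(c <- s) X c.1 * Y c.2].
have hS : [/\ S 1, forall a b, S a -> S b -> S (a - b)
    & forall a b, S a -> S b -> S (a * b)].
  split.
  - by exists [:: (1, 1)]; rewrite big_seq1 /= !rmorph1 mulr1.
  - move=> _ _ [s ->] [t ->]; exists (s ++ [seq (- c.1, c.2) | c <- t]).
    rewrite big_cat big_map /= -sumrN; congr (_ + _).
    by apply: eq_bigr => c _; rewrite rmorphN mulNr.
  - move=> _ _ [s ->] [t ->].
    exists [seq (c.1 * d.1, c.2 * d.2) | c <- s, d <- t].
    rewrite big_allpairs_dep /= mulr_suml; apply: eq_bigr => c _.
    rewrite mulr_sumr; apply: eq_bigr => d _.
    by rewrite !rmorphM mulrACA.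
have [B [i [inj iS]]] := subring_type hS.
have [X' X'E] : exists X' : pts (gring G) B, forall c, i (X' c) = X c.
  apply: lift_injective => // c.
  have : range i (X c) by rewrite iS; exists [:: (c, 1)]; rewrite big_seq1 /= rmorph1 mulr1.
  by case=> b _ <-; exists b.
have [Y' Y'E] : exists Y' : pts (gring G) B, forall c, i (Y' c) = Y c.
  apply: lift_injective => // c.
  have : range i (Y c) by rewrite iS; exists [:: (1, c)]; rewrite big_seq1 /= rmorph1 mul1r.
  by case=> b _ <-; exists b.
have eX : push i X' = X by exact: rmorph_ext.
have eY : push i Y' = Y by exact: rmorph_ext.
(* By naturality along [i], the product of the universal points also has its values in [S];
   evaluation at (x, y) then gives the formula. *)
have : range i (gmul X Y a) by rewrite -eX -eY -gmul_nat; exists (gmul X' Y' a).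
rewrite iS => -[s sE]; exists s => x y.
have [e eE] := ev (x, y).
have eXx : push e X = x by apply: rmorph_ext => c; rewrite /= eE XE.
have eYy : push e Y = y by apply: rmorph_ext => c; rewrite /= eE YE.
rewrite -{1}eXx -{1}eYy -gmul_nat /= sE rmorph_sum /=.
by apply: eq_bigr => c _; rewrite rmorphM !eE XE YE.
Qed.
End Comultiplication.
End Points.

(* Smoothness only speaks of square-zero extensions; the kernel of [q] is
   filtered by its last nonzero power. *)
Lemma smooth_lift (G : affGroup) (I : set (gring G)) : smooth_sub I ->
  forall (e : nat) (B C : comPzRingType) (q : {rmorphism B -> C}),
  (forall c, exists b, q b = c) ->
  (forall l : seq B, size l = e.+2 -> (forall b, b \in l -> q b = 0) ->
     \prod_(b <- l) b = 0) ->
  forall x : pts (gring G) C, spts I x ->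
  exists y : pts (gring G) B, spts I y /\ push q y = x.
Proof.
move=> [_ sm]; elim=> [|e IH] B C q qs qn x Ix.
  apply: sm => //; split=> // a b qa qb.
  have := qn [:: a; b] erefl; rewrite !big_cons big_nil mulr1; apply.
  by move=> c; rewrite !inE => /orP[]/eqP->.
(* [J] is the power e+2 of the kernel. A product of two of its generators contains e+3 factors from
   the kernel and vanishes, so B -> B/J is a square-zero extension, while B/J -> C falls under the
   induction hypothesis. *)
pose gens := [set p : B | exists l : seq B, [/\ size l = e.+2,
  (forall b, b \in l -> q b = 0) & p = \prod_(b <- l) b]].
pose J := ideal_gen gens.
have hJ : ideal J.
  split; [by move=> K [K0 _ _]| |].
    move=> a b Ja Jb K hK gK; case: (hK) => _ h _; apply: h; [exact: Ja|exact: Jb].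
  by move=> a b Jb K hK gK; case: (hK) => _ _; apply; exact: Jb.
have Jq b : J b -> q b = 0.
  move=> Jb; apply: (Jb [set b | q b = 0]).
    split=> /=; first by rewrite rmorph0.
      by move=> a c; rewrite rmorphD => -> ->; rewrite addr0.
    by move=> a c; rewrite rmorphM => ->; rewrite mulr0.
  move=> _ [[|c l] [//= _ h ->]]; rewrite /= big_cons rmorphM h ?mul0r//.
  by rewrite inE eqxx.
have J2 a b : J a -> J b -> a * b = 0.
  move=> Ja Jb; apply: (Ja [set a | a * b = 0]).
    split=> /=; first by rewrite mul0r.
      by move=> c d; rewrite mulrDl => -> ->; rewrite addr0.
    by move=> c d; rewrite -mulrA => ->; rewrite mulr0.
  move=> _ [l [sl hl ->]] /=.
  apply: (Jb [set b | \prod_(b <- l) b * b = 0]).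
    split=> /=; first by rewrite mulr0.
      by move=> c d; rewrite mulrDr => -> ->; rewrite addr0.
    by move=> c d; rewrite mulrCA => ->; rewrite mulr0.
  move=> _ [m [sm' hm ->]] /=; case: m sm' hm => [//|c m] /= sm' hm.
  rewrite big_cons mulrA.
  rewrite [X in X * _](_ : _ = \prod_(b <- rcons l c) b); last first.
    by rewrite -cats1 big_cat big_seq1.
  rewrite qn ?mul0r// ?size_rcons ?sl// => d; rewrite mem_rcons inE => /orP[/eqP->|/hl//].
  by apply: hm; rewrite inE eqxx.
have [Q [p [ps pJ]]] := quotient_ring hJ.
have [q' q'E] : exists q' : {rmorphism Q -> C}, forall b, q' (p b) = q b.
  by apply: factor_morphism => // b /pJ; exact: Jq.
have [z [Iz zx]] : exists z : pts (gring G) Q, spts I z /\ push q' z = x.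
  apply: IH Ix => [c|l sl hl].
    by have [b <-] := qs c; exists (p b).
  have [s sK] := choice ps.
  have -> : l = [seq p b | b <- map s l].
    by rewrite -map_comp -[LHS]map_id; apply: eq_map => b /=; rewrite sK.
  rewrite big_map -rmorph_prod; apply/pJ => K hK; apply.
  exists (map s l); split; rewrite ?size_map// => b /mapP[c cl ->].
  by rewrite -q'E sK hl.
have [y [Iy yz]] := sm _ _ p (conj ps (fun a b ha hb => J2 a b ((pJ a).1 ha) ((pJ b).1 hb))) z Iz.
exists y; split=> //; rewrite -zx -yz; apply: rmorph_ext => b /=.
by rewrite q'E.
Qed.

(** * Noetherian rings *)

Section Noetherian.
Variable A : comPzRingType.

Definition subring_set (B : set A) := [/\ B 1, forall a b, B a -> B b -> B (a - b)
  & forall a b, B a -> B b -> B (a * b)].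

Definition rel_ideal (B I : set A) := [/\ I `<=` B, I 0,
  forall a b, I a -> I b -> I (a - b) & forall a b, B a -> I b -> I (a * b)].

(** Relative to a subring of [A], so that generators can be adjoined one at a time inside [A]
    without polynomial rings. Finite generation is stated by minimality among ideals, which avoids
    linear combinations. *)
Definition rel_noetherian (B : set A) := forall I, rel_ideal B I ->
  exists l : seq A, (forall x, x \in l -> I x) /\
    forall J, rel_ideal B J -> (forall x, x \in l -> J x) -> I `<=` J.

Lemma subring_set0 B : subring_set B -> B 0.
Proof. by case=> B1 BB _; rewrite -(subrr 1); exact: BB. Qed.

Lemma subring_setN B a : subring_set B -> B a -> B (- a).
Proof. by move=> hB Ba; rewrite -sub0r; case: (hB) => _ h _; apply: h => //; exact: subring_set0. Qed.

Lemma subring_setD B a b : subring_set B -> B a -> B b -> B (a + b).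
Proof.
move=> hB Ba Bb; rewrite -(opprK b); case: (hB) => _ h _; apply: h => //.
exact: subring_setN.
Qed.

Lemma subring_set_int B (n : int) : subring_set B -> B n%:~R.
Proof.
move=> hB; case: n => n.
  elim: n => [|n ?]; first exact: subring_set0.
  by rewrite intS rmorphD; apply: subring_setD => //; case: hB.
rewrite NegzE rmorphN; apply: subring_setN => //.
elim: n => [|n ?]; first by case: hB.
by rewrite intS rmorphD; apply: subring_setD => //; case: hB.
Qed.

Lemma rel_idealN B I a : rel_ideal B I -> I a -> I (- a).
Proof. by move=> [_ I0 h _] Ia; rewrite -sub0r; exact: h. Qed.

Lemma rel_idealD B I a b : rel_ideal B I -> I a -> I b -> I (a + b).
Proof.
move=> hI Ia Ib; rewrite -(opprK b); case: (hI) => _ _ h _; apply: h => //.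
exact: rel_idealN hI _.
Qed.

Lemma rel_idealI B I J : rel_ideal B I -> rel_ideal B J -> rel_ideal B (I `&` J).
Proof.
move=> [IB I0 Ia Im] [JB J0 Ja Jm]; split=> //.
- by move=> a [/IB].
- by move=> a b [? ?] [? ?]; split; [exact: Ia|exact: Ja].
- by move=> a b ? [? ?]; split; [exact: Im|exact: Jm].
Qed.

(** * Hilbert's basis theorem inside a fixed ring *)

Section Hilbert.
Variables (B : set A) (hB : subring_set B) (x : A).

(** Values at [x] of polynomials over [B] of degree less than [n]. As [x] may satisfy relations,
    such a value has no well-defined degree or leading coefficient. *)
Fixpoint low_poly (n : nat) : set A :=
  if n is m.+1 then [set f | exists b r, [/\ B b, low_poly m r & f = b * x ^+ m + r]]
  else [set 0].

Lemma low_poly0 n : low_poly n 0.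
Proof.
elim: n => //= n IH; exists 0, 0; split=> //; first exact: subring_set0.
by rewrite mul0r addr0.
Qed.

Lemma low_polyB n f g : low_poly n f -> low_poly n g -> low_poly n (f - g).
Proof.
elim: n f g => [f g /= -> ->|n IH f g /=]; first by rewrite subrr.
move=> [b [r [Bb lr ->]]] [c [s [Bc ls ->]]]; exists (b - c), (r - s); split.
- by case: hB => _ h _; exact: h.
- exact: IH.
- by rewrite mulrBl opprD addrACA.
Qed.

Lemma low_polyZ n c f : B c -> low_poly n f -> low_poly n (c * f).
Proof.
move=> Bc; elim: n f => [f /= ->|n IH f /=]; first by rewrite mulr0.
move=> [b [r [Bb lr ->]]]; exists (c * b), (c * r); split; last by rewrite mulrDr mulrA.
  by case: hB => _ _; exact.
exact: IH.
Qed.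

Lemma low_polyX n f : low_poly n f -> low_poly n.+1 (f * x).
Proof.
elim: n f => [f /= ->|n IH f].
  exists 0, 0; split=> //; [exact: subring_set0|by rewrite !mul0r addr0].
move=> [b [r [Bb lr ->]]]; exists b, (r * x); split=> //; first exact: IH.
by rewrite mulrDl -mulrA -exprSr.
Qed.

Lemma low_polyXn n k f : low_poly n f -> low_poly (k + n) (f * x ^+ k).
Proof.
move=> lf; elim: k => [|k IH]; first by rewrite mulr1.
by rewrite exprSr mulrA; exact: low_polyX.
Qed.

Lemma low_polyS n f : low_poly n f -> low_poly n.+1 f.
Proof.
move=> lf; exists 0, f; split=> //; last by rewrite mul0r add0r.
exact: subring_set0.
Qed.

Lemma low_poly_le n m f : (n <= m)%N -> low_poly n f -> low_poly m f.
Proof. by move=> /subnK <-; elim: (m - n)%N => // k IH /IH; exact: low_polyS. Qed.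

Lemma low_polyM n m f g : low_poly n f -> low_poly m g -> exists k, low_poly k (f * g).
Proof.
elim: n f => [f /= -> _|n IH f /= [b [r [Bb lr ->]]] lg].
  by exists 0%N; rewrite mul0r.
have [k lk] := IH _ lr lg; exists (maxn (n + m) k).
rewrite mulrDl -(opprK (r * g)); apply: low_polyB.
  apply: low_poly_le (leq_maxl _ _) _.
  by rewrite -mulrA [_ ^+ _ * _]mulrC; apply: low_polyZ => //; exact: low_polyXn.
apply: low_poly_le (leq_maxr _ _) _; rewrite -sub0r; apply: low_polyB => //.
exact: low_poly0.
Qed.

Let Bx := [set a | forall S, subring_set S -> B `<=` S -> S x -> S a].

Lemma adjoin_subring : subring_set Bx.
Proof.
split=> [S [] //|a b Ba Bb S hS BS Sx|a b Ba Bb S hS BS Sx].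
  by case: (hS) => _ h _; apply: h; [exact: Ba|exact: Bb].
by case: (hS) => _ _; apply; [exact: Ba|exact: Bb].
Qed.

Lemma adjoin_poly : Bx = [set f | exists n, low_poly n f].
Proof.
have B1 : B 1 by case: hB.
apply/seteqP; split=> f /=.
  move=> /(_ [set f | exists n, low_poly n f]); apply; last 2 first.
  - move=> b Bb; exists 1%N, b, 0; split=> //; by rewrite mulr1 addr0.
  - exists 2%N, 1, 0; split=> //; last by rewrite mul1r addr0.
    exact: low_poly0.
  split=> [|a b [n la] [m lb]|a b [n la] [m lb]].
  - exists 1%N, 1, 0; split=> //; by rewrite mulr1 addr0.
  - exists (maxn n m); apply: low_polyB; [apply: low_poly_le la|apply: low_poly_le lb].
      exact: leq_maxl.
    exact: leq_maxr.
  - exact: low_polyM la lb.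
move=> [n lf] S hS BS Sx; elim: n f lf => [f /= ->|n IH f /= [b [r [Bb lr ->]]]].
  exact: subring_set0.
apply: subring_setD => //; last exact: IH.
case: (hS) => S1 _ SM; apply: (SM); first exact: BS.
by elim: n {IH lr} => [|n ?]; rewrite ?expr0// exprS; exact: SM.
Qed.

(** The coefficients of x^n in some presentation of an element of [I] of degree at most n form an
    ideal [L n] of [B], increasing with n. Finite generation of the union stops the chain at some N,
    and lifts of generators of [L n] for n <= N generate [I]. *)
Lemma hilbert_basis : rel_noetherian B -> rel_noetherian Bx.
Proof.
move=> nB I hI.
have sBx := adjoin_subring.
have BBx : B `<=` Bx by move=> b Bb S _ + _; exact.
have Bxx : Bx x by [].
have Bxn n : Bx (x ^+ n).
  case: (sBx) => S1 _ SM; elim: n => [|n ?]; rewrite ?expr0// exprS; exact: SM.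
pose L n := [set b | B b /\ exists2 r, low_poly n r & I (b * x ^+ n + r)].
have leadI (J : set A) n : rel_ideal Bx J ->
    rel_ideal B [set b | B b /\ exists2 r, low_poly n r & J (b * x ^+ n + r)].
  move=> hJ; split=> [b []//||a b [Ba [r lr Ir]] [Bb [s ls Is]]|a b Ba [Bb [s ls Is]]].
  - split; first exact: subring_set0.
    exists 0; first exact: low_poly0.
    by rewrite mul0r addr0; case: hJ.
  - split; first by case: hB => _ h _; exact: h.
    exists (r - s); first exact: low_polyB.
    by rewrite mulrBl addrACA -opprD; case: hJ => _ _ h _; exact: h.
  - split; first by case: hB => _ _; exact.
    exists (a * s); first exact: low_polyZ.
    by rewrite -mulrA -mulrDr; case: hJ => _ _ _; apply => //; exact: BBx.
have hL n : rel_ideal B (L n) by exact: leadI.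
have LS n : L n `<=` L n.+1.
  move=> b [Bb [r lr Ir]]; split=> //; exists (r * x); first exact: low_polyX.
  rewrite exprSr mulrA -mulrDl mulrC; by case: hI => _ _ _; exact.
have Lle n m : (n <= m)%N -> L n `<=` L m.
  by move=> /subnK <-; elim: (m - n)%N => // k IH b /IH; exact: LS.
pose Loo := [set b | exists n, L n b].
have hLoo : rel_ideal B Loo.
  split=> [b [n []]//||a b [n La] [m Lb]|a b Ba [n Lb]].
  - by exists 0%N; case: (hL 0%N).
  - exists (maxn n m); case: (hL (maxn n m)) => _ _ h _; apply: h.
      by apply: Lle La; exact: leq_maxl.
    by apply: Lle Lb; exact: leq_maxr.
  - by exists n; case: (hL n) => _ _ _; exact.
have [l [lL lgen]] := nB _ hLoo.
have [N LN] : exists N, forall y, y \in l -> L N y.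
  elim: l lL {lgen} => [|y l IH] lL; first by exists 0%N.
  have [N hN] := IH (fun z zl => lL z (mem_behead (s := y :: l) zl)).
  have [n hn] := lL y (mem_head _ _).
  exists (maxn n N) => z; rewrite inE => /orP[/eqP->|/hN].
    by apply: Lle hn; exact: leq_maxl.
  by apply: Lle; exact: leq_maxr.
have LooN n : L n `<=` L N.
  by move=> b Lb; apply: (lgen _ (hL N) LN); exists n.
(* A single finite list that serves all n <= N: every ideal [J] containing it realizes each
   coefficient in [L n] as a leading one. *)
have [W hW] : exists W : seq A, (forall w, w \in W -> I w) /\
    forall n, (n <= N)%N -> forall J, rel_ideal Bx J -> (forall w, w \in W -> J w) ->
      L n `<=` [set b | B b /\ exists2 r, low_poly n r & J (b * x ^+ n + r)].
  have one n : exists W : seq A, (forall w, w \in W -> I w) /\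
      forall J, rel_ideal Bx J -> (forall w, w \in W -> J w) ->
      L n `<=` [set b | B b /\ exists2 r, low_poly n r & J (b * x ^+ n + r)].
    have [m [mL mgen]] := nB _ (hL n).
    have [W [WI hW]] : exists W : seq A, (forall w, w \in W -> I w) /\
        forall b, b \in m -> exists2 r, low_poly n r & b * x ^+ n + r \in W.
      elim: m mL {mgen} => [|y m IH] mL; first by exists [::].
      have [W [WI hW]] := IH (fun z zl => mL z (mem_behead (s := y :: m) zl)).
      have [_ [r lr Ir]] := mL y (mem_head _ _).
      exists (y * x ^+ n + r :: W); split=> [w|b].
        by rewrite inE => /orP[/eqP->|/WI].
      rewrite inE => /orP[/eqP->|/hW[s ls sW]]; first by exists r => //; exact: mem_head.
      by exists s => //; rewrite inE sW orbT.
    exists W; split=> // J hJ JW; apply: mgen; first exact: leadI.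
    move=> b bm; split; first by have [] := mL _ bm.
    by have [r lr /JW] := hW _ bm; exists r.
  elim: N {LN LooN} => [|N [W [WI hW]]].
    by have [W [WI hW]] := one 0%N; exists W; split=> // n; rewrite leqn0 => /eqP->.
  have [W' [WI' hW']] := one N.+1; exists (W' ++ W); split=> [w|n].
    by rewrite mem_cat => /orP[/WI'|/WI].
  rewrite leq_eqVlt => /orP[/eqP->|nN] J hJ JW.
    by apply: hW' => // w wW; apply: JW; rewrite mem_cat wW.
  by apply: hW => // w wW; apply: JW; rewrite mem_cat wW orbT.
exists W; split=> [|J hJ JW]; first by case: hW.
case: hW => WI hW.
suff H f : I f -> J f by move=> f; exact: H.
move=> If; have [n lf] : exists n, low_poly n f.
  by move: (If); case: hI => h _ _ _ /h; rewrite adjoin_poly.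
elim: n f lf If => [f /= -> _|n IH f /= [b [r [Bb lr ->]]] If]; first by case: hJ.
have Lb : L n b by split=> //; exists r.
pose n0 := minn n N.
have Lb0 : L n0 b by rewrite /n0; case: leqP => // _; exact: LooN Lb.
(* The element is sought in [J] and [I] at once: in [J] because it is split off, in [I] so that the
   remainder, of lower degree, stays in [I]. *)
have [_ [s ls [Js Is]]] := hW n0 (geq_minr _ _) _ (rel_idealI hJ hI)
  (fun w ww => conj (JW _ ww) (WI _ ww)) _ Lb0.
have e : (n - n0 + n0)%N = n by rewrite subnK// geq_minl.
have e2 : b * x ^+ n = b * x ^+ n0 * x ^+ (n - n0) by rewrite -mulrA -exprD addnC e.
have -> : b * x ^+ n + r = x ^+ (n - n0) * (b * x ^+ n0 + s) + (r - s * x ^+ (n - n0)).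
  by rewrite [x ^+ (n - n0) * _]mulrC mulrDl -e2 -addrA [s * _ + _]addrC subrK.
apply: (rel_idealD hJ); first by case: hJ => _ _ _; apply.
apply: IH; first by apply: low_polyB => //; rewrite -{1}e; exact: low_polyXn.
have -> : r - s * x ^+ (n - n0) = (b * x ^+ n + r) - x ^+ (n - n0) * (b * x ^+ n0 + s).
  by rewrite [x ^+ (n - n0) * _]mulrC mulrDl -e2 opprD addrACA subrr add0r.
by case: hI => _ _ h h'; apply: h => //; exact: h'.
Qed.

End Hilbert.

(** Z -> A need not be injective, so the generator is the least positive integer whose image lies in
    [I]; if there is none, [I] is zero. *)
Lemma rel_noetherian_Z : rel_noetherian [set a | exists n : int, a = n%:~R].
Proof.
move=> I [IB I0 IBb IM].
have [[n [n0 In]]|H] := pselect (exists n : nat, (0 < n)%N /\ I n%:R); last first.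
  exists [::]; split=> // J hJ _ a Ia; have [m e] := IB _ Ia; subst a.
  suff -> : m = 0 by rewrite mulr0z; case: hJ.
  apply: contrapT => m0; apply: H; exists `|m|%N; split.
    by rewrite absz_gt0; apply/eqP.
  case: m {m0} Ia => k // Ik; rewrite NegzE abszN absz_nat.
  by rewrite -[_%:R]opprK -[- _%:R](mulrNz 1 k.+1) -sub0r; apply: IBb => //; rewrite -NegzE.
have ex : exists n, (0 < n)%N && `[< I n%:R >] by exists n; rewrite n0; apply/asboolP.
case: (ex_minnP ex) => {n n0 In ex} n /andP[n0 /asboolP In] nmin.
exists [:: n%:R]; split=> [y|J hJ Jn a Ia]; first by rewrite inE => /eqP->.
have [m e] := IB _ Ia; subst a.
have Jn' q : J (q%:~R * n%:R).
  by case: hJ => _ _ _; apply; [exists q|apply: Jn; rewrite inE].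
have e : m = (m %/ n)%Z * n + (m %% n)%Z := divz_eq m n.
suff r0 : (m %% n)%Z = 0 by rewrite e r0 addr0 rmorphM; exact: Jn'.
have Ir : I ((m %% n)%Z%:~R).
  rewrite (_ : (m %% n)%Z = m - (m %/ n)%Z * n); last by rewrite {2}e addrC addKr.
  by rewrite rmorphB rmorphM; apply: IBb => //; apply: IM => //; exists (m %/ n)%Z.
have : (0 <= (m %% n)%Z)%R by apply: modz_ge0; apply/eqP => -[n00]; rewrite n00 in n0.
have : ((m %% n)%Z < n)%R by rewrite ltz_pmod.
case: (m %% n)%Z Ir => // k Ik kn _; apply: contrapT => k0.
have : (n <= k)%N by apply: nmin; rewrite lt0n; apply/andP; split; [apply/eqP => kk; apply: k0; rewrite kk|apply/asboolP].
by rewrite leqNgt; move: kn; rewrite ltz_nat => ->.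
Qed.

Definition noetherian := forall I : set A, ideal I ->
  exists l : seq A, (forall x, x \in l -> I x) /\
    forall J, ideal J -> (forall x, x \in l -> J x) -> I `<=` J.

Lemma fin_gen_noetherian : fin_gen_Z A -> noetherian.
Proof.
move=> [l hl].
pose gen (m : seq A) := [set a | forall S, subring_set S ->
  (forall x, x \in m -> S x) -> S a].
have gsub m : subring_set (gen m).
  split=> [S [] //|a b Ba Bb S hS mS|a b Ba Bb S hS mS].
    by case: (hS) => _ h _; apply: h; [exact: Ba|exact: Bb].
  by case: (hS) => _ _; apply; [exact: Ba|exact: Bb].
have gn m : rel_noetherian (gen m).
  elim: m => [|x m IH].
    rewrite (_ : gen [::] = [set a | exists n : int, a = n%:~R]).
      exact: rel_noetherian_Z.
    apply/seteqP; split=> a.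
      move=> /(_ [set a | exists n : int, a = n%:~R]); apply=> //; split.
      - by exists 1.
      - by move=> _ _ [n ->] [k ->]; exists (n - k); rewrite rmorphB.
      - by move=> _ _ [n ->] [k ->]; exists (n * k); rewrite rmorphM.
    by move=> [n ->] S hS _; exact: subring_set_int.
  have := @hilbert_basis _ (gsub m) x IH; congr rel_noetherian.
  apply/seteqP; split=> a ga S hS.
    move=> mS; apply: ga => //; last by apply: mS; exact: mem_head.
    by move=> b; apply => // y ym; apply: mS; rewrite inE ym orbT.
  move=> mS Sx; apply: ga => // y; rewrite inE => /orP[/eqP->//|ym].
  by apply: mS => S' _; apply.
move=> I hI.
have gT a : gen l a.
  apply: hl => [n|b lb|b c gb gc|b c gb gc].
  - by move=> S hS _; exact: subring_set_int.
  - by move=> S _ h; exact: h.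
  - exact: (subring_setD (gsub l)).
  - by case: (gsub l) => _ _ h; exact: h.
have hT J : ideal J <-> rel_ideal (gen l) J.
  split=> hJ; last split.
  - split=> // [|a b|a b _]; [exact: ideal0|exact: idealB|exact: idealM].
  - by case: hJ.
  - by move=> a b; exact: rel_idealD hJ.
  - by move=> a b; case: hJ => _ _ _; apply.
have [m [mI mgen]] := gn l _ ((hT I).1 hI).
by exists m; split=> // J /hT; exact: mgen.
Qed.

(** The nilradical is finitely generated by nilpotent elements. Generators are added one at a time,
    keeping an ideal whose e-fold products vanish for some e. *)
Lemma nil_exponent : noetherian -> exists e : nat, forall s : seq A,
  size s = e -> (forall a, a \in s -> nilradical a) -> \prod_(a <- s) a = 0.
Proof.
move=> fA.
have idN : ideal (@nilradical A).
  split; first by exists 1%N; rewrite expr1.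
  - move=> a b [n an] [m bm]; exists (n + m)%N.
    rewrite exprDn big1// => i _.
    have [ni|ni] := leqP n (n + m - i).
      by rewrite -(subnK ni) exprD an mulr0 mul0r mul0rn.
    have mi : (m <= i)%N by rewrite leqNgt; apply/negP => im; move: ni; rewrite ltnNge -addnBA ?leq_addr// ltnW.
    by rewrite -(subnK mi) exprD bm !mulr0 mul0rn.
  - by move=> a b [n bn]; exists n; rewrite exprMn bn mulr0.
have [l [lN lgen]] := fA _ idN.
suff [I [hI lI [e he]]] : exists I : set A, [/\ ideal I, forall x, x \in l -> I x &
    exists e : nat, forall s : seq A,
      size s = e -> (forall a, a \in s -> I a) -> \prod_(a <- s) a = 0].
  by exists e => s ss sN; apply: he => // a /sN; exact: lgen.
elim: l lN {lgen} => [|x l IH] lN.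
  exists [set 0]; split=> //.
    by split=> //= [a b -> ->|a b ->]; rewrite ?addr0 ?mulr0.
  exists 1%N => -[|a []]//= _ h; rewrite big_seq1; apply: h; exact: mem_head.
have [I [hI lI [e he]]] := IH (fun z zl => lN z (mem_behead (s := x :: l) zl)).
exists [set a | exists b c, I c /\ a = c + x * b]; split.
- split=> [|_ _ [b [c [Ic ->]]] [b' [c' [Ic' ->]]]|a _ [b [c [Ic ->]]]].
  + by exists 0, 0; split; [exact: ideal0|rewrite mulr0 addr0].
  + exists (b + b'), (c + c'); split; first exact: idealD.
    by rewrite mulrDr addrACA.
  + exists (a * b), (a * c); split; first exact: idealM.
    by rewrite mulrDr [a * (x * b)]mulrCA.
- move=> y; rewrite inE => /orP[/eqP->|/lI Iy].
    by exists 1, 0; split; [exact: ideal0|rewrite mulr1 add0r].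
  by exists 0, y; rewrite mulr0 addr0.
have [n xn] := lN x (mem_head _ _).
(* Each block of e factors from I + (x) yields a factor x, because its part inside [I] is a product
   of e elements of [I]. After n blocks x^n appears, which is zero. *)
suff H k u s : x ^+ k * u = 0 -> size s = (k * e)%N ->
    (forall a, a \in s -> exists b c, I c /\ a = c + x * b) -> \prod_(a <- s) a * u = 0.
  exists (n * e)%N => s ss sI; rewrite -[LHS]mulr1; apply: (H n) => //.
  by rewrite xn mul0r.
elim: k u s => [|k IHk] u s; first by rewrite mul1r => ->; rewrite mulr0.
move=> xu ss sI; rewrite -(cat_take_drop e s) big_cat /= mulrAC mulrC.
have [w ->] : exists w, \prod_(a <- take e s) a = x * w.
  have : size (take e s) = e by rewrite size_takel// ss mulSn leq_addr.
  have : forall a, a \in take e s -> exists b c, I c /\ a = c + x * b.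
    by move=> a /mem_take /sI.
  move: (take e s) => t tI st.
  suff [w [t' [st' t'I ->]]] : exists w t', [/\ size t' = size t,
      forall a, a \in t' -> I a & \prod_(a <- t) a = \prod_(a <- t') a + x * w].
    by exists w; rewrite he ?add0r// st' st.
  elim: t tI {st} => [|a t IHt] tI.
    by exists 0, [::]; split=> //; rewrite mulr0 addr0.
  have [w [t' [st' t'I e']]] := IHt (fun z zl => tI z (mem_behead (s := a :: t) zl)).
  have [b [c [Ic ea]]] := tI a (mem_head _ _).
  exists (c * w + b * (\prod_(a <- t') a + x * w)), (c :: t'); split.
  - by rewrite /= st'.
  - by move=> z; rewrite inE => /orP[/eqP->|/t'I].
  - by rewrite !big_cons e' ea mulrDl [c * (_ + _)]mulrDr -addrA [x * (c * w + _)]mulrDr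
      [x * (c * w)]mulrCA [x * (b * _)]mulrA.
apply: IHk.
- by rewrite -mulrA [w * u]mulrC !mulrA -exprSr xu mul0r.
- by rewrite size_drop ss mulSn addKn.
- by move=> a /mem_drop /sI.
Qed.

End Noetherian.

(** * Completed local rings of dimension one *)

Section IdealPowers.
Variable A : comPzRingType.
Implicit Types (I J S : set A).

Lemma ideal_genP S : ideal (ideal_gen S).
Proof.
split; first by move=> K hK _; exact: ideal0.
- by move=> a b Ja Jb K hK SK; apply: idealD => //; [exact: Ja|exact: Jb].
- by move=> a b Jb K hK SK; apply: idealM => //; exact: Jb.
Qed.

Lemma ideal_gen_sub S : S `<=` ideal_gen S.
Proof. by move=> a Sa K _; apply. Qed.

Lemma ideal_powP I n : ideal (ideal_pow I n).
Proof. by case: n => [|n]; [split|exact: ideal_genP]. Qed.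

Lemma ideal_powS I n : ideal_pow I n.+1 `<=` ideal_pow I n.
Proof.
move=> a; apply; first exact: ideal_powP.
by move=> _ [b [c [_ Ic ->]]]; apply: idealM => //; exact: ideal_powP.
Qed.

Lemma ideal_pow_exp I t n : I t -> ideal_pow I n (t ^+ n).
Proof.
move=> It; elim: n => // n IH; apply: ideal_gen_sub.
by exists t, (t ^+ n); rewrite exprS.
Qed.

Lemma ideal_pow_ind I J n : ideal J ->
  (forall s : seq A, size s = n -> (forall a, a \in s -> I a) -> J (\prod_(a <- s) a)) ->
  ideal_pow I n `<=` J.
Proof.
elim: n J => [|n IH] J hJ h.
  move=> a _; rewrite -[a]mulr1; apply: idealM => //.
  by have := h [::] erefl; rewrite big_nil; apply.
move=> a; apply => // _ [b [c [Ib Ic ->]]].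
apply: (IH [set c | J (b * c)]) Ic.
  split=> /=; first by rewrite mulr0; exact: ideal0.
    by move=> ? ? ? ?; rewrite mulrDr; exact: idealD.
  by move=> d e Je; rewrite mulrCA; exact: idealM.
move=> s ss sI /=; have := h (b :: s); rewrite big_cons /= ss; apply=> // d.
by rewrite inE => /orP[/eqP->|/sI].
Qed.

Lemma ideal_pow_principal I n t k : (forall a, ideal_pow I n a -> exists b, a = t * b) ->
  forall a, ideal_pow I (k * n) a -> exists b, a = t ^+ k * b.
Proof.
have hK k' : ideal [set a | exists b, a = t ^+ k' * b].
  split; first by exists 0; rewrite mulr0.
    by move=> _ _ [a ->] [b ->]; exists (a + b); rewrite mulrDr.
  by move=> a _ [b ->]; exists (a * b); rewrite mulrCA.
move=> h; apply: (ideal_pow_ind (hK k)) => s.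
have prodI l : (forall a, a \in l -> I a) -> ideal_pow I (size l) (\prod_(a <- l) a).
  elim: l => // a l IHl lI; rewrite big_cons; apply: ideal_gen_sub.
  exists a, (\prod_(a <- l) a); split=> //; first exact/lI/mem_head.
  by apply: IHl => b bl; apply: lI; rewrite inE bl orbT.
elim: k s => [|k IH] s ss sI; first by exists (\prod_(a <- s) a); rewrite mul1r.
rewrite -(cat_take_drop n s) big_cat /=.
have [b ->] : exists b, \prod_(a <- take n s) a = t * b.
  apply: h; have := prodI (take n s); rewrite size_takel ?ss ?mulSn ?leq_addr//; apply.
  by move=> a /mem_take /sI.
have [c ->] : exists c, \prod_(a <- drop n s) a = t ^+ k * c.
  by apply: IH => [|a /mem_drop /sI //]; rewrite size_drop ss mulSn addKn.
by exists (b * c); rewrite mulrACA -exprS.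
Qed.

End IdealPowers.

Lemma noetherian_quotient (A B : comPzRingType) (p : {rmorphism A -> B}) :
  (forall b, exists a, p a = b) -> noetherian A -> noetherian B.
Proof.
move=> ps nA I hI.
have hpI (J : set B) : ideal J -> ideal [set a | J (p a)].
  move=> hJ; split=> /= [|a b|a b]; rewrite ?rmorph0 ?rmorphD ?rmorphM.
  - exact: ideal0.
  - exact: idealD.
  - exact: idealM.
have [l [lI lgen]] := nA _ (hpI I hI).
exists (map p l); split=> [_ /mapP[a /lI ? ->]//|J hJ lJ b].
have [a <-] := ps b => Ia; apply: (lgen _ (hpI J hJ)) => // x xl.
by apply: lJ; exact: map_f.
Qed.

(* A noetherian local ring whose maximal ideal is the radical of [(t)]. *)
Definition local_param (S : comPzRingType) (t : S) :=
  [/\ ideal (@nonunits S), noetherian S, nonunits t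
    & forall a, nonunits a -> exists n b, a ^+ n = t * b].

(** * Finite length modulo a parameter, and division in the completed ring *)

Section CompleteLocal.
Variables (S : comPzRingType) (R : completion S) (t : S).
Hypothesis ht : local_param t.

Local Notation m := (@nonunits S).
Local Notation c := (cp_map R).
Local Notation ker := (@cp_ker S R).

(** Modulo t the maximal ideal consists of nilpotent elements, and the quotient is noetherian, so a
    power of it vanishes there. *)
Lemma param_pow : exists n, forall a, ideal_pow m n a -> exists b, a = t * b.
Proof.
have [mI nS mt rad] := ht.
pose J := [set a | exists b, a = t * b].
have hJ : ideal J.
  split; first by exists 0; rewrite mulr0.
    by move=> _ _ [a ->] [b ->]; exists (a + b); rewrite mulrDr.
  by move=> a _ [b ->]; exists (a * b); rewrite mulrCA.
have [Q [p [ps pJ]]] := quotient_ring hJ.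
have [e he] := nil_exponent (noetherian_quotient ps nS).
exists e; apply: ideal_pow_ind => // s ss sm; apply/pJ.
rewrite rmorph_prod -(big_map p xpredT id); apply: he; rewrite ?size_map//.
move=> _ /mapP[a /sm /rad[n [b ab]] ->]; exists n.
by rewrite -rmorphXn ab; apply/pJ; exists b.
Qed.

Lemma ker_le n k : (n <= k)%N -> ker k `<=` ker n.
Proof. by move=> /subnK <-; elim: (k - n)%N => // j IH a /(cp_decr (c := R)); exact: IH. Qed.

(** [cp_complete] only provides limits of sequences from [S]; here each y n is first replaced by an
    approximation from [S] modulo [ker n]. *)
Lemma cp_limit (y : nat -> R) : (forall n, ker n (y n.+1 - y n)) ->
  exists z, forall n, ker n (z - y n).
Proof.
have kI n : ideal (ker n) by exact: cp_ideal.
move=> hy; have [s hs] := choice (fun n => @cp_dense S R n (y n)).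
have hs' n : ideal_pow m n (s n.+1 - s n).
  apply/(@cp_level S R); rewrite rmorphB.
  rewrite (_ : _ - _ = y n.+1 - y n - (y n.+1 - c (s n.+1)) + (y n - c (s n))).
    by apply: idealD => //; apply: idealB => //; exact/cp_decr/hs.
  by ring.
have [z hz] := @cp_complete S R s hs'.
exists z => n; rewrite -(subrKA (c (s n))) -[_ - y n]opprB.
exact: idealB.
Qed.

Lemma ker_T n : ker n (c t ^+ n).
Proof. by rewrite -rmorphXn; apply/(@cp_level S R)/ideal_pow_exp; case: ht. Qed.

Lemma cp_sep_eq (a b : R) : (forall n, ker n (a - b)) -> a = b.
Proof. by move=> /(@cp_sep S R)/eqP; rewrite subr_eq0 => /eqP. Qed.

Lemma T_series (w : nat -> R) : exists z, forall n,
  ker n (z - \sum_(i < n) c t ^+ i * w i).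
Proof.
apply: cp_limit => n; rewrite big_ord_recr /= addrAC subrr add0r mulrC.
by apply: idealM; [exact: cp_ideal|exact: ker_T].
Qed.

(** The filtration [ker] is finer than the t-adic one. Successive approximations s j of a differ by
    multiples of t^(j+k), and the quotients are summed as a t-adic series. *)
Lemma ker_div : exists n0, forall k a, ker (k * n0) a -> exists d, a = c t ^+ k * d.
Proof.
have kI n : ideal (ker n) by exact: cp_ideal.
(* The successor makes n0 positive, so that (n + k) * n0 is at least n and the approximations
   converge. *)
have [n1 h1] := param_pow; pose n0 := n1.+1.
have h0 a : ideal_pow m n0 a -> exists b, a = t * b by move=> /ideal_powS /h1.
exists n0 => k a ka.
have hS j s : ideal_pow m (j * n0) s -> exists b, s = t ^+ j * b.
  exact: ideal_pow_principal.
have [s hs] := choice (fun j => @cp_dense S R ((j + k) * n0) a).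
have pw j : ideal_pow m (j * n0) `<=` ideal_pow m j.
  have : (j <= j * n0)%N by rewrite leq_pmulr.
  move: (j * n0)%N => J /subnK <-; elim: (J - j)%N => // i IH b /ideal_powS; exact: IH.
have [d0 e0] : exists d, s 0%N = t ^+ k * d.
  apply: hS; apply/(@cp_level S R).
  rewrite -[c _](subKr a) ; apply: idealB => //; exact: (hs 0%N).
have /choice[d hd] : forall j, exists d, s j.+1 - s j = t ^+ (j + k) * d.
  move=> j; apply: hS; apply/(@cp_level S R).
  rewrite rmorphB (_ : _ - _ = (a - c (s j)) - (a - c (s j.+1))).
    apply: idealB => //; apply: ker_le (hs j.+1).
    by rewrite leq_mul2r addSn leqnSn orbT.
  by ring.
have [z hz] := T_series (c \o d).
exists (c d0 + z); apply: cp_sep_eq => n.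
have e n' : s n' = t ^+ k * (d0 + \sum_(i < n') t ^+ i * d i).
  elim: n' => [|n' IH]; first by rewrite big_ord0 addr0.
  by rewrite -(subrK (s n') (s n'.+1)) hd IH big_ord_recr /= exprD; ring.
rewrite -(subrKA (c (s n))) e rmorphM rmorphXn rmorphD rmorph_sum.
apply: idealD => //.
  rewrite -rmorph_sum -rmorphD -rmorphXn -rmorphM -e.
  apply: ker_le (hs n); rewrite mulnS; apply: leq_trans (leq_addr _ _).
  exact: leq_addr.
rewrite -mulrBr; apply: idealM => //; rewrite opprD addrACA subrr add0r.
rewrite -opprB; apply: idealN => //.
rewrite (_ : \sum_(i < n) _ = \sum_(i < n) c t ^+ i * (c \o d) i); first exact: hz.
by apply: eq_bigr => i _; rewrite rmorphM rmorphXn.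
Qed.

(** The ideal of the completed ring generated by t and the images of the elements of [l]. *)
Fixpoint span (l : seq S) : set R :=
  if l is x :: l' then [set y | exists a b, span l' b /\ y = a * c x + b]
  else [set y | exists a, y = c t * a].

(* [good l] makes [span] of the suffixes of [l] a filtration with simple or
   zero quotients. *)
Fixpoint good (l : seq S) : Prop :=
  if l is x :: l' then (forall u, m u -> span l' (c (u * x))) /\ good l' else True.

Lemma spanP l : ideal (span l).
Proof.
elim: l => [|x l IH] /=.
  split; first by exists 0; rewrite mulr0.
    by move=> _ _ [a ->] [b ->]; exists (a + b); rewrite mulrDr.
  by move=> a _ [b ->]; exists (a * b); rewrite mulrCA.
split; first by exists 0, 0; split; [exact: ideal0|rewrite mul0r addr0].
  move=> _ _ [a [b [sb ->]]] [a' [b' [sb' ->]]]; exists (a + a'), (b + b').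
  by split; [exact: idealD|rewrite mulrDl addrACA].
move=> r _ [a [b [sb ->]]]; exists (r * a), (r * b).
by split; [exact: idealM|rewrite mulrDr mulrA].
Qed.

Lemma span_T l a : span l (c t * a).
Proof. by elim: l => [|x l IH] /=; [exists a|exists 0, (c t * a); rewrite mul0r add0r]. Qed.

Lemma span_cons x l : span l `<=` span (x :: l).
Proof. by move=> y sy; exists 0, y; rewrite mul0r add0r. Qed.

(** R/tR has finite length: a power m^n0 lies in (t), and each m^i is generated by finitely many
    elements, which m carries into m^(i+1). The list grows from i = n0 down to i = 0. *)
Lemma composition_series : exists l, good l /\ span l = setT.
Proof.
have [mI nS mt rad] := ht; have [n0 h0] := param_pow.
suff H d : (d <= n0)%N -> exists l, good l /\ forall a, ideal_pow m (n0 - d) a -> span l (c a).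
  have [l [gl sl]] := H n0 (leqnn _); exists l; split=> //.
  apply/seteqP; split=> // a _; rewrite -[a]mulr1.
  apply: (idealM (spanP l)); rewrite -(rmorph1 c).
  by apply: sl; rewrite subnn.
elim: d => [_|d IH dn].
  exists [::]; split=> // a; rewrite subn0 => /h0[b ->]; exists (c b); by rewrite rmorphM.
have [l [gl sl]] := IH (ltnW dn).
have [g [gI ggen]] := nS _ (ideal_powP m (n0 - d.+1)).
have gl' : forall g' , (forall x, x \in g' -> x \in g) ->
    good (g' ++ l) /\ (forall y, span l y -> span (g' ++ l) y).
  elim=> [|x g' IHg] //= h.
  have [IH1 IH2] := IHg (fun y yg => h y (mem_behead (s := x :: g') yg)).
  split; last by move=> y /IH2; exact: span_cons.
  split=> // u mu; apply/IH2/sl; rewrite (_ : (n0 - d)%N = (n0 - d.+1).+1); last first.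
    by rewrite subnS prednK// subn_gt0.
  by apply: ideal_gen_sub; exists u, x; split=> //; exact/gI/h/mem_head.
have [gg1 gg2] := gl' g (fun x h => h); exists (g ++ l); split=> // a.
apply: (ggen [set a | span (g ++ l) (c a)]).
  split=> /=; rewrite ?rmorph0; first exact: (ideal0 (spanP _)).
    by move=> x y; rewrite rmorphD; exact: (idealD (spanP _)).
  by move=> x y; rewrite rmorphM; exact: (idealM (spanP _)).
move=> x; rewrite /=; elim: (g) => //= y g' IHg; rewrite inE => /orP[/eqP->|/IHg]; last exact: span_cons.
exists 1, 0; rewrite mul1r addr0; split=> //; exact: (ideal0 (spanP _)).
Qed.

(** Modulo t the coefficient of x in z comes from [S]. Were it a nonunit, z would lie in [span l];
    so it is a unit, and z generates the layer. *)
Lemma span_exchange x l z : good (x :: l) -> span (x :: l) z -> ~ span l z ->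
  exists w, span l (w * z - c x).
Proof.
move=> [gx gl] [a [b [sb ->]]] nz; have sI := spanP l.
have [s hs] : exists s d, a = c s + c t * d.
  have [n0 h0] := ker_div; have [s hs] := @cp_dense S R (1 * n0) a.
  by have [d hd] := h0 1%N _ hs; exists s, d; rewrite -hd addrC subrK.
case: hs => d ea; subst a.
have [ms|[s1 ss1]] : m s \/ exists s1, s * s1 = 1.
  by have [|h] := pselect (invertible s); [right|left].
  case: nz; rewrite mulrDl -rmorphM -addrA; apply: idealD => //; first exact: gx.
  by apply: idealD => //; rewrite -mulrA; exact: span_T.
have e1 : c s1 * c s = 1 by rewrite -rmorphM mulrC ss1 rmorph1.
exists (c s1); rewrite (_ : _ - _ = c t * (c s1 * d * c x) + c s1 * b + (c s1 * c s - 1) * c x).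
  by rewrite e1 subrr mul0r addr0; apply: idealD => //; [exact: span_T|exact: idealM].
by ring.
Qed.

Lemma cp_acc (J : nat -> set R) : (forall n, ideal (J n)) ->
  (forall n a, J n (c t * a)) -> (forall n, J n `<=` J n.+1) ->
  exists N, forall n, J n `<=` J N.
Proof.
move=> JI JT JS.
have Jle i j : (i <= j)%N -> J i `<=` J j.
  by move=> /subnK <-; elim: (j - i)%N => // k IH a /IH; exact: JS.
have [l [gl sl]] := composition_series.
suff [N hN] : exists N, forall n, J n `&` span l `<=` J N.
  by exists N => n a Ja; apply: (hN n); rewrite sl.
elim: l gl {sl} => [_|x l IH /= gl]; first by exists 0%N => n a [_ [b ->]].
have [N1 hN1] := IH gl.2.
have [[n1 [z [Jz sz nz]]]|no] := pselect (exists n z, [/\ J n z, span (x :: l) z & ~ span l z]).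
  have [w sw] := span_exchange gl sz nz.
  exists (maxn N1 n1) => n y [Jy [a [b [sb ey]]]].
  have Jz' : J (maxn N1 n1) (a * (w * z)).
    by apply: idealM => //; apply: idealM => //; apply: Jle Jz; exact: leq_maxr.
  have : span l (y - a * (w * z)).
    rewrite ey addrAC -mulrBr; apply: (idealD (spanP l) _ sb).
    by rewrite -opprB mulrN; apply: (idealN (spanP l)); apply: (idealM (spanP l)).
  move=> sy; rewrite -(subrK (a * (w * z)) y); apply: idealD => //.
  apply: (Jle _ _ (leq_maxl N1 n1)); apply: (hN1 (maxn n n1)); split=> //.
  apply: idealB => //; first by apply: Jle Jy; exact: leq_maxl.
  by apply: idealM => //; apply: idealM => //; apply: Jle Jz; exact: leq_maxr.
exists N1 => n y [Jy sy]; apply: (hN1 n); split=> //.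
by apply: contrapT => nsy; apply: no; exists n, y.
Qed.

(** Dual to the ascending case: either some [J n] misses the top layer, and so do all later ones, or
    each of them contains a generator of the layer. *)
Lemma cp_dcc (J : nat -> set R) : (forall n, ideal (J n)) ->
  (forall n a, J n (c t * a)) -> (forall n, J n.+1 `<=` J n) ->
  exists N, J N `<=` J N.+1.
Proof.
move=> JI JT JS.
have Jle i j : (i <= j)%N -> J j `<=` J i.
  by move=> /subnK <-; elim: (j - i)%N => // k IH a /JS; exact: IH.
have [l [gl sl]] := composition_series.
suff [N hN] : exists N, forall n, J N `&` span l `<=` J n.
  by exists N => a Ja; apply: hN; rewrite sl.
elim: l gl {sl} => [_|x l IH /= gl]; first by exists 0%N => n a [_ [b ->]].
have [N1 hN1] := IH gl.2.
have [[n1 h1]|yes] := pselect (exists n, forall z, J n z -> span (x :: l) z -> span l z).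
  exists (maxn N1 n1) => n y [Jy sy]; apply: hN1; split.
    by apply: Jle Jy; exact: leq_maxl.
  by apply: h1 => //; apply: Jle Jy; exact: leq_maxr.
exists N1 => n y [Jy sy].
have [z [Jz sz nz]] : exists z, [/\ J (maxn n N1) z, span (x :: l) z & ~ span l z].
  apply: contrapT => h; apply: yes; exists (maxn n N1) => z Jz sz.
  by apply: contrapT => nz; apply: h; exists z.
have [w sw] := span_exchange gl sz nz.
case: sy => a [b [sb ey]].
have Jz' i : (i <= maxn n N1)%N -> J i (a * (w * z)).
  by move=> hi; apply: idealM => //; apply: idealM => //; apply: Jle Jz.
rewrite -(subrK (a * (w * z)) y); apply: idealD => //; last by apply: Jz'; exact: leq_maxl.
apply: hN1; split; first by apply: idealB => //; apply: Jz'; exact: leq_maxr.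
rewrite ey addrAC -mulrBr; apply: (idealD (spanP l) _ sb).
by rewrite -opprB mulrN; apply: (idealN (spanP l)); apply: (idealM (spanP l)).
Qed.

(** The error t p x' has the same shape as p x. Iterating, the partial quotients w form a t-adic
    series whose sum is an exact quotient. *)
Lemma T_iterate (Q : set R) (p q : R) :
  (forall x, Q x -> exists w x', Q x' /\ p * x = q * w + c t * (p * x')) ->
  forall x, Q x -> exists w, p * x = q * w.
Proof.
move=> h x Qx.
have /choice[f /choice[g hfg]] : forall x, exists f w, Q x ->
    Q f /\ p * x = q * w + c t * (p * f).
  move=> y; have [/h[w [f [Qf e]]]|nQ] := pselect (Q y); first by exists f, w.
  by exists 0, 0.
pose xs i := iter i f x.
have Qxs i : Q (xs i) by elim: i => //= i /hfg[].
have [z hz] := T_series (g \o xs).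
exists z; apply: cp_sep_eq => n.
rewrite -(subrKA (q * \sum_(i < n) c t ^+ i * (g \o xs) i)) -mulrBr.
apply: idealD; first exact: cp_ideal; last first.
  rewrite -opprB mulrN; apply: idealN; first exact: cp_ideal.
  by apply: idealM => //; exact: cp_ideal.
suff -> : p * x - q * (\sum_(i < n) c t ^+ i * (g \o xs) i) = p * xs n * c t ^+ n.
  by apply: idealM; [exact: cp_ideal|exact: ker_T].
apply/eqP; rewrite subr_eq; apply/eqP.
elim: n => [|n IH]; first by rewrite big_ord0 mulr0 addr0 mulr1.
rewrite IH (hfg _ (Qxs n)).2 big_ord_recr /= -/(xs n) exprS; ring.
Qed.

(* [Joo n] is the saturation of [b^n] with respect to [t]. Modulo [t] there are
   both chain conditions: the ascending one makes [t^N] work for all of [Joo n],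
   the descending one gives [Joo n = Joo n.+1] up to [t], and completeness, via
   [T_iterate], removes the error terms. Then [b] can be cancelled [n] times. *)
Lemma nonzerodivisor_dvd_T b : nonzerodivisor b -> exists k w, c t ^+ k = b * w.
Proof.
move=> nb.
pose J n k := [set x | exists r, c t ^+ k * x = b ^+ n * r].
pose J' n k := [set x | exists y a, J n k y /\ x = y + c t * a].
pose Joo n := [set x | exists k, J n k x].
pose J'oo n := [set x | exists y a, Joo n y /\ x = y + c t * a].
have JI n k : ideal (J n k).
  split; first by exists 0; rewrite !mulr0.
    by move=> x y [r e] [s f]; exists (r + s); rewrite !mulrDr e f.
  by move=> a x [r e]; exists (a * r); rewrite mulrCA e mulrCA.
have JS n k : J n k `<=` J n k.+1.
  by move=> x [r e]; exists (c t * r); rewrite exprS -mulrA e mulrCA.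
have Jle n i j : (i <= j)%N -> J n i `<=` J n j.
  by move=> /subnK <-; elim: (j - i)%N => // k IH a /IH; exact: JS.
have JooI n : ideal (Joo n).
  split; first by exists 0%N; exact: ideal0.
    move=> x y [i Jx] [j Jy]; exists (maxn i j); apply: idealD => //.
      by apply: Jle Jx; exact: leq_maxl.
    by apply: Jle Jy; exact: leq_maxr.
  by move=> a x [i Jx]; exists i; exact: idealM.
have addT (I : set R) : ideal I -> ideal [set x | exists y a, I y /\ x = y + c t * a].
  move=> hI; split; first by exists 0, 0; rewrite mulr0 addr0; split=> //; exact: ideal0.
    move=> _ _ [y [a [Iy ->]]] [y' [a' [Iy' ->]]]; exists (y + y'), (a + a').
    by split; [exact: idealD|rewrite mulrDr addrACA].
  move=> r _ [y [a [Iy ->]]]; exists (r * y), (r * a).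
  by split; [exact: idealM|rewrite mulrDr [r * (c t * a)]mulrCA].
have Tin (I : set R) a : ideal I -> (exists y a', I y /\ c t * a = y + c t * a').
  by move=> hI; exists 0, a; split; [exact: ideal0|rewrite add0r].
have JooT n x : Joo n (c t * x) -> Joo n x.
  by move=> [k [r e]]; exists k.+1, r; rewrite exprSr -mulrA.
have JooN n : exists N, Joo n = J n N.
  have [N hN] := @cp_acc (J' n) (fun k => addT _ (JI n k)) (fun k a => Tin _ a (JI n k))
    (fun k x => fun '(ex_intro y (ex_intro a (conj Jy e))) =>
       ex_intro _ y (ex_intro _ a (conj (JS _ _ _ Jy) e))).
  exists N; apply/seteqP; split=> x; last by move=> Jx; exists N.
  apply: (@T_iterate (Joo n) (c t ^+ N) (b ^+ n)) => {}x [k Jx].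
  (* Modulo t the chain [J' n] is stationary, so x = y + t a with y in [J n N]. As [Joo n] is
     saturated, a lies in it again, which is the hypothesis of [T_iterate]. *)
  have [y [a [[w ew] exy]]] : J' n N x by apply: (hN k); exists x, 0; rewrite mulr0 addr0.
  exists w, a; split; last by rewrite exy mulrDr ew mulrCA.
  apply: JooT; exists (maxn k N); rewrite (_ : c t * a = x - y); last by rewrite exy addrC addKr.
  apply: idealB => //; first by apply: Jle Jx; exact: leq_maxl.
  by apply: (@Jle _ N); [exact: leq_maxr|exists w].
have Jb n : Joo n.+1 `<=` Joo n.
  by move=> x [k [r e]]; exists k, (b * r); rewrite e exprSr -mulrA.
have [n hn] := @cp_dcc J'oo (fun n => addT _ (JooI n)) (fun n a => Tin _ a (JooI n))
  (fun n x => fun '(ex_intro y (ex_intro a (conj Jy e))) =>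
       ex_intro _ y (ex_intro _ a (conj (Jb _ _ Jy) e))).
have [N JN] := JooN n.+1.
have [w e] : exists w, c t ^+ N * b ^+ n = b ^+ n.+1 * w.
  apply: (@T_iterate (Joo n)); last by exists 0%N, 1; rewrite mulr1 mul1r.
  move=> x Jx; have [y [a [Jy exy]]] : J'oo n.+1 x.
    by apply: hn; exists x, 0; rewrite mulr0 addr0.
  have : J n.+1 N y by rewrite -JN.
  move=> [w ew]; exists w, a; split; last by rewrite exy mulrDr ew mulrCA.
  apply: JooT; rewrite (_ : c t * a = x - y); last by rewrite exy addrC addKr.
  by apply: idealB => //; exact: Jb.
(* From t^N b^n = b^(n+1) w one factor b is cancelled at a time, down to t^N = b w. *)
exists N, w; elim: n e {hn JN} => [|n IH] e; first by rewrite expr0 expr1 mulr1 in e.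
apply: IH; apply/eqP; rewrite -subr_eq0; apply/eqP/nb.
by rewrite mulrBr mulrCA -exprS e [in b ^+ n.+2]exprS -mulrA subrr.
Qed.

Variable F : total_fractions R.
Local Notation tf := (tf_map F).

Lemma fraction_T (z : F) : exists k a, z * tf (c t) ^+ k = tf a.
Proof.
have [a [b [nb e]]] := tf_frac z; have [k [w ew]] := nonzerodivisor_dvd_T nb.
by exists k, (a * w); rewrite -rmorphXn ew !rmorphM mulrA e.
Qed.

(** Multiplication by z is continuous at 0: with z = w / t^k, an element of [ker ((k + n) * n0)] is
    divisible by t^(k+n), and after the division by t^k a factor t^n remains. *)
Lemma mul_local_nbhd (z : F) n : exists k, forall a, ker k a ->
  exists b, ker n b /\ z * tf a = tf b.
Proof.
have [k [w zw]] := fraction_T z; have [n0 h0] := ker_div.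
exists ((k + n) * n0)%N => _ /h0[d ->]; exists (c t ^+ n * (w * d)); split.
  by rewrite mulrC; apply: idealM; [exact: cp_ideal|exact: ker_T].
rewrite exprD !(rmorphM tf) -zw !rmorphXn; ring.
Qed.

End CompleteLocal.

(** * Local rings of schemes *)

(** Compactness speaks of cluster points. Without a finite subcover, the sets containing the
    complement in [Z] of a finite union of members form a proper filter; a member of the cover
    around a cluster point contradicts it. *)
Lemma compact_seq_cover (T : topologicalType) (Z : set T) (P : set (set T)) :
  compact Z -> (forall V, P V -> open V) ->
  (forall z, Z z -> exists V, P V /\ V z) ->
  exists s : seq (set T), (forall V, V \in s -> P V) /\
    forall z, Z z -> exists V, V \in s /\ V z.
Proof.
move=> cZ oP ZP; apply: contrapT => no.
pose F := [set B : set T | exists s : seq (set T), (forall V, V \in s -> P V) /\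
  forall z, Z z -> (forall V, V \in s -> ~ V z) -> B z].
have FF : ProperFilter F.
  apply: Build_ProperFilter_ex => [B [s [sP sB]]|].
    apply: contrapT => nB; apply: no; exists s; split=> // z Zz.
    apply: contrapT => nz; apply: nB; exists z; apply: sB => // V Vs Vz.
    by apply: nz; exists V.
  split.
  - by exists [::].
  - move=> A B [s [sP sA]] [t [tP tB]]; exists (s ++ t); split=> [V|z Zz h].
      by rewrite mem_cat => /orP[/sP|/tP].
    by split; [apply: sA|apply: tB] => // V Vs; apply: h; rewrite mem_cat Vs ?orbT.
  - by move=> A B AB [s [sP sA]]; exists s; split=> // z Zz /(sA _ Zz)/AB.
have FZ : F Z by exists [::].
have [z [Zz cz]] := cZ F FF FZ.
have [V [PV Vz]] := ZP z Zz.
have FV : F (~` V).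
  exists [:: V]; split=> [W|y _ h]; first by rewrite inE => /eqP->.
  by apply: h; rewrite inE.
by have [y []] := cz _ _ FV (open_nbhs_nbhs (conj (oP _ PV) Vz)).
Qed.

Lemma closure1P (T : topologicalType) (x p : T) :
  closure [set x] p <-> forall V, open V -> V p -> V x.
Proof.
split=> [cp V oV Vp|h B]; last first.
  by rewrite nbhsE => -[V [oV Vp] VB]; exists x; split=> //; apply: VB; exact: h oV Vp.
by have [y [/= <- Vy]] := cp V (open_nbhs_nbhs (conj oV Vp)).
Qed.

Lemma open_locally (T : topologicalType) (U : set T) :
  (forall x, U x -> exists V, [/\ open V, V x & V `<=` U]) -> open U.
Proof.
move=> h; rewrite openE => x /h[V [oV Vx VU]].
by apply: (filterS VU); apply: open_nbhs_nbhs.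
Qed.

Section PrimeIdeals.
Variable A : comPzRingType.

(** An ideal maximal among those that contain [I] and avoid the multiplicative set [Sig] is
    prime. *)
Lemma prime_avoiding (I Sig : set A) : ideal I -> Sig 1 ->
  (forall a b, Sig a -> Sig b -> Sig (a * b)) -> I `&` Sig = set0 ->
  exists J, [/\ prime_ideal_set J, I `<=` J & J `&` Sig = set0].
Proof.
move=> hI S1 SM IS.
pose gen X := ideal_gen (X `|` I).
(* Zorn's lemma is applied to arbitrary subsets through the ideals they generate with [I]; the empty
   chain is then covered by the empty set, which generates [I]. *)
pose P := [set X : set A | gen X `&` Sig = set0].
have genS (X Y : set A) : X `<=` Y -> gen X `<=` gen Y.
  move=> XY a ga K hK YK; apply: ga => // b [/XY Yb|Ib]; apply: YK; by [left|right].
have [|M [PM Mmax]] := @Zorn_bigcup A P.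
  move=> F FP Ftot; rewrite /P/=; apply/seteqP; split=> // a [ga Sa].
  have [X [FX gX]] : exists X, (F X \/ X = set0) /\ gen X a.
    apply: (ga [set a | exists X, (F X \/ X = set0) /\ gen X a]).
      split=> /=.
      - by exists set0; split; [right|apply: ideal0; exact: ideal_genP].
      - move=> b c [X [FX gX]] [Y [FY gY]].
        have [Z [FZ [XZ YZ]]] : exists Z, (F Z \/ Z = set0) /\ (X `<=` Z /\ Y `<=` Z).
          case: FX => [FX|->]; last by exists Y; split=> //; split=> //; exact: sub0set.
          case: FY => [FY|->]; last by exists X; split; [left|split=> //; exact: sub0set].
          have [XY|YX] := Ftot _ _ FX FY.
            by exists Y; split; [left|split].
          by exists X; split; [left|split].
        exists Z; split=> //; apply: (idealD (ideal_genP _)); [exact: (genS X Z XZ b gX)|exact: (genS Y Z YZ c gY)].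
      - move=> b c [X [FX gX]]; exists X; split=> //; exact: (idealM (ideal_genP _)).
    move=> b [[X FX Xb]|Ib] /=.
      by exists X; split; [left|apply: ideal_gen_sub; left].
    by exists set0; split; [right|apply: ideal_gen_sub; right].
  suff : (gen X `&` Sig) a.
    case: FX => [/FP PX|->]; first by rewrite PX.
    have : gen set0 `<=` I by move=> b; apply=> // c [].
    by move=> g0 [/g0 Ia _]; have : (I `&` Sig) a by []; rewrite IS.
  by [].
have gM := ideal_genP (M `|` I); rewrite -/(gen M) in gM.
have nP a : ~ gen M a -> exists s r, [/\ Sig s, gen M (s - r * a) & True].
  move=> ga; apply: contrapT => h.
  apply: (Mmax (M `|` [set a])).
    split=> [b|MM]; first by left.
    by apply: ga; apply: ideal_gen_sub; left; apply: MM; right.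
  apply/seteqP; split=> // s [gs Ss].
  have [r gr] : exists r, gen M (s - r * a).
    apply: (gs [set s | exists r, gen M (s - r * a)]).
      split=> /=.
      - by exists 0; rewrite mul0r subr0; exact: (ideal0 gM).
      - move=> x y [r gx] [q gy]; exists (r + q).
        by rewrite mulrDl opprD addrACA; exact: (idealD gM).
      - by move=> x y [r gy]; exists (x * r); rewrite -mulrA -mulrBr; exact: (idealM gM).
    move=> x [[Mx|->]|Ix] /=.
    - by exists 0; rewrite mul0r subr0; apply: ideal_gen_sub; left.
    - by exists 1; rewrite mul1r subrr; exact: (ideal0 gM).
    - by exists 0; rewrite mul0r subr0; apply: ideal_gen_sub; right.
  by apply: h; exists s, r.
exists (gen M); split=> //; last by move=> a Ia; apply: ideal_gen_sub; right.
split=> // [g1|a b gab].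
  by have : (gen M `&` Sig) 1 by []; rewrite PM.
apply: contrapT => /not_orP[na nb].
have [s [r [Ss gs _]]] := nP _ na; have [q [v [Sq gq _]]] := nP _ nb.
have : (gen M `&` Sig) (s * q).
  split; last exact: SM.
  rewrite (_ : s * q = q * (s - r * a) + (r * a) * (q - v * b) + (r * v) * (a * b)); last by ring.
  by apply: (idealD gM); [apply: (idealD gM); exact: (idealM gM)|exact: (idealM gM)].
by rewrite PM.
Qed.

End PrimeIdeals.

Section SchemeFacts.
Variable X : scheme.

Lemma basic_open_open (U : set X) (f : sec U) : open (basic_open f).
Proof.
apply: open_locally => x [Ux [V [h [oV Vx iV]]]].
exists V; split=> // y Vy; split; first by apply: (h).
by exists V, h.
Qed.

Lemma sec_ext (U : set X) (P : set (set X)) (a b : sec U) :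
  (forall V, P V -> open V) -> \bigcup_(V in P) V = U ->
  (forall V (h : V `<=` U), P V -> res h a = res h b) -> a = b.
Proof.
move=> oP PU ab.
(* [rs_sheaf] takes a family over all subsets, so the restrictions of a are extended by 0 to the V
   not contained in U. *)
pose s V : sec V := if pselect (V `<=` U) is left h then res h a else 0.
have sE V (h : V `<=` U) : s V = res h a.
  rewrite /s; case: pselect => // h'; congr (res _ a); exact: Prop_irrelevance.
have [V W hV hW PV PW|t [_ tu]] := @rs_sheaf X U P oP PU s.
  have VU : V `<=` U by rewrite -PU; exact: bigcup_sup.
  have WU : W `<=` U by rewrite -PU; exact: bigcup_sup.
  have h : V `&` W `<=` U by move=> x [/VU].
  by rewrite (sE V VU) (sE W WU) (res_comp _ _ h) (res_comp _ _ h).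
rewrite -(tu a); last by move=> V h _; rewrite sE.
by apply: tu => V h PV; rewrite sE ab.
Qed.

Lemma sec_set0 (a b : sec (set0 : set X)) : a = b.
Proof. by apply: (@sec_ext _ set0) => //; rewrite bigcup_set0. Qed.

(** On the empty set 1 = 0, and by the description of the sections on D(f) as a localization a power
    of f kills 1. *)
Lemma nilpotent_of_nowhere_inv (U : set X) (f : sec U) : affine_open U ->
  basic_open f = set0 -> exists n, f ^+ n = 0.
Proof.
move=> [_ _ _ _ loc] f0; have [+ _] := loc f; move/(_ 1); rewrite rmorph1.
have e0 : forall (V : set X) (a b : sec V), V = set0 -> a = b.
  by move=> V a b V0; subst V; exact: sec_set0.
move=> h; have [|n] := h; first exact: e0.
by rewrite mulr1 => e; exists n.
Qed.

Lemma inv_atM (U : set X) (f g : sec U) x :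
  inv_at f x -> inv_at g x -> inv_at (f * g) x.
Proof.
move=> [V [h [oV Vx [a fa]]]] [W [h' [oW Wx [b gb]]]].
have hVW : V `&` W `<=` U by move=> y [/h].
have hv : V `&` W `<=` V by move=> ? [].
have hw : V `&` W `<=` W by move=> ? [].
exists (V `&` W), hVW; split=> //; first exact: openI.
exists (res hv a * res hw b); rewrite rmorphM mulrACA.
rewrite -{1}(res_comp h hv hVW) -(res_comp h' hw hVW) -!rmorphM fa gb.
by rewrite !rmorph1 mulr1.
Qed.

Lemma inv_at1 (U : set X) x : open U -> U x -> inv_at (1 : sec U) x.
Proof.
move=> oU Ux; exists U, (@subset_refl _ U); split=> //.
by exists 1; rewrite rmorph1 mulr1.
Qed.

Lemma inv_atX (U : set X) (f : sec U) x n : open U -> U x ->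
  inv_at f x -> inv_at (f ^+ n) x.
Proof.
by move=> oU Ux fx; elim: n => [|n IH]; [exact: inv_at1|rewrite exprS; exact: inv_atM].
Qed.

Lemma point_eq (U : set X) (x y : X) : affine_open U -> U x -> U y ->
  (forall f : sec U, inv_at f x <-> inv_at f y) -> x = y.
Proof.
move=> [_ pr ex _ _] Ux Uy xy; have [z [_ zu]] := ex _ (pr x Ux).
rewrite -(zu x)// -(zu y)//; split=> //; apply/seteqP; split=> f /= nf /xy //.
Qed.

Lemma generic_open (g : X) (V : set X) x : closure [set g] = setT -> open V ->
  V x -> V g.
Proof. by move=> hg oV Vx; apply: (closure1P g x).1 => //; rewrite hg. Qed.

Lemma generic_unique (g g' : X) : closure [set g] = setT ->
  closure [set g'] = setT -> g = g'.
Proof.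
move=> hg hg'; have [U aU Ug] := sch_affine g.
have Ug' : U g' by case: aU => oU _ _ _ _; exact: generic_open hg' oU Ug.
apply: (point_eq aU) => // f; split=> -[V [h [oV Vx i]]]; exists V, h; split=> //.
  exact: generic_open hg' oV Vx.
exact: generic_open hg oV Vx.
Qed.

Lemma irreducible_closure1 (T : topologicalType) (x : T) : irreducible (closure [set x]).
Proof.
split; first by exists x; exact/subset_closure.
move=> Z1 Z2 cZ1 cZ2 h.
have cl (Z : set T) : closed Z -> Z x -> closure [set x] `<=` Z.
  by move=> cZ Zx; rewrite ((closure_id Z).1 cZ); apply: closure_subset => _ ->.
by have [Zx|Zx] := h x (subset_closure (erefl x)); [left|right]; exact: cl.
Qed.

(** Otherwise {p}, the closure of x and the whole space form a chain of three irreducible closed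
    sets. *)
Lemma specialization_dim_one (g p x : X) : dim_one X -> closure [set g] = setT ->
  closed [set p] -> closure [set x] p -> x = p \/ x = g.
Proof.
move=> [_ no] hg cp xp.
have [e|ne] := pselect (closure [set x] `<=` [set p]).
  by left; apply: e; exact: subset_closure.
have [e|ne'] := pselect (closure [set x] = setT).
  by right; exact: generic_unique.
exfalso; apply: no; exists [set p], (closure [set x]), setT; split.
- split=> //; rewrite ((closure_id [set p]).1 cp); exact: irreducible_closure1.
- by split; [exact: closed_closure|exact: irreducible_closure1].
- by split; [exact: closedT|rewrite -hg; exact: irreducible_closure1].
- by split=> // _ ->.
- split=> // h; apply: ne'; apply/seteqP; split=> //.
Qed.

Lemma generic_not_closed (g : X) : dim_one X -> closure [set g] = setT ->
  ~ closed [set g].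
Proof.
move=> [[Z0 [Z1 [[_ [[x Z0x] _]] _ [_ nZ]]]] _] hg cg; apply: nZ => y _.
have e : [set g] = setT by rewrite ((closure_id [set g]).1 cg).
have : [set g] x by rewrite e.
have : [set g] y by rewrite e.
by move=> /= -> <-.
Qed.

End SchemeFacts.

Section StalkFacts.
Variables (X : scheme) (x : X) (S : stalk x) (U : set X) (aU : affine_open U).
Hypotheses (Ux : U x) (oU : open U).

Lemma affine_frac (V : set X) (s : sec V) : open V -> V x ->
  exists (f a : sec U) (hU : basic_open f `<=` U) (hV : basic_open f `<=` V),
    [/\ basic_open f x, inv_at f x & res hU a = res hU f * res hV s].
Proof.
move=> oV Vx; have [_ _ _ base loc] := aU.
have oVU : open (V `&` U) by exact: openI.
have [||f [fx fV]] := base (V `&` U) x oVU; [by move=> y []|by []|].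
have hV : basic_open f `<=` V by move=> y /fV[].
have hU := @basic_open_sub _ _ f.
have [_ /(_ (res hV s))[n [a]]] := loc f.
rewrite (Prop_irrelevance (@basic_open_sub _ _ f) hU) => e.
(* The exponent is n+1 rather than n, so that for n = 0 too the new denominator is a positive power
   of f and its basic open set stays inside [V]. *)
have hh : basic_open (f ^+ n.+1) `<=` basic_open f.
  move=> y [Uy [W [hW [oW Wy [b fb]]]]]; split=> //; exists W, hW; split=> //.
  by exists (res hW f ^+ n * b); rewrite mulrA -exprS -rmorphXn.
have fx' : basic_open (f ^+ n.+1) x.
  by split=> //; apply: inv_atX => //; case: fx.
exists (f ^+ n.+1), (f * a), (@basic_open_sub _ _ (f ^+ n.+1)), (fun y h => hV y (hh y h)).
split=> //; first by case: fx'.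
rewrite -!(res_comp hU hh).
rewrite -[res (fun y h => _) s](res_comp hV hh) (rmorphM (res hU)) e.
by rewrite mulrA -exprS !rmorphM !rmorphXn.
Qed.

Lemma germ_inv (f : sec U) : inv_at f x <-> invertible (germ S oU Ux f).
Proof.
split=> [[V [h [oV Vx [g fg]]]]|[b fb]].
  exists (germ S oV Vx g).
  by rewrite -(germ_res S oU oV Ux Vx h) -rmorphM fg rmorph1.
have [V [oV [Vx [s sb]]]] := germ_surj b.
have oW : open (U `&` V) by exact: openI.
have hU : U `&` V `<=` U by move=> ? [].
have hV : U `&` V `<=` V by move=> ? [].
have Wx : (U `&` V) x by [].
have : germ S oW Wx (res hU f * res hV s - 1) = 0.
  by rewrite rmorphB rmorphM rmorph1 !germ_res sb fb subrr.
move=> /(@germ_inj _ _ _ _ _ _ _)[W [h [oW' Wx']]]; rewrite rmorphB rmorphM rmorph1 => /eqP.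
rewrite subr_eq0 => /eqP e.
have hWU : W `<=` U by move=> y /h[].
exists W, hWU; split=> //; exists (res h (res hV s)).
by rewrite -(res_comp hU h hWU).
Qed.

Lemma stalk_frac (s : S) : exists a f : sec U,
  inv_at f x /\ s * germ S oU Ux f = germ S oU Ux a.
Proof.
have [V [oV [Vx [t <-]]]] := germ_surj s.
have [f [a [hU [hV [fx fi e]]]]] := affine_frac t oV Vx.
exists a, f; split=> //.
have oF := @basic_open_open X U f.
rewrite -(germ_res S oV oF Vx fx hV) -(germ_res S oU oF Ux fx hU a) e rmorphM.
by rewrite (germ_res S oU oF Ux fx hU) mulrC.
Qed.

Lemma germ_eq0 (a : sec U) : germ S oU Ux a = 0 ->
  exists f : sec U, inv_at f x /\ f * a = 0.
Proof.
move=> /(@germ_inj _ _ _ _ _ _ _)[V [h [oV Vx a0]]]; have [_ _ _ base loc] := aU.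
have [|f [fx fV]] := base V x oV h; first by [].
have [/(_ a) + _] := loc f; case.
  rewrite (Prop_irrelevance (@basic_open_sub _ _ f) (fun y hy => h y (fV y hy))).
  by rewrite -(res_comp h fV) a0 rmorph0.
by move=> n e; exists (f ^+ n); split=> //; apply: inv_atX => //; case: fx.
Qed.

Lemma invertibleMl (A : comPzRingType) (a b : A) : invertible (a * b) -> invertible b.
Proof. by move=> [c e]; exists (a * c); rewrite mulrCA mulrA. Qed.

Lemma nonunit_frac (s : S) (a f : sec U) : inv_at f x ->
  s * germ S oU Ux f = germ S oU Ux a -> nonunits s <-> ~ inv_at a x.
Proof.
move=> /germ_inv[g fg] e; rewrite /nonunits/=; split=> h; apply: contra_not h.
  by move=> /germ_inv; rewrite -e mulrC; exact: invertibleMl.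
move=> [b sb]; apply/germ_inv; rewrite -e.
by exists (b * g); rewrite mulrACA sb fg mulr1.
Qed.

Lemma stalk_local : ideal (@nonunits S).
Proof.
have [_ pr _ _ _] := aU; have [pI _ _] := pr x Ux.
split.
- apply/(@nonunit_frac 0 0 1); first exact: inv_at1.
    by rewrite mul0r rmorph0.
  exact: ideal0 pI.
- move=> s t ns nt.
  have [a [f [fx ea]]] := stalk_frac s; have [b [g [gx eb]]] := stalk_frac t.
  apply/(@nonunit_frac _ (g * a + f * b) (f * g)).
  + exact: inv_atM.
  + rewrite rmorphD !rmorphM -ea -eb; ring.
  apply: (idealD pI); apply: (idealM pI).
    exact/(nonunit_frac fx ea).
  exact/(nonunit_frac gx eb).
- by move=> s t nt /invertibleMl.
Qed.

Lemma stalk_noetherian : noetherian (sec U) -> noetherian S.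
Proof.
move=> nA I hI.
have hJ (J : set S) : ideal J -> ideal [set a | J (germ S oU Ux a)].
  move=> hJ; split=> [|a b|a b] /=; rewrite ?rmorph0 ?rmorphD ?rmorphM.
  - exact: ideal0.
  - exact: idealD.
  - exact: idealM.
have [l [lI lgen]] := nA _ (hJ I hI).
exists (map (germ S oU Ux) l); split=> [_ /mapP[a /lI ? ->]//|J JI lJ s Is].
have [a [f [/germ_inv[g fg] e]]] := stalk_frac s.
rewrite -[s]mulr1 -fg mulrA e mulrC; apply: idealM => //.
apply: (lgen _ (hJ J JI)) => [b bl|]; first by apply: lJ; exact: map_f.
by rewrite /= -e; apply: idealMl.
Qed.

End StalkFacts.

(** * Local parameters at closed points *)

Section StalkParam.
Variables (X : scheme) (g : X) (hdim : dim_one X) (hft : finite_type_Z X).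
Hypothesis hg : closure [set g] = setT.
Variables (p : X) (cp : closed [set p]) (S : stalk p).

(** A prime of the local ring that contains t comes from a point specializing to p; it is not the
    general point, where t is invertible, so it is p. Hence the maximal ideal is the radical of
    (t). *)
Lemma exists_param : exists (U : set X) (oU : open U) (Up : U p) (t : sec U),
  [/\ U g, inv_at t g & local_param (germ S oU Up t)].
Proof.
have [_ /(_ p)[U [aU Up fU]]] := hft.
have oU : open U by case: aU.
have Ug : U g by exact: generic_open hg oU Up.
have nA := fin_gen_noetherian fU.
have pg : p <> g by move=> e; subst p; exact: (generic_not_closed hdim hg).
(* Every section invertible at p is invertible at the general point; if the converse held as well,
   the two points would coincide. *)
have [t [tp tg]] : exists t : sec U, ~ inv_at t p /\ inv_at t g.
  apply: contrapT => no; apply: pg; apply: (point_eq aU) => // f; split.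
    by move=> [V [h [oV Vp i]]]; exists V, h; split=> //; exact: generic_open hg oV Vp.
  by move=> fg; apply: contrapT => fp; apply: no; exists f.
exists U, oU, Up, t; split=> //.
have nu (f : sec U) : nonunits (germ S oU Up f) <-> ~ inv_at f p.
  by have e := germ_inv S Up oU f; rewrite /nonunits /= e.
split.
- exact: (@stalk_local _ _ S _ aU Up oU).
- exact: (@stalk_noetherian _ _ S _ aU Up oU).
- exact/nu.
move=> s ns; have [a [f [fp e]]] := stalk_frac aU Up oU s.
have na : ~ inv_at a p by apply/(nonunit_frac fp e).
(* The powers of a times the sections invertible at p: a prime avoiding [Sig] is a point
   specializing to p at which a is invertible. *)
pose Sig := [set b : sec U | exists n h, inv_at h p /\ b = a ^+ n * h].
pose I := [set b : sec U | exists c, b = t * c].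
have hI : ideal I.
  split; first by exists 0; rewrite mulr0.
    by move=> _ _ [u ->] [v ->]; exists (u + v); rewrite mulrDr.
  by move=> u _ [v ->]; exists (u * v); rewrite mulrCA.
have [n [h [c [hp ec]]]] : exists n h c, inv_at h p /\ a ^+ n * h = t * c.
  apply: contrapT => no.
  have [|||J [pJ IJ JS]] := @prime_avoiding _ I Sig hI.
  - by exists 0%N, 1; split; [exact: inv_at1|rewrite mulr1].
  - move=> _ _ [n [h [hp ->]]] [m [k [kp ->]]]; exists (n + m)%N, (h * k); split.
      exact: inv_atM.
    by rewrite mulrACA exprD.
  - apply/seteqP; split=> // _ [[c ->] [n [h [hp ec]]]]; apply: no.
    by exists n, h, c.
  have [_ _ ex base _] := aU.
  have [y [[Uy Jy] _]] := ex J pJ.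
  have yp : closure [set y] p.
    apply/closure1P => V oV Vp.
    have oVU : open (V `&` U) by exact: openI.
    have [||k [[_ kp] kV]] := base (V `&` U) p oVU; [by move=> z []|by []|].
    have ky : inv_at k y.
      apply: contrapT => nk; have : (J `&` Sig) k.
        by split; [rewrite Jy|exists 0%N, k; rewrite mul1r].
      by rewrite JS.
    by have [] := kV y (conj Uy ky).
  have [yE|yE] := specialization_dim_one hdim hg cp yp; subst y.
    have : (J `&` Sig) a.
      by split; [rewrite Jy|exists 1%N, 1; split; [exact: inv_at1|rewrite mulr1]].
    by rewrite JS.
  by have : J t; [apply: IJ; exists 1; rewrite mulr1|rewrite Jy].
have [h' hh'] := (germ_inv S Up oU h).1 hp.
have [f' ff'] := (germ_inv S Up oU f).1 fp.
exists n, (germ S oU Up c * h' * f' ^+ n).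
have e1 : s ^+ n * germ S oU Up f ^+ n * germ S oU Up h = germ S oU Up t * germ S oU Up c.
  by rewrite -exprMn e -rmorphXn -!rmorphM ec.
rewrite !mulrA -e1 -[_ * _ * h']mulrA hh' mulr1.
by rewrite -mulrA -exprMn ff' expr1n mulr1.
Qed.

End StalkParam.

(** * The topology of the adelic groups *)

Section Adeles.
Variables (X : scheme) (hdim : dim_one X) (hft : finite_type_Z X).
Variable D : adelic_data X.

Definition fin_supp (n : closed_pt X -> nat) := finite_set [set p | n p <> 0%N].
Definition adele_nbhd (n : closed_pt X -> nat) : set (adele D) :=
  [set y | forall p, local_nbhd (n p) (ad_proj D p y)].

(** t is invertible at the general point, hence in F, and [ad_diagP] carries its inverse to F_p. *)
Lemma ad_param (p : closed_pt X) : exists t : ad_loc D p,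
  local_param t /\ invertible (tf_map (ad_Fp D p) (cp_map (ad_cp D p) t)).
Proof.
have [U [oU [Up [t [Ug tg ht]]]]] :=
  exists_param hdim hft (ad_genP D) (svalP p) (ad_loc D p).
exists (germ (ad_loc D p) oU Up t); split=> //.
rewrite -(ad_diagP (a0 := D) oU Ug).
have [b tb] := (germ_inv (ad_F D) Ug oU t).1 tg.
by exists (ad_proj D p (ad_diag D b)); rewrite -!rmorphM tb !rmorph1.
Qed.

Lemma local_nbhdB p n (y z : ad_Fp D p) :
  local_nbhd n y -> local_nbhd n z -> local_nbhd n (y - z).
Proof.
move=> [a ka <-] [b kb <-]; exists (a - b); last by rewrite rmorphB.
by apply: idealB => //; exact: cp_ideal.
Qed.

Lemma local_nbhd0 p n : local_nbhd n (0 : ad_Fp D p).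
Proof. by exists 0; [exact: (ideal0 (@cp_ideal _ _ n))|rewrite rmorph0]. Qed.

Lemma local_nbhd_sep p (y : ad_Fp D p) : (forall n, local_nbhd n y) -> y = 0.
Proof.
move=> h; have [a ka ay] := h 0%N; rewrite -ay.
rewrite (cp_sep (c := ad_cp D p) (a := a)) ?rmorph0// => n.
by have [b kb by_] := h n; rewrite (_ : a = b)//; apply: (@tf_inj _ (ad_Fp D p)); rewrite ay.
Qed.

Lemma local_nbhd0M p n (y z : ad_Fp D p) :
  (exists b, y = tf_map (ad_Fp D p) b) -> local_nbhd n z -> local_nbhd n (y * z).
Proof.
move=> [b ->] [a ka <-]; exists (b * a); last by rewrite rmorphM.
by apply: idealM => //; exact: cp_ideal.
Qed.

Lemma adele_nbhd0 n : adele_nbhd n 0.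
Proof. by move=> p; rewrite rmorph0; exact: local_nbhd0. Qed.

Lemma adele_nbhdB n y z : adele_nbhd n y -> adele_nbhd n z -> adele_nbhd n (y - z).
Proof. by move=> hy hz p; rewrite rmorphB; exact: local_nbhdB. Qed.

Lemma adele_nbhdD n y z : adele_nbhd n y -> adele_nbhd n z -> adele_nbhd n (y + z).
Proof.
move=> hy hz; rewrite -[z]opprK; apply: adele_nbhdB => //.
by rewrite -sub0r; apply: adele_nbhdB => //; exact: adele_nbhd0.
Qed.

Lemma adele_nbhd_le n m : (forall p, (n p <= m p)%N) -> adele_nbhd m `<=` adele_nbhd n.
Proof. by move=> nm y hy p; exact: local_nbhdS (hy p). Qed.

Lemma fin_supp_max n m : fin_supp n -> fin_supp m -> fin_supp (fun p => maxn (n p) (m p)).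
Proof.
move=> fn fm.
apply: (@sub_finite_set _ _ ([set p | n p <> 0%N] `|` [set p | m p <> 0%N])).
  by move=> p /=; case: (n p) => [|?]; case: (m p) => [|?] // _;
    [right|left|left].
by rewrite finite_setU.
Qed.

Lemma fin_supp0 : fin_supp (fun=> 0%N).
Proof. by rewrite /fin_supp [X in finite_set X](_ : _ = set0)//; apply/seteqP; split. Qed.

(** At almost all p the component of z is integral and the level n p can be kept; the finitely many
    others are treated by [mul_local_nbhd]. *)
Lemma adele_nbhdM (z : adele D) n : fin_supp n -> exists m, fin_supp m /\
  forall y, adele_nbhd m y -> adele_nbhd n (z * y).
Proof.
move=> fn.
have /choice[m hm] : forall p, exists k,
    (forall y, local_nbhd k y -> local_nbhd (n p) (ad_proj D p z * y)) /\
    ((exists b, ad_proj D p z = tf_map (ad_Fp D p) b) -> k = n p).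
  move=> p; have [iz|niz] := pselect (exists b, ad_proj D p z = tf_map (ad_Fp D p) b).
    by exists (n p); split=> // y; exact: local_nbhd0M.
  have [t [ht _]] := ad_param p.
  have [k hk] := mul_local_nbhd ht (ad_proj D p z) (n p).
  by exists k; split=> // y [a /hk[b [kb e]] <-]; exists b.
exists m; split; last by move=> y hy p; rewrite rmorphM; exact: (hm p).1.
have fz := (ad_restricted (a0 := D) (fun p => ad_proj D p z)).1 (ex_intro _ z (fun=> erefl)).
apply: (@sub_finite_set _ _ ([set p | n p <> 0%N] `|`
  [set p | ~ exists b, ad_proj D p z = tf_map (ad_Fp D p) b])).
  move=> p /= mp; have [iz|niz] := pselect (exists b, ad_proj D p z = tf_map (ad_Fp D p) b).
    by left; rewrite -(hm p).2.
  by right.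
by rewrite finite_setU; split.
Qed.

Lemma adele_openE (W : set (adele D)) : open W = adele_open W.
Proof. by []. Qed.

Lemma adele_nbhd_open n (x : adele D) : fin_supp n -> open [set y : adele D | adele_nbhd n (y - x)].
Proof.
move=> fn; rewrite adele_openE => y hy; exists n; split=> // z hz.
rewrite /= -(subrKA y); apply: adele_nbhdD => // p.
by rewrite rmorphB; exact: hz.
Qed.

Lemma adele_sep (x y : adele D) : x <> y -> exists n, fin_supp n /\ ~ adele_nbhd n (x - y).
Proof.
move=> xy; apply: contrapT => no; apply: xy; apply: (@ad_proj_inj _ D) => p.
apply/eqP; rewrite -subr_eq0 -rmorphB; apply/eqP/local_nbhd_sep => k.
apply: contrapT => nk; apply: no.
pose n q := if pselect (q = p) then k else 0%N.
exists n; split=> [|/(_ p)]; last by rewrite /n; case: pselect.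
apply: (@sub_finite_set _ _ [set p]); last exact: finite_set1.
by move=> q /=; rewrite /n; case: pselect.
Qed.

Variable G : affGroup.
Implicit Types x y g : apts D G.

Definition apts_nbhd (l : seq (gring G)) (n : closed_pt X -> nat) x : set (apts D G) :=
  [set y | forall a, a \in l -> adele_nbhd n (y a - x a)].

Lemma apts_nbhd_cat l l' n n' x : 
  apts_nbhd (l ++ l') (fun p => maxn (n p) (n' p)) x `<=`
  apts_nbhd l n x `&` apts_nbhd l' n' x.
Proof.
move=> y h; split=> a al.
  apply: (adele_nbhd_le (m := fun p => maxn (n p) (n' p))) => [p|]; first exact: leq_maxl.
  by apply: h; rewrite mem_cat al.
apply: (adele_nbhd_le (m := fun p => maxn (n p) (n' p))) => [p|]; first exact: leq_maxr.
by apply: h; rewrite mem_cat al orbT.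
Qed.

Let ev : apts D G -> prod_topology (fun _ : gring G => adele D) := fun x a => x a.

(** The initial topology made explicit: finitely many coordinates and a single level function
    suffice. For the direct implication, these sets generate a filter that converges to x in the
    product. *)
Lemma apts_openP (O : set (apts D G)) : open O <->
  forall x, O x -> exists l n, fin_supp n /\ apts_nbhd l n x `<=` O.
Proof.
split=> [oO x Ox|h]; last first.
  apply: open_locally => x /h[l [n [fn lO]]].
  exists (apts_nbhd l n x); split=> //; last by move=> a _; rewrite subrr; exact: adele_nbhd0.
  have -> : apts_nbhd l n x =
      [set y | forall a, a \in l -> (ev @^-1` (proj a @^-1` [set z | adele_nbhd n (z - x a)])) y].
    by [].
  elim: l {lO} => [|b l IH].
    rewrite (_ : mkset _ = setT); first exact: openT.
    by apply/seteqP; split=> // y _ a.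
  rewrite (_ : mkset _ = (ev @^-1` (proj b @^-1` [set z | adele_nbhd n (z - x b)])) `&`
    [set y | forall a, a \in l -> (ev @^-1` (proj a @^-1` [set z | adele_nbhd n (z - x a)])) y]).
    apply: openI => //; have oW := @adele_nbhd_open n (x b) fn.
    have c1 : continuous (proj b : prod_topology (fun _ : gring G => adele D) -> adele D).
      by move=> f; exact: (@proj_continuous (gring G) (fun _ => adele D : topologicalType) b f).
    move/continuousP in c1.
    have c2 := (continuousP _).1 (@initial_continuous (pts (gring G) (adele D)) _ ev).
    exact: (c2 _ (c1 _ oW)).
  apply/seteqP; split=> y /=.
    move=> hy; split; first by apply: (hy b); exact: mem_head.
    by move=> a al; apply: (hy a); rewrite inE al orbT.
  by move=> [hb hl] a; rewrite inE => /orP[/eqP->//|/hl].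
pose F : set_system (apts D G) := [set B | exists l n, fin_supp n /\ apts_nbhd l n x `<=` B].
have FF : Filter F.
  split.
  - by exists [::], (fun=> 0%N); split=> //; exact: fin_supp0.
  - move=> A B [l [n [fn lA]]] [l' [n' [fn' lB]]].
    exists (l ++ l'), (fun p => maxn (n p) (n' p)); split; first exact: fin_supp_max.
    by move=> y /apts_nbhd_cat[/lA ? /lB].
  - by move=> A B AB [l [n [fn lA]]]; exists l, n; split=> // y /lA/AB.
have cF : (ev @ F)%classic --> ev x.
  apply/cvg_sup => a V [B [[W oW <-] Wx WV]].
  rewrite nbhs_filterE /= in WV *.
  have [n [fn nW]] := oW (x a) Wx.
  exists [:: a], n; split=> // y hy; apply: WV => /=; apply: nW => p.
  by have := hy a (mem_head _ _) p; rewrite rmorphB.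
have [V oV VO] := oO.
have : F (ev @^-1` V).
  apply: cF; apply: open_nbhs_nbhs; split=> //.
  by have : (ev @^-1` V) x by rewrite VO.
by rewrite VO.
Qed.

End Adeles.

(** * Continuity of translations, and the open subgroup G(O) *)

Section GroupTopology.
Variables (X : scheme) (hdim : dim_one X) (hft : finite_type_Z X).
Variables (D : adelic_data X) (G : affGroup).
Implicit Types x y g : apts D G.

(** Made for translations by a fixed element: by [gmul_formula] their coordinates are linear
    combinations of coordinates with constant adelic coefficients, so continuity of multiplication
    by a fixed adele is enough. *)
Lemma affine_map_continuous (Phi : apts D G -> apts D G) :
  (forall a, exists s : seq (adele D * gring G),
     forall y, Phi y a = \sum_(c <- s) c.1 * y c.2) ->
  forall O, open O -> open (Phi @^-1` O).
Proof.
move=> hPhi O /apts_openP hO; apply/apts_openP => y /hO[l [n [fn lO]]].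
have one a : exists l' n', fin_supp n' /\
    apts_nbhd l' n' y `<=` [set z | adele_nbhd n (Phi z a - Phi y a)].
  have [s hs] := hPhi a.
  have {hs} hs z : Phi z a - Phi y a = \sum_(c <- s) c.1 * (z c.2 - y c.2).
    by rewrite !hs -sumrB; apply: eq_bigr => c _; rewrite mulrBr.
  have [l' [n' [fn' h]]] : exists l' n', fin_supp n' /\
      apts_nbhd l' n' y `<=` [set z | adele_nbhd n (\sum_(c <- s) c.1 * (z c.2 - y c.2))].
    elim: s {hs} => [|c s [l' [n' [fn' IH]]]].
      exists [::], (fun=> 0%N); split=> [|z _]; first exact: fin_supp0.
      by rewrite /= big_nil; exact: adele_nbhd0.
    have [m [fm hm]] := adele_nbhdM hdim hft c.1 fn.
    exists ([:: c.2] ++ l'), (fun p => maxn (m p) (n' p)); split; first exact: fin_supp_max.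
    move=> z /apts_nbhd_cat[z1 /IH z2] /=; rewrite big_cons; apply: adele_nbhdD => //.
    by apply/hm/z1; rewrite inE.
  by exists l', n'; split=> // z /h; rewrite /= -hs.
suff [l' [n' [fn' h]]] : exists l' n', fin_supp n' /\
    apts_nbhd l' n' y `<=` [set z | apts_nbhd l n (Phi y) (Phi z)].
  by exists l', n'; split=> // z /h /lO.
elim: l {lO} => [|a l [l' [n' [fn' IH]]]].
  by exists [::], (fun=> 0%N); split=> //; exact: fin_supp0.
have [l1 [n1 [fn1 h1]]] := one a.
exists (l1 ++ l'), (fun p => maxn (n1 p) (n' p)); split; first exact: fin_supp_max.
move=> z /apts_nbhd_cat[/h1 z1 /IH z2] b /=; rewrite inE => /orP[/eqP->//|]; exact: z2.
Qed.

Lemma mulg_open g (O : set (apts D G)) : open O -> open [set y : apts D G | O (gmul g y)].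
Proof.
apply: (@affine_map_continuous (fun y => gmul g y)) => a.
have [s hs] := gmul_formula (adele D) a.
exists [seq (g c.1, c.2) | c <- s] => y; rewrite big_map; exact: hs.
Qed.

Lemma gmul_open g (O : set (apts D G)) : open O -> open [set y : apts D G | O (gmul y g)].
Proof.
apply: (@affine_map_continuous (fun y => gmul y g)) => a.
have [s hs] := gmul_formula (adele D) a.
exists [seq (g c.2, c.1) | c <- s] => y; rewrite big_map hs /=.
by apply: eq_bigr => c _; rewrite mulrC.
Qed.

Lemma translLE g (A : set (apts D G)) : translL g A = [set y : apts D G | A (gmul (ginv g) y)].
Proof.
apply/seteqP; split=> [_ [y Ay <-]|y Ay]; first by rewrite /= gmulKg.
by exists (gmul (ginv g) y) => //; rewrite gmulVKg.
Qed.

Lemma translRE g (A : set (apts D G)) : translR A g = [set y : apts D G | A (gmul y (ginv g))].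
Proof.
apply/seteqP; split=> [_ [y Ay <-]|y Ay]; first by rewrite /= gmulgK.
by exists (gmul y (ginv g)) => //; rewrite gmulgVK.
Qed.

Lemma translL_gone (A : set (apts D G)) : translL (gone G (adele D)) A = A.
Proof.
by apply/seteqP; split=> [_ [u ? <-]|u ?]; [rewrite gmul1g|exists u; rewrite ?gmul1g].
Qed.

Lemma translR_gone (A : set (apts D G)) : translR A (gone G (adele D)) = A.
Proof.
by apply/seteqP; split=> [_ [u ? <-]|u ?]; [rewrite gmulg1|exists u; rewrite ?gmulg1].
Qed.

Lemma translL_open g (A : set (apts D G)) : open A -> open (translL g A).
Proof. by rewrite translLE; exact: mulg_open. Qed.

Lemma translR_open g (A : set (apts D G)) : open A -> open (translR A g).
Proof. by rewrite translRE; exact: gmul_open. Qed.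

Lemma eval_nbhd_open a n (z : adele D) : fin_supp n ->
  open [set y : apts D G | adele_nbhd n (y a - z)].
Proof.
move=> fn; apply/apts_openP => y hy; exists [:: a], n; split=> // x hx /=.
by rewrite -(subrKA (y a)); apply: adele_nbhdD => //; apply: hx; rewrite inE.
Qed.

Lemma apts_hausdorff : hausdorff_space (apts D G).
Proof.
move=> x y cxy; apply: contrapT => xy.
have [a xya] : exists a, x a <> y a.
  apply: contrapT => no; apply: xy; apply: rmorph_ext => a.
  by apply: contrapT => xa; apply: no; exists a.
have [n [fn nn]] := adele_sep xya; apply: nn.
have nx (z : apts D G) : nbhs z [set u : apts D G | adele_nbhd n (u a - z a)].
  apply: open_nbhs_nbhs; split; first exact: eval_nbhd_open.
  by rewrite /= subrr; exact: adele_nbhd0.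
have [u [ux uy]] := cxy _ _ (nx x) (nx y).
rewrite (_ : x a - y a = (u a - y a) - (u a - x a)); last by ring.
exact: adele_nbhdB.
Qed.

Lemma sub_A_closed (U : set (gring G)) : closed (sub_A U : set (apts D G)).
Proof.
rewrite -openC; apply: open_locally => x nx.
have [a [Ua xa]] : exists a, U a /\ x a <> 0.
  apply: contrapT => no; apply: nx => a Ua; apply: contrapT => xa; apply: no.
  by exists a.
have [n [fn nn]] := adele_sep xa; rewrite subr0 in nn.
exists [set y : apts D G | adele_nbhd n (y a - x a)]; split.
- exact: eval_nbhd_open.
- by rewrite /= subrr; exact: adele_nbhd0.
- move=> y hy Uy; apply: nn; move: hy; rewrite /= Uy// => h.
  rewrite -[x a]opprK -[- x a]sub0r -[- _]sub0r.
  by apply: adele_nbhdB => //; exact: adele_nbhd0.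
Qed.

(** [cp_ker 0] is the whole completed ring, since it contains the image of the local ring, whose
    zeroth ideal power is everything, and this image is dense. *)
Lemma adele_intE : @adele_int X D = adele_nbhd (fun=> 0%N).
Proof.
apply/seteqP; split=> y hy p; last by have [a _ <-] := hy p; exists a.
have [b ->] := hy p; exists b => //.
have [s hs] := @cp_dense _ (ad_cp D p) 0%N b.
rewrite -(subrK (cp_map (ad_cp D p) s) b); apply: idealD => //.
  exact: cp_ideal.
by apply/(@cp_level _ (ad_cp D p)).
Qed.

Lemma adele_intM (y z : adele D) : adele_int y -> adele_int z -> adele_int (y * z).
Proof. by move=> hy hz p; have [a ea] := hy p; have [b eb] := hz p; exists (a * b); rewrite !rmorphM ea eb. Qed.

Lemma adele_intD (y z : adele D) : adele_int y -> adele_int z -> adele_int (y + z).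
Proof. by move=> hy hz p; have [a ea] := hy p; have [b eb] := hz p; exists (a + b); rewrite !rmorphD ea eb. Qed.

Lemma adele_int_int (n : int) : adele_int (n%:~R : adele D).
Proof. by move=> p; exists n%:~R; rewrite !rmorph_int. Qed.

Lemma GO_subgroup : subgroup (GO D G).
Proof.
split.
(* The unit is already defined over Z, so its coordinates are integers. *)
- move=> a; rewrite -(push_one G (intmul 1 : {rmorphism int -> adele D})).
  exact: adele_int_int.
- move=> x y hx hy a; have [s ->] := gmul_formula (adele D) a.
  elim: s => [|c s IH]; first by rewrite big_nil; exact: (adele_int_int 0).
  by rewrite big_cons; apply: adele_intD => //; exact: adele_intM.
- move=> x hx a.
  (* x is the image of the universal point, so the coordinates of its inverse are values of x on
     elements of Z[G]. *)
  have -> : x = push x (idfun : {rmorphism gring G -> gring G}) by exact: rmorph_ext.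
  by rewrite -push_inv; exact: hx.
Qed.

Lemma GO_open : fin_gen_Z (gring G) -> open (GO D G).
Proof.
move=> [l hl]; apply/apts_openP => x hx; exists l, (fun=> 0%N); split.
  exact: fin_supp0.
move=> y hy; apply: hl => [n|a al|a b|a b].
- by rewrite rmorph_int; exact: adele_int_int.
- rewrite -(subrK (x a) (y a)); apply: adele_intD => //.
  by rewrite adele_intE; exact: hy.
- by rewrite rmorphD; exact: adele_intD.
- by rewrite rmorphM; exact: adele_intM.
Qed.

End GroupTopology.

(** * Integrals of locally constant functions *)

Section PartitionIntegral.
Context (d : measure_display) (T : measurableType d) (R : realType).
Variable mu : {measure set T -> \bar R}.

(** The pieces need to cover the domain only up to a null set; this matters for the Jordan parts of
    a charge, whose cosets cover only its support. *)
Lemma partition_integral (D : set T) (Ds : seq (set T)) (phi : T -> R)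
    (r : set T -> R) :
  measurable D -> (mu D < +oo)%E -> measurable_fun D phi ->
  (forall A, A \in Ds -> measurable A) -> uniq Ds ->
  (forall A B, A \in Ds -> B \in Ds -> A <> B -> A `&` B = set0) ->
  mu [set x | D x /\ forall A, A \in Ds -> ~ A x] = 0%E ->
  (forall A x, A \in Ds -> D x -> A x -> phi x = r A) ->
  mu.-integrable D (EFin \o phi) /\
  Rintegral mu D phi = \sum_(A <- Ds) r A * fine (mu (D `&` A)).
Proof.
elim: Ds D => [|A Ds IH] D mD fD mphi mDs uDs dDs nDs hphi.
  have D0 : mu D = 0%E by rewrite -nDs; congr (mu _); apply/seteqP; split=> [x Dx|x []].
  split; first by apply: null_set_integrable => //; exact/measurable_EFinP.
  by rewrite big_nil /Rintegral null_set_integral//; exact/measurable_EFinP.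
have mA : measurable A by apply: mDs; exact: mem_head.
have mDA : measurable (D `&` A) by exact: measurableI.
have mDA' : measurable (D `\` A) by exact: measurableD.
have AD x B : B \in Ds -> A x -> ~ B x.
  move=> BDs Ax Bx; have AB : A <> B.
    by move=> AB; move: uDs; rewrite /= AB BDs.
  have : (A `&` B) x by [].
  by rewrite (dDs A B) ?mem_head// inE BDs orbT.
have [||||||||i1 e1] := IH (D `\` A).
- exact: mDA'.
- by apply: le_lt_trans fD; apply: le_measure; rewrite ?inE//; exact: subDsetl.
- by apply: measurable_funS mphi => //; exact: subDsetl.
- by move=> B BDs; apply: mDs; rewrite inE BDs orbT.
- by case/andP: uDs.
- by move=> B C BDs CDs; apply: dDs; rewrite inE ?BDs ?CDs orbT.
- rewrite -nDs; congr (mu _); apply/seteqP; split=> x.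
    move=> [[Dx Ax] h]; split=> // B; rewrite inE => /orP[/eqP->//|]; exact: h.
  move=> [Dx h]; split; first by split=> //; apply: h; exact: mem_head.
  by move=> B BDs; apply: h; rewrite inE BDs orbT.
- by move=> B x BDs [Dx _]; apply: hphi => //; rewrite inE BDs orbT.
have i2 : mu.-integrable (D `&` A) (EFin \o phi).
  apply: (@eq_integrable _ _ _ _ _ mDA (EFin \o cst (r A))).
    by move=> x; rewrite inE => -[Dx Ax] /=; rewrite (hphi A x)// mem_head.
  apply: measurable_bounded_integrable => //.
    by apply: le_lt_trans fD; apply: le_measure; rewrite ?inE//; exact: subIsetl.
  exists `|r A|; split; first exact: num_real.
  by move=> x /ltW hx y _ /=.
have DE : (D `&` A) `|` (D `\` A) = D by exact: setUIDK.
have i3 : mu.-integrable D (EFin \o phi).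
  apply/integrableP; split; first exact/measurable_EFinP.
  have mabs (E : set T) : measurable E -> E `<=` D ->
      measurable_fun E (fun x => `|(EFin \o phi) x|%E).
    move=> mE ED; apply: measurableT_comp => //; apply/measurable_EFinP.
    exact: measurable_funS mphi.
  rewrite -DE ge0_integral_setU//; last 2 first.
  - by rewrite DE; exact: mabs.
  - by apply/disj_setPS => x [[_ Ax] [_ /(_ Ax)]].
  by apply: lte_add_pinfty; [case/integrableP: i2|case/integrableP: i1].
split=> //; rewrite big_cons -{1}DE Rintegral_setU ?DE//; last first.
  apply/disj_setPS => x [[_ Ax] [_ /(_ Ax)]] //.
congr (_ + _).
  rewrite (@eq_Rintegral _ _ _ _ _ (cst (r A))); first by rewrite Rintegral_cst.
  by move=> x; rewrite inE => -[Dx Ax] /=; rewrite (hphi A x)// mem_head.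
rewrite e1 big_seq [RHS]big_seq; apply: eq_bigr => B BDs.
congr (_ * fine (mu _)); apply/seteqP; split=> x; first by move=> [[]].
by move=> [Dx Bx]; split=> //; split=> // Ax; exact: AD Bx.
Qed.

End PartitionIntegral.

Lemma borel_preimage (X X' : scheme) (D : adelic_data X) (D' : adelic_data X')
    (G : affGroup) (rho : apts D G -> apts D' G) :
  (forall O, open O -> open (rho @^-1` O)) ->
  forall Y : set (borelG D' G), measurable Y -> measurable (rho @^-1` Y : set (borelG D G)).
Proof.
move=> ro Y mY; apply: (@smallest_sub _ _ _ [set E | measurable (rho @^-1` E : set (borelG D G))]) mY.
  split=> /=; first by rewrite preimage_set0; exact: measurable0.
  - by move=> A mA; rewrite setTD preimage_setC; exact: measurableC.
  - by move=> F mF; rewrite preimage_bigcup; exact: bigcup_measurable.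
by move=> O /ro oO; exact: sub_sigma_algebra.
Qed.

Section ComplexIntegral.
Variables (X : scheme) (hdim : dim_one X) (hft : finite_type_Z X).
Variables (D : adelic_data X) (G : affGroup) (R : realType).
Local Notation C := (complex R).
Local Notation bG := (borelG D G).
Implicit Types (x y g : apts D G) (phi : apts D G -> C).

Lemma borel_open (O : set (apts D G)) : open O -> measurable (O : set bG).
Proof. by move=> oO; exact: sub_sigma_algebra. Qed.

Lemma borel_closed (O : set (apts D G)) : closed O -> measurable (O : set bG).
Proof.
by rewrite -openC => oO; rewrite -(setCK O); apply: measurableC; exact: borel_open.
Qed.

Lemma compact_borel (Z : set (apts D G)) : compact Z -> measurable (Z : set bG).
Proof.
move=> cZ; apply: borel_closed.
by apply: compact_closed => //; apply: apts_hausdorff.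
Qed.

Definition open_subgroup (K : set (apts D G)) := subgroup K /\ open K.

Definition right_inv (K : set (apts D G)) (T : Type) (phi : apts D G -> T) :=
  forall x k, K k -> phi (gmul x k) = phi x.

Lemma coset1 (K : set (apts D G)) x : subgroup K -> translL x K x.
Proof. by move=> [K1 _ _]; exists (gone G (adele D)) => //; rewrite gmulg1. Qed.

Lemma coset_eq (K : set (apts D G)) x y : subgroup K -> translL x K y ->
  translL x K = translL y K.
Proof.
move=> [K1 KM KV] [k Kk <-]; apply/seteqP; split=> _ [k' Kk' <-].
  by exists (gmul (ginv k) k'); [exact/KM/Kk'/KV|rewrite -gmulA gmulVKg].
by exists (gmul k k'); [exact: KM|rewrite gmulA].
Qed.

Lemma right_inv_open (K : set (apts D G)) T (phi : apts D G -> T) (Y : set T) :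
  open_subgroup K -> right_inv K phi -> open (phi @^-1` Y).
Proof.
move=> [sK oK] ri; apply: open_locally => x Yx; exists (translL x K); split.
- exact: (translL_open hdim hft).
- exact: coset1.
- by move=> _ [k Kk <-]; rewrite /= ri.
Qed.

Lemma right_inv_measurable (K : set (apts D G)) (phi : apts D G -> R) (A : set bG) :
  open_subgroup K -> right_inv K phi -> measurable_fun A (phi : bG -> R).
Proof.
move=> oK ri mA Y _; apply: measurableI => //; apply: borel_open.
exact: right_inv_open oK ri.
Qed.

Definition coset_seq (K : set (apts D G)) (Ds : seq (set (apts D G))) :=
  uniq Ds /\ forall A, A \in Ds -> exists x, A = translL x K.

Lemma coset_seq_disjoint K Ds : subgroup K -> coset_seq K Ds ->
  forall A B, A \in Ds -> B \in Ds -> A <> B -> A `&` B = set0.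
Proof.
move=> sK [_ cDs] A B /cDs[x ->] /cDs[y ->] AB; apply/seteqP; split=> // z [xz yz].
by apply: AB; rewrite (coset_eq sK xz) (coset_eq sK yz).
Qed.

Lemma coset_cover K (Z : set (apts D G)) : open_subgroup K -> compact Z ->
  exists Ds, coset_seq K Ds /\ forall z, Z z -> exists A, A \in Ds /\ A z.
Proof.
move=> [sK oK] cZ.
have [|z _|s [sP sZ]] := compact_seq_cover (P := [set A | exists x, A = translL x K]) cZ.
- by move=> _ [x ->]; exact: (translL_open hdim hft).
- by exists (translL z K); split; [exists z|exact: coset1].
exists (undup s); split; first by split; [exact: undup_uniq|move=> A; rewrite mem_undup; exact: sP].
by move=> z /sZ[A [As Az]]; exists A; rewrite mem_undup.
Qed.

Lemma Complex_sum (I : Type) (s : seq I) (a : I -> R) (z : I -> C) :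
  Complex (\sum_(i <- s) complex.Re (z i) * a i) (\sum_(i <- s) complex.Im (z i) * a i) =
  \sum_(i <- s) (a i)%:C%C * z i.
Proof.
elim: s => [|i s IH]; first by rewrite !big_nil.
rewrite !big_cons -IH; case: (z i) => u v.
by congr Complex; rewrite /=; ring.
Qed.

Definition Cintegrable (mu : {measure set bG -> \bar R}) (A : set bG) phi :=
  mu.-integrable A (EFin \o (fun x => complex.Re (phi x))) /\
  mu.-integrable A (EFin \o (fun x => complex.Im (phi x))).

Lemma Cintegral_partition (mu : {measure set bG -> \bar R}) (A : set bG)
    (Ds : seq (set (apts D G))) phi (z : set (apts D G) -> C) :
  measurable A -> (mu A < +oo)%E ->
  measurable_fun A ((fun x => complex.Re (phi x)) : bG -> R) ->
  measurable_fun A ((fun x => complex.Im (phi x)) : bG -> R) ->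
  (forall B, B \in Ds -> measurable (B : set bG)) -> uniq Ds ->
  (forall B B', B \in Ds -> B' \in Ds -> B <> B' -> B `&` B' = set0) ->
  mu [set x | A x /\ forall B, B \in Ds -> ~ B x] = 0%E ->
  (forall B x, B \in Ds -> A x -> B x -> phi x = z B) ->
  Cintegrable mu A phi /\
  Cintegral mu A phi = \sum_(B <- Ds) (fine (mu (A `&` B)))%:C%C * z B.
Proof.
move=> mA fA mre mim mDs uDs dDs nA val.
have part (F : C -> R) (mF : measurable_fun A ((F \o phi) : bG -> R)) :=
  @partition_integral _ _ _ mu A Ds (F \o phi) (fun B => F (z B)) mA fA mF mDs uDs
  dDs nA (fun B x BDs Ax Bx => congr1 F (val B x BDs Ax Bx)).
have [i1 e1] := part (fun z : C => complex.Re z) mre.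
have [i2 e2] := part (fun z : C => complex.Im z) mim.
by split; [split|rewrite /Cintegral e1 e2 Complex_sum].
Qed.

Lemma coset_integral K (mu : {measure set bG -> \bar R}) (A : set bG) Ds phi
    (rep : set (apts D G) -> apts D G) :
  open_subgroup K -> coset_seq K Ds -> right_inv K phi ->
  measurable A -> (mu A < +oo)%E ->
  mu [set x | A x /\ forall B, B \in Ds -> ~ B x] = 0%E ->
  (forall B, B \in Ds -> B (rep B)) ->
  Cintegrable mu A phi /\
  Cintegral mu A phi = \sum_(B <- Ds) (fine (mu (A `&` B)))%:C%C * phi (rep B).
Proof.
move=> oK cDs ri mA fA nA repP.
have riT (T : Type) (F : C -> T) : right_inv K (F \o phi).
  by move=> x k Kk /=; rewrite ri.
apply: (@Cintegral_partition _ _ _ _ (fun B => phi (rep B)) mA fA _ _ _ cDs.1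
  (coset_seq_disjoint oK.1 cDs) nA).
- exact: right_inv_measurable oK (riT _ (fun z => complex.Re z)).
- exact: right_inv_measurable oK (riT _ (fun z => complex.Im z)).
- move=> B /cDs.2[x ->]; apply: borel_open; apply: (translL_open hdim hft).
  by case: oK.
- move=> B x BDs _; have := repP B BDs; have [y ->] := cDs.2 B BDs.
  by move=> [k Kk <-] [k' Kk' <-]; rewrite !ri.
Qed.

Lemma Cintegral_sum (I : Type) (s : seq I) (mu : {measure set bG -> \bar R})
    (A : set bG) (c : I -> C) (phi : I -> apts D G -> C) : measurable A ->
  (forall i, Cintegrable mu A (phi i)) ->
  Cintegrable mu A (fun x => \sum_(i <- s) c i * phi i x) /\
  Cintegral mu A (fun x => \sum_(i <- s) c i * phi i x) =
  \sum_(i <- s) c i * Cintegral mu A (phi i).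
Proof.
move=> mA hphi; elim: s => [|i s [[IH1 IH2] IH3]].
  rewrite big_nil; have -> : (fun x => \sum_(i <- [::]) c i * phi i x) = (fun=> 0).
    by apply/funext => x; rewrite big_nil.
  split; first by split; exact: integrable0.
  by rewrite /Cintegral /= !Rintegral_cst// !mul0r.
rewrite big_cons -IH3.
set S := fun x => \sum_(i <- s) c i * phi i x in IH1 IH2 *.
have -> : (fun x => \sum_(j <- i :: s) c j * phi j x) = (fun x => c i * phi i x + S x).
  by apply/funext => x; rewrite big_cons.
have [h1 h2] := hphi i; case: (c i) => a b.
have Zl (r : R) (f : apts D G -> R) : mu.-integrable A (EFin \o f) ->
    mu.-integrable A (EFin \o (fun x => r * f x)).
  by move=> /(integrableZl mA r); apply: eq_integrable => // x _ /=; rewrite EFinM.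
have re x : complex.Re (Complex a b * phi i x + S x) =
    (a * complex.Re (phi i x) - b * complex.Im (phi i x)) + complex.Re (S x).
  by case: (phi i x) => u v; case: (S x).
have im x : complex.Im (Complex a b * phi i x + S x) =
    (a * complex.Im (phi i x) + b * complex.Re (phi i x)) + complex.Im (S x).
  by case: (phi i x) => u v; case: (S x).
have ir : mu.-integrable A (EFin \o (fun x => a * complex.Re (phi i x) - b * complex.Im (phi i x))).
  have := integrableB mA (Zl a _ h1) (Zl b _ h2).
  by apply: eq_integrable => // x _ /=; rewrite EFinB.
have ii : mu.-integrable A (EFin \o (fun x => a * complex.Im (phi i x) + b * complex.Re (phi i x))).
  have := integrableD mA (Zl a _ h2) (Zl b _ h1).
  by apply: eq_integrable => // x _ /=; rewrite EFinD.
split.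
  split.
    have := integrableD mA ir IH1.
    by apply: eq_integrable => // x _ /=; rewrite re EFinD.
  have := integrableD mA ii IH2.
  by apply: eq_integrable => // x _ /=; rewrite im EFinD.
have E1 : Rintegral mu A (fun x => complex.Re (Complex a b * phi i x + S x)) =
    (a * Rintegral mu A (fun x => complex.Re (phi i x)) -
     b * Rintegral mu A (fun x => complex.Im (phi i x))) + Rintegral mu A (fun x => complex.Re (S x)).
  under eq_Rintegral do rewrite re.
  by rewrite (RintegralD mA ir IH1) (RintegralB mA (Zl a _ h1) (Zl b _ h2)) !RintegralZl.
have E2 : Rintegral mu A (fun x => complex.Im (Complex a b * phi i x + S x)) =
    (a * Rintegral mu A (fun x => complex.Im (phi i x)) +
     b * Rintegral mu A (fun x => complex.Re (phi i x))) + Rintegral mu A (fun x => complex.Im (S x)).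
  under eq_Rintegral do rewrite im.
  by rewrite (RintegralD mA ii IH2) (RintegralD mA (Zl a _ h2) (Zl b _ h1)) !RintegralZl.
by rewrite /Cintegral E1 E2.
Qed.

End ComplexIntegral.

(** * The Hecke action *)

Section HeckeAction.
Variables (X : scheme) (hdim : dim_one X) (hft : finite_type_Z X).
Variables (D : adelic_data X) (G : affGroup) (R : realType).
Local Notation C := (complex R).
Local Notation bG := (borelG D G).
Implicit Types (x y g : apts D G) (phi f : apts D G -> C) (K : set (apts D G)).

(** The Hahn decomposition may cut through the cosets, but the integrand is constant on each of
    them, so only the difference of the two Jordan parts, the charge of the coset, remains. *)
Lemma charge_integral_cosets K (nu : {charge set bG -> \bar R}) Ds phi
    (rep : set (apts D G) -> apts D G) :
  open_subgroup K -> coset_seq K Ds -> right_inv K phi ->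
  (forall E : set bG, measurable E -> (forall B, B \in Ds -> E `&` B = set0) -> nu E = 0%E) ->
  (forall B, B \in Ds -> B (rep B)) ->
  charge_integral nu phi = \sum_(B <- Ds) (fine (nu B))%:C%C * phi (rep B).
Proof.
move=> oK cDs ri nuDs repP.
have mDs B : B \in Ds -> measurable (B : set bG).
  by move=> /cDs.2[x ->]; apply: borel_open; apply: (translL_open hdim hft); case: oK.
set N := [set x : bG | setT x /\ forall B, B \in Ds -> ~ B x].
have mN : measurable N.
  apply: borel_closed; rewrite -openC; apply: open_locally => x nx.
  have [B [BDs Bx]] : exists B, B \in Ds /\ B x.
    apply: contrapT => no; apply: nx; split=> // B BDs Bx; apply: no.
    by exists B.
  exists B; split=> //; last by move=> y By [_ /(_ B BDs)].
  by have [z ->] := cDs.2 B BDs; apply: (translL_open hdim hft); case: oK.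
(* The charge vanishes on every measurable part of the complement [N], not merely on [N], so both
   Jordan parts vanish there. *)
have N0 (P : set bG) : measurable P -> nu (N `&` P) = 0%E.
  move=> mP; apply: nuDs; first exact: measurableI.
  by move=> B BDs; apply/seteqP; split=> // x [[[_ /(_ B BDs)]]].
rewrite /charge_integral /jpos /jneg.
set h := cid (Hahn_decomposition nu); set h' := cid (projT2 h).
set hP := projT2 h'.
have Npos : jordan_pos hP N = 0%E.
  rewrite jordan_posE cjordan_posE /crestr0 mem_set// /crestr; apply: N0.
  by case: (hP) => -[].
have Nneg : jordan_neg hP N = 0%E.
  rewrite jordan_negE cjordan_negE /crestr0 mem_set// /crestr N0 ?oppe0//.
  by case: (hP) => _ [].
have fin_lt (mu : {finite_measure set bG -> \bar R}) : (mu setT < +oo)%E.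
  by rewrite -ge0_fin_numE// fin_num_measure.
have [_ ->] := coset_integral hdim hft oK cDs ri measurableT
  (fin_lt (jordan_pos hP)) Npos repP.
have [_ ->] := coset_integral hdim hft oK cDs ri measurableT
  (fin_lt (jordan_neg hP)) Nneg repP.
rewrite -sumrB big_seq [RHS]big_seq; apply: eq_bigr => B BDs.
rewrite -mulrBl; congr (_ * _); rewrite !setTI (jordan_decomp hP)//; last exact: mDs.
rewrite /cadd /= cscaleN1 fineD ?fineN ?rmorphB//.
- by rewrite fin_num_measure//; exact: mDs.
- by rewrite fin_numN fin_num_measure//; exact: mDs.
Qed.

(** The conjugate y K y^-1, under which u -> f (u y) is right invariant when f is invariant under
    [K]. *)
Definition conj_set y K : set (apts D G) := [set u | K (gmul (ginv y) (gmul u y))].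

Lemma conj_subgroup y K : open_subgroup K -> open_subgroup (conj_set y K).
Proof.
move=> [[K1 KM KV] oK]; split.
  split; rewrite /conj_set /=.
  - by rewrite gmul1g gmulVg.
  - move=> u v Ku Kv; rewrite (_ : gmul (ginv y) _ =
      gmul (gmul (ginv y) (gmul u y)) (gmul (ginv y) (gmul v y))); first exact: KM.
    by rewrite !gmulA gmulgK.
  - by move=> u /KV; rewrite !ginvM ginvK -gmulA.
have := gmul_open hdim hft y (mulg_open hdim hft (ginv y) oK); congr open.
Qed.

Lemma right_inv_conj y K T (f : apts D G -> T) : right_inv K f ->
  right_inv (conj_set y K) (fun u => f (gmul u y)).
Proof.
move=> ri u v Kv; rewrite -[RHS](ri _ _ Kv); congr f.
by rewrite -!gmulA gmulVKg.
Qed.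

Lemma Bun_fun_right_inv K (f : apts D G -> C) : Bun_fun K f -> right_inv K f.
Proof.
move=> h x k Kk; have := h (gone G (adele D)) x k; rewrite gmul1g; apply=> //.
exists (gone G (ad_F D)) => //.
exact: (@push_one G (ad_F D) (adele D) (ad_diag D)).
Qed.

Lemma Bun_fun_left_inv K (f : apts D G -> C) gam x : subgroup K -> Bun_fun K f ->
  GF gam -> f (gmul gam x) = f x.
Proof. by move=> [K1 _ _] h hg; have := h _ x _ hg K1; rewrite gmulg1. Qed.

Lemma quotient_haar_fin (V Gam : set (apts D G)) (q : quotient_haar R V Gam) :
  (qh_mu q (qh_dom q) < +oo)%E.
Proof.
have [Z cZ dZ] := qh_dom_bounded q.
apply: (le_lt_trans _ (qh_compact q cZ)); apply: le_measure => //; rewrite ?inE.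
  exact: qh_dom_meas.
exact: compact_borel.
Qed.

Lemma quotient_haar_cover (V Gam : set (apts D G)) (q : quotient_haar R V Gam) K :
  open_subgroup K -> exists Ds, coset_seq K Ds /\
    forall z, qh_dom q z -> exists A, A \in Ds /\ A z.
Proof.
move=> oK; have [Z cZ dZ] := qh_dom_bounded q.
have [Ds [cDs hDs]] := coset_cover hdim hft oK cZ.
by exists Ds; split=> // z /dZ/hDs.
Qed.

Definition coset_rep (A : set (apts D G)) : apts D G := xget (gone G (adele D)) A.

Lemma coset_repP K Ds A : subgroup K -> coset_seq K Ds -> A \in Ds -> A (coset_rep A).
Proof.
move=> sK [_ cDs] /cDs[x ->]; rewrite /coset_rep; case: xgetP => // /(_ x) h.
by case: h; exact: coset1.
Qed.

Lemma quotient_integrable (V Gam : set (apts D G)) (q : quotient_haar R V Gam) K phi :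
  open_subgroup K -> right_inv K phi -> Cintegrable (qh_mu q) (qh_dom q) phi.
Proof.
move=> oK ri; have [Ds [cDs hDs]] := quotient_haar_cover q oK.
apply: (coset_integral hdim hft oK cDs ri (qh_dom_meas q) (quotient_haar_fin q) _
  (fun B BDs => coset_repP oK.1 cDs BDs)).1.
rewrite (_ : mkset _ = set0) ?measure0//; apply/seteqP; split=> // x [dx h].
by have [B [BDs Bx]] := hDs x dx; exact: (h B).
Qed.

Section Preservation.
Variables (K : set (apts D G)) (cK : compact_open_subgroup K) (h : hecke R K).

Let oK : open_subgroup K. Proof. by case: cK. Qed.

Let coset_null (nu : {charge set bG -> \bar R}) (Ds : seq (set (apts D G))) :=
  forall E : set bG, measurable E -> (forall B, B \in Ds -> E `&` B = set0) -> nu E = 0%E.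

Let hecke_cosets : exists Ds, [/\ coset_seq K Ds, coset_null (hk_re h) Ds
  & coset_null (hk_im h) Ds].
Proof.
have [[Z1 cZ1 hZ1] [Z2 cZ2 hZ2]] := hk_supp h.
have [Ds [cDs hDs]] := coset_cover hdim hft oK (compactU cZ1 cZ2).
by exists Ds; split=> // E mE hE; [apply: hZ1|apply: hZ2] => //;
  apply/seteqP; split=> // x [Ex Zx]; (have [B [BDs Bx]] : exists A, A \in Ds /\ A x by
    apply: hDs; by [left|right]); rewrite -(hE B BDs).
Qed.

(** The list of cosets covers the compact support of h, so one list and one family of coefficients
    serve all f and g. *)
Lemma hecke_act_sum : exists (Ds : seq (set (apts D G))) (c : set (apts D G) -> C),
  forall f, right_inv K f -> forall g,
  hecke_act h f g = \sum_(B <- Ds) c B * f (gmul g (coset_rep B)).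
Proof.
have [Ds [cDs n1 n2]] := hecke_cosets.
exists Ds, (fun B => (fine (hk_re h B))%:C%C + Complex 0 1 * (fine (hk_im h B))%:C%C).
move=> f ri g; rewrite /hecke_act.
have ri' : right_inv K (fun x => f (gmul g x)) by move=> x k Kk; rewrite gmulA ri.
have repP B := @coset_repP K Ds B oK.1 cDs.
rewrite (charge_integral_cosets oK cDs ri' n1 repP).
rewrite (charge_integral_cosets oK cDs ri' n2 repP).
by rewrite mulr_sumr -big_split /=; apply: eq_bigr => B _; rewrite mulrDl mulrA.
Qed.

(** The substitution x -> k x replaces the cosets of the support by their left translates, which
    have the same charge because h is left invariant under [K]. *)
Lemma hecke_act_right_inv f : right_inv K f -> right_inv K (hecke_act h f).
Proof.
move=> ri g k Kk; have [Ds [cDs n1 n2]] := hecke_cosets.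
have ri' g' : right_inv K (fun x => f (gmul g' x)) by move=> x k' Kk'; rewrite gmulA ri.
have repP B := @coset_repP K Ds B oK.1 cDs.
pose Ds' := map (translL k) Ds.
have tK (A : set (apts D G)) : translL (ginv k) (translL k A) = A.
  apply/seteqP; split=> [_ [_ [x Ax <-] <-]|x Ax]; first by rewrite gmulKg.
  by exists (gmul k x); [exists x|rewrite gmulKg].
have tK' (A : set (apts D G)) : translL k (translL (ginv k) A) = A.
  apply/seteqP; split=> [_ [_ [x Ax <-] <-]|x Ax]; first by rewrite gmulVKg.
  by exists (gmul (ginv k) x); [exists x|rewrite gmulVKg].
have cDs' : coset_seq K Ds'.
  split; first by rewrite map_inj_uniq; [exact: cDs.1|exact: can_inj tK].
  move=> _ /mapP[A /cDs.2[x ->] ->]; exists (gmul k x).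
  apply/seteqP; split=> [_ [_ [y Ky <-] <-]|_ [y Ky <-]].
    by exists y => //; rewrite gmulA.
  by exists (gmul x y); [exists y|rewrite gmulA].
have KV : K (ginv k) by case: oK => -[_ _ KV] _; exact: KV.
have mtr (E : set bG) : measurable E -> measurable (translL (ginv k) E : set bG).
  by rewrite translLE ginvK; apply: borel_preimage => O; exact: (mulg_open hdim hft).
have null' (nu : {charge set bG -> \bar R}) : biinvariant K nu -> coset_null nu Ds -> coset_null nu Ds'.
  move=> bi n E mE hE; rewrite -(bi (ginv k) E KV mE).1; apply: n; first exact: mtr.
  move=> B BDs; rewrite -[B]tK; apply/seteqP; split=> // _ [[x Ex <-] [y By]].
  move=> /(congr1 (gmul k)); rewrite !gmulVKg => e; subst y.
  have : (E `&` translL k B) x by [].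
  by rewrite hE//; exact: map_f.
rewrite /hecke_act.
have rep'P B : B \in Ds' -> B (gmul k (coset_rep (translL (ginv k) B))).
  by move=> /mapP[A ADs ->]; rewrite tK; exists (coset_rep A) => //; exact: repP.
have main (nu : {charge set bG -> \bar R}) : biinvariant K nu -> coset_null nu Ds ->
    charge_integral nu (fun x => f (gmul (gmul g k) x)) = charge_integral nu (fun x => f (gmul g x)).
  move=> bi n; rewrite (charge_integral_cosets oK cDs (ri' _) n repP).
  rewrite (charge_integral_cosets oK cDs' (ri' _) (null' nu bi n) rep'P).
  rewrite big_map big_seq [RHS]big_seq; apply: eq_bigr => B BDs.
  rewrite tK gmulA (bi k B Kk _).1//.
  by have [z ->] := cDs.2 B BDs; apply: borel_open; apply: (translL_open hdim hft); case: oK.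
by rewrite !main//; case: (hk_inv h).
Qed.

Lemma hecke_act_Bun f : Bun_fun K f -> Bun_fun K (hecke_act h f).
Proof.
move=> bf; have ri := Bun_fun_right_inv bf; move=> gam g k hgam Kk.
rewrite (hecke_act_right_inv ri)//; have [Ds [c e]] := hecke_act_sum.
rewrite !e//; apply: eq_bigr => B _; congr (_ * _).
by rewrite -gmulA (Bun_fun_left_inv _ oK.1).
Qed.

(** Stated for an arbitrary pair V, Gam, so that it covers the constant terms E_P and E_P^i
    together. *)
Lemma hecke_act_quotient_integral (V Gam : set (apts D G)) (q : quotient_haar R V Gam) f :
  right_inv K f -> (forall g, quotient_integral q (fun u => f (gmul u g)) = 0) ->
  forall g, quotient_integral q (fun u => hecke_act h f (gmul u g)) = 0.
Proof.
move=> ri h0 g; have [Ds [c e]] := hecke_act_sum.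
have -> : (fun u => hecke_act h f (gmul u g)) =
    (fun u => \sum_(B <- Ds) c B * f (gmul u (gmul g (coset_rep B)))).
  by apply/funext => u; rewrite e//; apply: eq_bigr => B _; rewrite gmulA.
have int B : Cintegrable (qh_mu q) (qh_dom q) (fun u => f (gmul u (gmul g (coset_rep B)))).
  apply: (@quotient_integrable _ _ q (conj_set (gmul g (coset_rep B)) K)).
    exact: conj_subgroup.
  exact: right_inv_conj.
rewrite /quotient_integral (Cintegral_sum _ c (qh_dom_meas q) int).2.
by apply: big1 => B _; rewrite [Cintegral _ _ _]h0 mulr0.
Qed.

End Preservation.
End HeckeAction.

(** * Nilpotent closed embeddings *)

Section ClosedBijections.
Variables (S T : topologicalType) (f : S -> T).
Hypotheses (fc : continuous f) (finj : injective f) (fcl : closed_map f).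

Lemma image_irreducible (Z : set S) : irreducible Z -> irreducible (f @` Z).
Proof.
move=> [[z Zz] irr]; split; first by exists (f z), z.
move=> Z1 Z2 cZ1 cZ2 h.
have [||x Zx|h1|h2] := irr (f @^-1` Z1) (f @^-1` Z2).
- by apply: closed_comp => // x _; exact: fc.
- by apply: closed_comp => // x _; exact: fc.
- by apply: (h (f x)); exists x.
- by left=> _ [x /h1 ? <-].
- by right=> _ [x /h2 ? <-].
Qed.

Lemma image_proper (Z0 Z1 : set S) : Z0 `<` Z1 -> f @` Z0 `<` f @` Z1.
Proof.
move=> [h n]; split; first by move=> _ [x /h Zx <-]; exists x.
by move=> h'; apply: n => x Zx; have [|y Zy /finj <-] := h' (f x); first by exists x.
Qed.

(** If a point is missed, the images of a two-step chain of S are proper closed subsets, and the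
    whole space prolongs the chain beyond dimension one. *)
Lemma closed_embedding_surj : dim_one S -> dim_one T -> irreducible [set: T] ->
  forall y, exists x, f x = y.
Proof.
move=> [[Z0 [Z1 [[c0 i0] [c1 i1] Z01]]] _] [_ no] iT y; apply: contrapT => ny.
apply: no; exists (f @` Z0), (f @` Z1), setT; split.
- by split; [exact: fcl|exact: image_irreducible].
- by split; [exact: fcl|exact: image_irreducible].
- by split=> //; exact: closedT.
- exact: image_proper.
- by split=> // /(_ y I)[x _ e]; apply: ny; exists x.
Qed.

Hypothesis fsurj : forall y, exists x, f x = y.

Lemma dim_one_image : dim_one S -> dim_one T.
Proof.
move=> [[Z0 [Z1 [[c0 i0] [c1 i1] Z01]]] no]; split.
  exists (f @` Z0), (f @` Z1); split; [| |exact: image_proper];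
    by split; [exact: fcl|exact: image_irreducible].
move=> [W0 [W1 [W2 [[c0' j0] [c1' j1] [c2' j2] W01 W12]]]].
have irr (W : set T) : closed W /\ irreducible W -> closed (f @^-1` W) /\ irreducible (f @^-1` W).
  move=> [cW [[w Ww] irr]]; split; first by apply: closed_comp => // x _; exact: fc.
  split; first by have [x e] := fsurj w; exists x; rewrite /= e.
  move=> A B cA cB h.
  have [||v Wv|hA|hB] := irr (f @` A) (f @` B).
  - exact: fcl.
  - exact: fcl.
  - have [x e] := fsurj v; subst v.
    by have [Ax|Bx] := h x Wv; [left|right]; exists x.
  - by left=> x /hA[y Ay /finj <-].
  - by right=> x /hB[y Ay /finj <-].
have pr (W W' : set T) : W `<` W' -> f @^-1` W `<` f @^-1` W'.
  move=> [h n]; split; first by move=> x /h.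
  by move=> h'; apply: n => w Ww; have [x e] := fsurj w; subst w; exact: h'.
by apply: no; exists (f @^-1` W0), (f @^-1` W1), (f @^-1` W2); split;
  [exact: irr|exact: irr|exact: irr|exact: pr|exact: pr].
Qed.

Lemma closed_embedding_open (V : set S) : open V ->
  exists2 W : set T, open W & f @^-1` W = V.
Proof.
move=> oV; exists (~` (f @` (~` V))).
  by rewrite openC; apply: fcl; rewrite closedC.
apply/seteqP; split=> x /= h; first by apply: contrapT => nV; apply: h; exists x.
by move=> [y nV /finj e]; subst y.
Qed.

End ClosedBijections.

(** * The map on stalks of a bijective closed embedding *)

Section StalkMap.
Variables (Y X : scheme) (f : sch_mor Y X).
Variables (y : Y) (x : X) (fy : f y = x) (S : stalk x) (S' : stalk y).

Definition stalk_compat (phi : S -> S') :=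
  forall (U : set X) (oU : open U) (Ux : U x) (Uy : (f @^-1` U) y) (s : sec U),
    phi (germ S oU Ux s) = germ S' (mor_open f oU) Uy (mor_com f oU s).

Lemma germ_mor_res (U V : set X) (oU : open U) (oV : open V) (h : V `<=` U)
    (Uy : (f @^-1` U) y) (Vy : (f @^-1` V) y) (s : sec U) :
  germ S' (mor_open f oV) Vy (mor_com f oV (res h s)) =
  germ S' (mor_open f oU) Uy (mor_com f oU s).
Proof.
have h' : f @^-1` V `<=` f @^-1` U by move=> z /h.
by rewrite (mor_nat oU oV h h') (germ_res S' (mor_open f oU) (mor_open f oV) Uy Vy h').
Qed.

Lemma germ_mor_eq (U V : set X) (oU : open U) (oV : open V) (Ux : U x) (Vx : V x)
    (Uy : (f @^-1` U) y) (Vy : (f @^-1` V) y) (s : sec U) (t : sec V) :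
  germ S oU Ux s = germ S oV Vx t ->
  germ S' (mor_open f oU) Uy (mor_com f oU s) =
  germ S' (mor_open f oV) Vy (mor_com f oV t).
Proof.
move=> e; have oW : open (U `&` V) by exact: openI.
have hU : U `&` V `<=` U by move=> ? [].
have hV : U `&` V `<=` V by move=> ? [].
have Wx : (U `&` V) x by [].
have : germ S oW Wx (res hU s - res hV t) = 0.
  by rewrite rmorphB !germ_res e subrr.
move=> /(@germ_inj _ _ _ _ _ _ _)[W1 [h [oO Ox]]]; rewrite rmorphB => /eqP.
rewrite subr_eq0 => /eqP e'.
have hUO : W1 `<=` U by move=> z /h[].
have hVO : W1 `<=` V by move=> z /h[].
have Oy : (f @^-1` W1) y by rewrite /= fy.
rewrite -(germ_mor_res oU oO hUO Uy Oy) -(germ_mor_res oV oO hVO Vy Oy).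
by rewrite -(res_comp hU h hUO) -(res_comp hV h hVO) e'.
Qed.

Lemma stalk_map : exists phi : {rmorphism S -> S'}, stalk_compat phi.
Proof.
have /choice[phi hphi] : forall s : S, exists s' : S',
    forall (U : set X) (oU : open U) (Ux : U x) (Uy : (f @^-1` U) y) (t : sec U),
    s = germ S oU Ux t -> s' = germ S' (mor_open f oU) Uy (mor_com f oU t).
  move=> s; have [U [oU [Ux [t et]]]] := germ_surj s.
  have Uy : (f @^-1` U) y by rewrite /= fy.
  exists (germ S' (mor_open f oU) Uy (mor_com f oU t)) => V oV Vx Vy u eu.
  by apply: (germ_mor_eq (Ux := Ux) (Vx := Vx)); rewrite et.
have two s t : exists (U : set X) (oU : open U) (Ux : U x) (Uy : (f @^-1` U) y)
    (a b : sec U), s = germ S oU Ux a /\ t = germ S oU Ux b.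
  have [U [oU [Ux [a <-]]]] := germ_surj s; have [V [oV [Vx [b <-]]]] := germ_surj t.
  have oW : open (U `&` V) by exact: openI.
  have hU : U `&` V `<=` U by move=> ? [].
  have hV : U `&` V `<=` V by move=> ? [].
  have Wx : (U `&` V) x by [].
  have Wy : (f @^-1` (U `&` V)) y by rewrite /= fy.
  by exists (U `&` V), oW, Wx, Wy, (res hU a), (res hV b); rewrite !germ_res.
have add : zmod_morphism phi.
  move=> s t; have [U [oU [Ux [Uy [a [b [ea eb]]]]]]] := two s t.
  rewrite (hphi s U oU Ux Uy a ea) (hphi t U oU Ux Uy b eb).
  by rewrite (hphi (s - t) U oU Ux Uy (a - b)) ?rmorphB// ea eb.
have mul : monoid_morphism phi.
  split.
    have [U [oU [Ux [Uy [a [b [ea eb]]]]]]] := two 1 1.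
    by rewrite (hphi 1 U oU Ux Uy 1) ?rmorph1.
  move=> s t; have [U [oU [Ux [Uy [a [b [ea eb]]]]]]] := two s t.
  rewrite (hphi s U oU Ux Uy a ea) (hphi t U oU Ux Uy b eb).
  by rewrite (hphi (s * t) U oU Ux Uy (a * b)) ?rmorphM// ea eb.
pose p : {rmorphism S -> S'} := HB.pack phi
  (GRing.isZmodMorphism.Build _ _ _ add) (GRing.isMonoidMorphism.Build _ _ _ mul).
by exists p => U oU Ux Uy s; exact: hphi.
Qed.

Section Nilpotent.
Hypotheses (emb : closed_embedding f) (surj : forall z, exists w, f w = z).
Variables (phi : {rmorphism S -> S'}) (hphi : stalk_compat phi).

Lemma stalk_map_surj s' : exists s, phi s = s'.
Proof.
case: emb => finj fcl fs.
have [V [oV [Vy [t <-]]]] := germ_surj s'.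
have [U oU UV] := closed_embedding_open finj fcl oV.
subst V; have Uy : U (f y) := Vy.
have [W [oW [h [u [Wy WU e]]]]] := fs U t y oU Uy.
have Wx : W x by rewrite -fy.
exists (germ S oW Wx u); rewrite (hphi oW Wx Wy) e.
exact: germ_res.
Qed.

Lemma not_inv_at0 (Z : scheme) (z : Z) (U : set Z) : ~ inv_at (0 : sec U) z.
Proof.
move=> [V [h [oV Vz [b]]]]; rewrite rmorph0 mul0r => e01.
have [W [oW pr _ _ _] Wz] := sch_affine z.
have [[I0 _ _] _ _] := pr z Wz; apply: I0.
have hV : V `&` W `<=` V by move=> ? [].
have hW : V `&` W `<=` W by move=> ? [].
exists (V `&` W), hW; split=> //; first exact: openI.
by exists 1; rewrite rmorph0 mul0r -(rmorph0 (res hV)) e01 rmorph1.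
Qed.

Lemma inv_at_mor (U : set X) (oU : open U) (s : sec U) (w : Y) :
  inv_at s (f w) -> inv_at (mor_com f oU s) w.
Proof.
move=> [V [h [oV Vw [b sb]]]].
have h' : f @^-1` V `<=` f @^-1` U by move=> z /h.
exists (f @^-1` V), h'; split=> //; first exact: mor_open.
by exists (mor_com f oV b); rewrite -(mor_nat oU oV h h') -rmorphM sb rmorph1.
Qed.

(** The numerator a pulls back to 0 near y. Multiplied by g, which is invertible only inside that
    neighborhood, it is invertible at no point because f is surjective, hence it is nilpotent; g is
    a unit in the stalk. *)
Lemma stalk_map_ker s : phi s = 0 -> nilradical s.
Proof.
case: emb => finj fcl _ phis.
have [U aU Ux] := sch_affine x; have oU : open U by case: aU.
have [a [b [bx e]]] := stalk_frac aU Ux oU s.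
have Uy : (f @^-1` U) y by rewrite /= fy.
have : phi (germ S oU Ux a) = 0 by rewrite -e rmorphM phis mul0r.
rewrite (hphi oU Ux Uy) => /(@germ_inj _ _ _ _ _ _ _)[W' [h' [oW' W'y a0]]].
have [W oW WW'] := closed_embedding_open finj fcl oW'; subst W'.
have oWU : open (W `&` U) by exact: openI.
have Wx : W x by rewrite -fy.
have [_ _ _ base _] := aU.
have [||g [gx gW]] := base (W `&` U) x oWU; [by move=> ? []|by []|].
have [n agn] : exists n, (a * g) ^+ n = 0.
  apply: (nilpotent_of_nowhere_inv aU); apply/seteqP; split=> // z [Uz zi].
  have gz : basic_open g z.
    split=> //; case: zi => V [h [oV Vz [c ec]]]; exists V, h; split=> //.
    by exists (res h a * c); rewrite mulrCA mulrA -rmorphM.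
  have az : inv_at a z.
    case: zi => V [h [oV Vz [c ec]]]; exists V, h; split=> //.
    by exists (res h g * c); rewrite mulrA -rmorphM.
  have [w ew] := surj z; subst z.
  have Ww : (f @^-1` W) w by have [] := gW _ gz.
  have : inv_at (mor_com f oU a) w by exact: inv_at_mor.
  move=> [V [h [oV Vw [c ec]]]].
  have hW : V `&` f @^-1` W `<=` f @^-1` W by move=> ? [].
  have hV : V `&` f @^-1` W `<=` V by move=> ? [].
  have hU : V `&` f @^-1` W `<=` f @^-1` U by move=> ? [/h].
  apply: (@not_inv_at0 Y w (f @^-1` W)); exists (V `&` f @^-1` W), hW; split=> //.
    by apply: openI => //; exact: mor_open.
  exists (res hV c); rewrite -a0 (res_comp h' hW hU) -(res_comp h hV hU).
  by rewrite -rmorphM ec rmorph1.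
have [b' bb'] := (germ_inv S Ux oU b).1 bx.
have [g' gg'] := (germ_inv S Ux oU g).1 gx.2.
exists n.
have -> : s = germ S oU Ux (a * g) * (g' * b').
  by rewrite rmorphM -e -mulrA [germ S oU Ux g * _]mulrA gg' mul1r -mulrA bb' mulr1.
by rewrite exprMn -rmorphXn agn rmorph0 mul0r.
Qed.

Lemma stalk_map_pow n s' : ideal_pow (@nonunits S') n s' ->
  exists2 s, ideal_pow (@nonunits S) n s & phi s = s'.
Proof.
elim: n s' => [|n IH] s' hs'; first by have [s e] := stalk_map_surj s'; exists s.
apply: (hs' [set s' | exists2 s, ideal_pow (@nonunits S) n.+1 s & phi s = s']).
  split=> /=; first by exists 0; [exact: (ideal0 (ideal_powP _ n.+1))|rewrite rmorph0].
    move=> _ _ [s hs <-] [t ht <-]; exists (s + t); last by rewrite rmorphD.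
    exact: (idealD (ideal_powP _ n.+1)).
  move=> a _ [s hs <-]; have [b <-] := stalk_map_surj a.
  by exists (b * s); [exact: (idealM (ideal_powP _ n.+1))|rewrite rmorphM].
move=> _ [a [b [na /IH[t ht <-] ->]]]; have [s es] := stalk_map_surj a; subst a.
exists (s * t); last by rewrite rmorphM.
apply: ideal_gen_sub; exists s, t; split=> // -[u su]; apply: na.
by exists (phi u); rewrite -rmorphM su rmorph1.
Qed.

Lemma stalk_map_param t : local_param t -> local_param (phi t).
Proof.
move=> [mI nS nt rad].
have lift a : nonunits (phi a) -> nonunits a.
  by move=> na [u su]; apply: na; exists (phi u); rewrite -rmorphM su rmorph1.
(* Units lift because the kernel is nil: (1 - a b)^n = 0 makes 1 a multiple of a by the geometric
   sum. *)
have unit a : invertible (phi a) -> invertible a.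
  move=> [b' e]; have [b eb] := stalk_map_surj b'; subst b'.
  have [n en] : nilradical (1 - a * b).
    by apply: stalk_map_ker; rewrite rmorphB rmorphM e rmorph1 subrr.
  have [c ec] : exists c, 1 - (1 - a * b) ^+ n = a * c.
    exists (b * \sum_(i < n) (1 - a * b) ^+ i).
    by rewrite -{1}(expr1n _ n) subrXX subKr mulrA; congr (_ * _); apply: eq_bigr => i _; rewrite expr1n mul1r.
  by exists c; rewrite -ec en subr0.
have [U aU Uy] := sch_affine y; have oU : open U by case: aU.
split.
- exact: stalk_local aU Uy oU.
- exact: (noetherian_quotient stalk_map_surj).
- by move=> /unit.
- move=> a' na'; have [a ea] := stalk_map_surj a'; subst a'.
  have [n [b e]] := rad a (lift a na').
  by exists n, (phi b); rewrite -rmorphM -e rmorphXn.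
Qed.

End Nilpotent.
End StalkMap.

(** The exponent must not depend on the point, as an adele has infinitely many components. It is
    obtained by adding the exponents of a finite affine cover. *)
Lemma stalk_nil_exponent (X : scheme) : finite_type_Z X -> exists e : nat,
  forall (x : X) (S : stalk x) (l : seq S), size l = e ->
    (forall s, s \in l -> nilradical s) -> \prod_(s <- l) s = 0.
Proof.
move=> [cX fX].
pose P := [set U : set X | affine_open U /\ fin_gen_Z (sec U)].
have [||L [LP Lc]] := @compact_seq_cover X setT P cX.
- by move=> U [[]].
- by move=> z _; have [U [aU Uz fU]] := fX z; exists U.
have [e he] : exists e, forall U, U \in L -> forall l : seq (sec U), size l = e ->
    (forall s, s \in l -> nilradical s) -> \prod_(s <- l) s = 0.
  elim: L LP {Lc} => [|U L IH] LP; first by exists 0%N.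
  have [e1 h1] := IH (fun V VL => LP V (mem_behead (s := U :: L) VL)).
  have [_ fU] := LP U (mem_head _ _).
  have [e2 h2] := nil_exponent (fin_gen_noetherian fU).
  exists (e1 + e2)%N => V; rewrite inE => /orP[/eqP->|VL] l sl hl.
    rewrite -(cat_take_drop e2 l) big_cat /= h2 ?mul0r//.
      by rewrite size_takel// sl leq_addl.
    by move=> s /mem_take/hl.
  rewrite -(cat_take_drop e1 l) big_cat /= (h1 V VL) ?mul0r//.
    by rewrite size_takel// sl leq_addr.
  by move=> s /mem_take/hl.
exists e => x S l sl hl.
have [U [UL Ux]] := Lc x I; have [aU _] := LP U UL.
have oU : open U by case: aU.
have [m [sm hm [c [ec ci]]]] : exists m : seq (sec U), [/\ size m = size l,
    forall s, s \in m -> nilradical s &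
    exists c, \prod_(s <- l) s * c = germ S oU Ux (\prod_(a <- m) a) /\ invertible c].
  elim: l hl {sl} => [|s l IH] hl.
    exists [::]; split=> //; exists 1; rewrite !big_nil rmorph1 mulr1; split=> //.
    by exists 1; rewrite mulr1.
  have [m [sm hm [c [ec [c' cc']]]]] := IH (fun t tl => hl t (mem_behead (s := s :: l) tl)).
  have [n sn] := hl s (mem_head _ _).
  have [a [b [bx e0]]] := stalk_frac aU Ux oU s.
  have [b' bb'] := (germ_inv S Ux oU b).1 bx.
  have : germ S oU Ux (a ^+ n) = 0 by rewrite rmorphXn -e0 exprMn sn mul0r.
  move=> /(germ_eq0 aU)[g [gx ga]].
  have [g' gg'] := (germ_inv S Ux oU g).1 gx.
  (* The numerator a is nilpotent only near x; g, a unit in the stalk, satisfies g a^n = 0. The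
     exponent n+1 guarantees a factor g also for n = 0. *)
  exists (g * a :: m); split.
  - by rewrite /= sm.
  - move=> t; rewrite inE => /orP[/eqP->|/hm//]; exists n.+1.
    by rewrite exprMn exprSr exprS mulrACA -mulrA ga !mulr0.
  - exists (germ S oU Ux g * germ S oU Ux b * c); rewrite !big_cons !rmorphM -ec -e0; split; first by ring.
    exists (g' * b' * c'); transitivity ((germ S oU Ux g * g') * (germ S oU Ux b * b') * (c * c')).
      by ring.
    by rewrite gg' bb' cc' !mulr1.
have [c' cc'] := ci.
have : \prod_(s <- l) s * c * c' = 0 by rewrite ec (he U UL) ?rmorph0 ?mul0r// sm.
by rewrite -mulrA cc' mulr1.
Qed.

(** * The map F_p -> F'_p: surjectivity and nilpotent kernel *)

Section LocalFields.
Variables (Y X : scheme) (f : sch_mor Y X).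
Variables (y : Y) (x : X) (fy : f y = x) (S : stalk x) (S' : stalk y).
Hypotheses (emb : closed_embedding f) (surj : forall z, exists w, f w = z).
Variables (phi : {rmorphism S -> S'}) (hphi : stalk_compat f phi).
Variables (A : completion S) (A' : completion S').
Variables (F : total_fractions A) (F' : total_fractions A').
Local Notation tf := (tf_map F).
Local Notation tf' := (tf_map F').
Local Notation c := (cp_map A).
Local Notation c' := (cp_map A').
Variable rho : {rmorphism F -> F'}.
Hypothesis rho_phi : forall s, rho (tf (c s)) = tf' (c' (phi s)).
Hypothesis rho_cont : forall n (z : F), [set tf a | a in cp_ker n] z ->
  [set tf' a | a in cp_ker n] (rho z).

Lemma frac_sep (z : F') : (forall n, [set tf' a | a in cp_ker n] z) -> z = 0.
Proof.
move=> h; have [a ka az] := h 0%N; rewrite -az.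
rewrite (cp_sep (c := A') (a := a)) ?rmorph0// => n.
by have [b kb bz] := h n; rewrite (_ : a = b)//; apply: (@tf_inj _ F'); rewrite az.
Qed.

(** The differences of successive approximations of a' are lifted inside the same powers of the
    maximal ideal, so the lifted series converges, and continuity of [rho] identifies the image of
    its limit. *)
Lemma frac_int_surj (a' : A') : exists a : A, rho (tf a) = tf' a'.
Proof.
have [s' hs'] := choice (fun n => @cp_dense S' A' n a').
have /choice[d hd] : forall n, exists d, ideal_pow (@nonunits S) n d /\ phi d = s' n.+1 - s' n.
  move=> n; have [d hd e] : exists2 d, ideal_pow (@nonunits S) n d & phi d = s' n.+1 - s' n.
    apply: (stalk_map_pow fy emb hphi); apply/(@cp_level _ A'); rewrite rmorphB.
    rewrite (_ : _ - _ = (a' - c' (s' n)) - (a' - c' (s' n.+1))); last by ring.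
    by apply: idealB => //; [exact: cp_ideal|exact/cp_decr].
  by exists d.
have [s0 es0] := stalk_map_surj fy emb hphi (s' 0%N).
pose s n := s0 + \sum_(i < n) d i.
have sS n : s n.+1 = s n + d n by rewrite /s big_ord_recr /= addrA.
have phis n : phi (s n) = s' n.
  elim: n => [|n IH]; first by rewrite /s big_ord0 addr0.
  by rewrite sS rmorphD IH (hd n).2 addrC subrK.
have [n|a ha] := @cp_complete _ A s.
  by rewrite sS addrAC subrr add0r; exact: (hd n).1.
exists a; apply/eqP; rewrite -subr_eq0; apply/eqP/frac_sep => n.
rewrite (_ : _ - _ = rho (tf (a - c (s n))) - tf' (a' - c' (s' n))).
  have [b kb <-] := rho_cont (ex_intro2 _ _ (a - c (s n)) (ha n) erefl : [set tf a | a in cp_ker n] (tf (a - c (s n)))).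
  exists (b - (a' - c' (s' n))); last by rewrite rmorphB.
  by apply: idealB => //; exact: cp_ideal.
by rewrite !rmorphB rho_phi phis; ring.
Qed.

Section Param.
Variables (t : S) (ht : local_param t) (tinv : invertible (tf (c t))).

(** The denominators of F' can be taken to be powers of the image of t, and t itself is invertible
    in F. *)
Lemma frac_surj (z' : F') : exists z : F, rho z = z'.
Proof.
have [k [a' e]] := fraction_T (stalk_map_param fy emb surj hphi ht) z'.
have [a ea] := frac_int_surj a'; have [u tu] := tinv.
exists (tf a * u ^+ k); rewrite rmorphM ea -e -rho_phi -mulrA rmorphXn -exprMn -rmorphM tu.
by rewrite rmorph1 expr1n mulr1.
Qed.

(** Powers of t clear the denominators. Integral elements of the kernel are limits of nilpotent
    elements of the local ring, e of which multiply to 0, so the product lies in every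
    [cp_ker n]. *)
Lemma frac_ker (e : nat) (l : seq F) :
  (forall m : seq S, size m = e -> (forall s, s \in m -> nilradical s) -> \prod_(s <- m) s = 0) ->
  size l = e -> (forall z, z \in l -> rho z = 0) -> \prod_(z <- l) z = 0.
Proof.
move=> he sl hl; have [u tu] := tinv.
have kI n : ideal (@cp_ker _ A n) by exact: cp_ideal.
(* The image of the approximation s lies in the n-th power of the maximal ideal; subtracting a lift
   k of it from the same power leaves an element of the kernel of [phi], which is nilpotent. *)
have intker (a : A) : rho (tf a) = 0 -> forall n, exists v, nilradical v /\ cp_ker n (a - c v).
  move=> ra n; have [s hs] := @cp_dense _ A n a.
  have [k kk ek] : exists2 k, ideal_pow (@nonunits S) n k & phi k = phi s.
    apply: (stalk_map_pow fy emb hphi); have := rho_cont (ex_intro2 _ _ (a - c s) hs erefl : [set tf a | a in cp_ker n] (tf (a - c s))).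
    rewrite !rmorphB ra sub0r rho_phi -rmorphN => -[b kb /(@tf_inj _ F') eb].
    apply/(@cp_level _ A'); rewrite -[c' _]opprK -eb.
    by apply: idealN => //; exact: cp_ideal.
  exists (s - k); split.
    by apply: (stalk_map_ker fy emb surj hphi); rewrite rmorphB ek subrr.
  rewrite rmorphB opprB addrA [a + _]addrC -addrA; apply: idealD => //.
  exact/(@cp_level _ A).
have [m [sm hm [k ek]]] : exists m : seq A, [/\ size m = e,
    forall a, a \in m -> rho (tf a) = 0 &
    exists k, \prod_(z <- l) z * tf (c t) ^+ k = tf (\prod_(a <- m) a)].
  elim: l e hl sl {he} => [|z l IH] e hl sl.
    by exists [::]; split=> //; exists 0%N; rewrite !big_nil rmorph1 mulr1.
  case: e sl => // e [sl].
  have [m [sm hm [k ek]]] := IH e (fun w wl => hl w (mem_behead (s := z :: l) wl)) sl.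
  have [j [a ea]] := fraction_T ht z.
  exists (a :: m); split.
  - by rewrite /= sm.
  - move=> b; rewrite inE => /orP[/eqP->|/hm//].
    by rewrite -ea rmorphM hl ?mem_head// mul0r.
  - by exists (j + k)%N; rewrite !big_cons exprD mulrACA ek ea rmorphM.
have m0 : \prod_(a <- m) a = 0.
  apply: (@cp_sep _ A) => n.
  have [v [sv hv ev]] : exists v : seq S, [/\ size v = size m,
      forall s, s \in v -> nilradical s &
      cp_ker n (\prod_(a <- m) a - c (\prod_(s <- v) s))].
    elim: m hm {sm ek} => [|a m IH] hm.
      by exists [::]; split=> //; rewrite !big_nil rmorph1 subrr; exact: ideal0.
    have [v [sv hv ev]] := IH (fun b bm => hm b (mem_behead (s := a :: m) bm)).
    have [s [ns es]] := intker a (hm a (mem_head _ _)) n.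
    exists (s :: v); split.
    - by rewrite /= sv.
    - by move=> b; rewrite inE => /orP[/eqP->|/hv].
    - rewrite !big_cons rmorphM.
      rewrite (_ : _ - _ = a * (\prod_(a <- m) a - c (\prod_(s <- v) s)) + c (\prod_(s <- v) s) * (a - c s)).
        by apply: idealD => //; apply: idealM.
      by ring.
  by rewrite he ?rmorph0 ?subr0// in ev; rewrite sv sm.
move: ek; rewrite m0 rmorph0 => /(congr1 (fun w => w * u ^+ k)).
by rewrite mul0r -mulrA -exprMn tu expr1n mulr1.
Qed.

End Param.
End LocalFields.

(** * The map A_C -> A_C' *)

Section Reduction.
Variables (Y X : scheme) (f : sch_mor Y X).
Hypotheses (emb : closed_embedding f) (surj : forall z, exists w, f w = z).
Hypotheses (hdX : dim_one X) (hfX : finite_type_Z X).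
Variables (D' : adelic_data Y) (D : adelic_data X).
Variables (r : {rmorphism adele D -> adele D'}) (hr : induced_map f r).

Let finj : injective f. Proof. by case: emb. Qed.

Let up (q : closed_pt Y) : {p : closed_pt X | f (sval q) = sval p}.
Proof.
have cq : closed [set f (sval q)].
  rewrite (_ : [set _] = f @` [set sval q]); first by case: emb => _ h _; apply: h; exact: svalP q.
  by apply/seteqP; split=> [_ ->|_ [_ -> <-]//]; exists (sval q).
by exists (exist _ (f (sval q)) cq).
Qed.

Let down (p : closed_pt X) : {q : closed_pt Y | f (sval q) = sval p}.
Proof.
apply: cid; have [w ew] := surj (sval p).
have cw : closed [set w].
  rewrite (_ : [set w] = f @^-1` [set sval p]).
    by apply: closed_comp => [z _|]; [exact: mor_cont|exact: svalP p].
  apply/seteqP; split=> z /=; first by move=> ->.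
  by rewrite -ew => /finj.
by exists (exist _ w cw).
Qed.

Lemma closed_pt_eq (Z : scheme) (p q : closed_pt Z) : sval p = sval q -> p = q.
Proof. by case: p q => p hp [q hq] /= e; subst q; congr exist; exact: Prop_irrelevance. Qed.

Let upK q : sval (down (sval (up q))) = q.
Proof.
by apply: closed_pt_eq; apply: finj; rewrite (svalP (down _)) -(svalP (up _)).
Qed.

Let downK p : sval (up (sval (down p))) = p.
Proof. by apply: closed_pt_eq; rewrite -(svalP (up _)) (svalP (down _)). Qed.

Lemma local_reduction (p : closed_pt X) (q : closed_pt Y) (e : f (sval q) = sval p) :
  exists (rho : {rmorphism ad_Fp D p -> ad_Fp D' q})
    (phi : {rmorphism ad_loc D p -> ad_loc D' q}),
  [/\ forall a, ad_proj D' q (r a) = rho (ad_proj D p a),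
      stalk_compat f phi,
      forall s, rho (tf_map (ad_Fp D p) (cp_map (ad_cp D p) s)) =
        tf_map (ad_Fp D' q) (cp_map (ad_cp D' q) (phi s))
    & forall n z, local_nbhd n z -> local_nbhd n (rho z)].
Proof.
have [rho [h1 h2 h3]] := hr e.
have [phi hphi] := stalk_map e (ad_loc D p) (ad_loc D' q).
exists rho, phi; split=> // s; have [U [oU [Up [t <-]]]] := germ_surj s.
have Uq : (f @^-1` U) (sval q) by rewrite /= e.
by rewrite (h2 U oU Up Uq) (hphi U oU Up Uq).
Qed.

(** Components are lifted one by one, and integral ones to integral ones, so that the lifts satisfy
    the finiteness condition of the restricted product. *)
Lemma reduction_surj (z' : adele D') : exists z : adele D, r z = z'.
Proof.
(* The local map is only known to exist, so the condition on z is phrased through adeles with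
   component z instead of naming that map. *)
have ex (p : closed_pt X) : exists z : ad_Fp D p,
    (forall a, ad_proj D p a = z ->
       ad_proj D' (sval (down p)) (r a) = ad_proj D' (sval (down p)) z') /\
    ((exists b, ad_proj D' (sval (down p)) z' = tf_map (ad_Fp D' (sval (down p))) b) ->
     exists b, z = tf_map (ad_Fp D p) b).
  have e := svalP (down p).
  have [rho [phi [h1 h2 h3 h4]]] := local_reduction e.
  have [[b eb]|ni] := pselect (exists b, ad_proj D' (sval (down p)) z' =
      tf_map (ad_Fp D' (sval (down p))) b).
    have [a ea] := frac_int_surj e emb h2 h3 h4 b.
    by exists (tf_map (ad_Fp D p) a); split=> [w ew|_]; [rewrite h1 ew ea eb|exists a].
  have [t [ht tinv]] := ad_param hdX hfX D p.
  have [z ez] := frac_surj e emb surj h2 h3 h4 ht tinv (ad_proj D' (sval (down p)) z').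
  by exists z; split=> // w ew; rewrite h1 ew ez.
pose z p := sval (cid (ex p)); have hz p := svalP (cid (ex p)); rewrite -/(z _) in hz.
have fin : finite_set [set p | ~ exists b, z p = tf_map (ad_Fp D p) b].
  have := (ad_restricted (a0 := D') (fun q => ad_proj D' q z')).1 (ex_intro _ z' (fun=> erefl)).
  move=> /(finite_image (fun q => sval (up q))); apply: sub_finite_set => p np.
  exists (sval (down p)); last exact: downK.
  by move=> ib; apply: np; exact: (hz p).2.
have [a ha] := (ad_restricted (a0 := D) z).2 fin.
exists a; apply: (@ad_proj_inj _ D') => q.
by have := (hz (sval (up q))).1 a (ha _); rewrite upK.
Qed.

Lemma reduction_ker : exists e : nat, forall l : seq (adele D), size l = e ->
  (forall a, a \in l -> r a = 0) -> \prod_(a <- l) a = 0.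
Proof.
have [e he] := stalk_nil_exponent hfX; exists e => l sl hl.
apply: (@ad_proj_inj _ D) => p; rewrite rmorph0 rmorph_prod.
rewrite -(big_map (ad_proj D p) xpredT id).
have ep := svalP (down p).
have [rho [phi [h1 h2 h3 h4]]] := local_reduction ep.
have [t [ht tinv]] := ad_param hdX hfX D p.
apply: (frac_ker ep emb surj h2 h3 h4 ht tinv (he _ _)); first by rewrite size_map.
by move=> _ /mapP[a /hl ra ->]; rewrite -h1 ra rmorph0.
Qed.

Lemma reduction_nbhd (n' : closed_pt Y -> nat) : fin_supp n' ->
  exists n, fin_supp n /\ forall y, adele_nbhd n y -> adele_nbhd n' (r y).
Proof.
move=> fn'; exists (fun p => n' (sval (down p))); split.
  move: fn' => /(finite_image (fun q => sval (up q))); apply: sub_finite_set => p np.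
  by exists (sval (down p)) => //; exact: downK.
move=> y hy q; have e := svalP (up q).
have [rho [phi [h1 h2 h3 h4]]] := local_reduction e.
by rewrite h1; apply: h4; have := hy (sval (up q)); rewrite upK.
Qed.

Lemma reduction_int y : adele_int y -> adele_int (r y).
Proof.
rewrite !adele_intE => hy q; have [rho [phi [h1 h2 h3 h4]]] := local_reduction (svalP (up q)).
by rewrite h1; apply: h4; exact: hy.
Qed.

Lemma generic_image : f (ad_gen D') = ad_gen D.
Proof.
apply: generic_unique; last exact: ad_genP.
apply/seteqP; split=> // x _; apply/closure1P => V oV Vx.
have [w ew] := surj x; subst x.
exact: (generic_open (ad_genP D') (mor_open f oV) Vx).
Qed.

(** An element of F is a fraction of sections over an affine neighborhood of any given closed point.
    On sections the two sides agree by compatibility with the comorphism, and the denominator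
    becomes a unit. *)
Lemma reduction_diag : exists psi : {rmorphism ad_F D -> ad_F D'},
  forall s, r (ad_diag D s) = ad_diag D' (psi s).
Proof.
have eg := generic_image.
have [psi hpsi] := stalk_map eg (ad_F D) (ad_F D').
exists psi => s; apply: (@ad_proj_inj _ D') => q.
have e := svalP (up q); set p := sval (up q) in e.
have [rho [h1 h2 h3]] := hr e.
have [V [oV [Vg [u us]]]] := germ_surj s.
have [U aU Up] := sch_affine (sval p); have oU : open U by case: aU.
have Ug : U (ad_gen D) by exact: generic_open (ad_genP D) oU Up.
have [a [b [bg eab]]] := stalk_frac aU Ug oU s.
have Uq : (f @^-1` U) (sval q) by rewrite /= e.
have Ug' : (f @^-1` U) (ad_gen D') by rewrite /= eg.
pose gq (w : sec U) := tf_map (ad_Fp D' q) (cp_map (ad_cp D' q)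
  (germ (ad_loc D' q) (mor_open f oU) Uq (mor_com f oU w))).
have e1 w : ad_proj D' q (ad_diag D' (psi (germ (ad_F D) oU Ug w))) = gq w.
  by rewrite (hpsi U oU Ug Ug') (ad_diagP (a0 := D') (mor_open f oU) Ug' Uq).
have e2 w : ad_proj D' q (r (ad_diag D (germ (ad_F D) oU Ug w))) = gq w.
  by rewrite h1 (ad_diagP (a0 := D) oU Ug Up) (h2 U oU Up Uq).
have [b' bb'] := (germ_inv (ad_F D) Ug oU b).1 bg.
have inv : gq b * ad_proj D' q (ad_diag D' (psi b')) = 1.
  by rewrite -e1 -!rmorphM bb' !rmorph1.
have : ad_proj D' q (r (ad_diag D s)) * gq b = ad_proj D' q (ad_diag D' (psi s)) * gq b.
  by rewrite -{1}e2 -e1 -!rmorphM eab e1 e2.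
move=> /(congr1 (fun w => w * ad_proj D' q (ad_diag D' (psi b')))).
by rewrite -!mulrA inv !mulr1.
Qed.

End Reduction.

(** * Reduction of adelic points of G *)

Section ReductionPoints.
Variables (Y X : scheme) (f : sch_mor Y X).
Hypotheses (emb : closed_embedding f) (surj : forall z, exists w, f w = z).
Hypotheses (hdX : dim_one X) (hfX : finite_type_Z X).
Variables (D' : adelic_data Y) (D : adelic_data X).
Variables (r : {rmorphism adele D -> adele D'}) (hr : induced_map f r).
Variable G : affGroup.

Definition push_adele (x : apts D G) : apts D' G := push r x.

Lemma push_adeleM x y : push_adele (gmul x y) = gmul (push_adele x) (push_adele y).
Proof. exact: gmul_nat. Qed.

Lemma push_adeleV x : push_adele (ginv x) = ginv (push_adele x).
Proof. exact: push_inv. Qed.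

Lemma push_adele1 : push_adele (gone G (adele D)) = gone G (adele D').
Proof. exact: push_one. Qed.

Lemma push_adele_open (O : set (apts D' G)) : open O -> open (push_adele @^-1` O).
Proof.
move=> /apts_openP hO; apply/apts_openP => x /hO[l [n' [fn' lO]]].
have [n [fn hn]] := reduction_nbhd emb surj hr fn'.
exists l, n; split=> // y hy; apply: lO => a al.
by rewrite /= -rmorphB; apply: hn; exact: hy.
Qed.

Lemma push_adele_GO x : GO D G x -> GO D' G (push_adele x).
Proof. by move=> hx a; apply: (reduction_int emb hr); exact: hx. Qed.

Lemma push_adele_F (U : set (gring G)) x : sub_F U x -> sub_F U (push_adele x).
Proof.
move=> [y Uy <-]; have [psi hpsi] := reduction_diag emb surj hr.
exists (push psi y); first by move=> a Ua /=; rewrite Uy// rmorph0.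
by apply: rmorph_ext => a /=; rewrite hpsi.
Qed.

Lemma push_adele_GF x : GF x -> GF (push_adele x).
Proof.
move=> [y _ <-]; have [psi hpsi] := reduction_diag emb surj hr.
exists (push psi y) => //.
by apply: rmorph_ext => a /=; rewrite hpsi.
Qed.

Lemma push_adele_A (U : set (gring G)) x : sub_A U x -> sub_A U (push_adele x).
Proof. by move=> Ux a Ua /=; rewrite Ux// rmorph0. Qed.

Lemma push_adele_surj (U : set (gring G)) (x' : apts D' G) : smooth_sub U ->
  sub_A U x' -> exists x : apts D G, sub_A U x /\ push_adele x = x'.
Proof.
move=> smU Ux'; have [e he] := reduction_ker emb surj hdX hfX hr.
apply: (smooth_lift smU (e := e) (q := r)) => // [z|l sl hl].
  exact: (reduction_surj emb surj hdX hfX hr).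
rewrite -(cat_take_drop e l) big_cat /= he ?mul0r//.
  by rewrite size_takel// sl -addn2 leq_addr.
by move=> a /mem_take/hl.
Qed.

End ReductionPoints.

(** * Haar measures on quotients *)

Section QuotientHaar.
Variables (X : scheme) (hdim : dim_one X) (hft : finite_type_Z X).
Variables (D : adelic_data X) (G : affGroup) (R : realType).
Local Notation bG := (borelG D G).
Implicit Types (x y u v : apts D G) (O : set (apts D G)).
Variables (V Gam : set (apts D G)) (q : quotient_haar R V Gam).
Hypotheses (sV : subgroup V) (sGam : subgroup Gam) (GamV : Gam `<=` V).
Hypotheses (cGam : countable Gam) (clV : closed V).
Local Notation mu := (qh_mu q).
Local Notation dom := (qh_dom q).

Lemma countable_enum : exists (e : nat -> apts D G) (P : set nat), set_bij P Gam e.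
Proof.
have [enc einj] : exists enc : apts D G -> nat, {in Gam &, injective enc}.
  by have /pcard_leP/unsquash f := cGam; exists f; exact: inj.
pose e n := xget (gone G (adele D)) [set g | Gam g /\ enc g = n].
have eE g : Gam g -> e (enc g) = g.
  move=> Gg; rewrite /e; case: xgetP => [h _ [Gh eh]|/(_ g) []//].
  by apply: einj; rewrite ?inE.
exists e, (enc @` Gam); split.
- by move=> _ [g Gg <-] /=; rewrite eE.
- by move=> n m; rewrite !inE => -[g Gg <-] [h Gh <-]; rewrite !eE// => ->.
- by move=> g Gg; exists (enc g); [exists g|exact: eE].
Qed.

Definition orbit_count (Y : set (apts D G)) (u : apts D G) : \bar R :=
  \esum_(g in Gam) (\1_Y (gmul g u))%:E.

Lemma orbit_count_ge0 Y u : (0 <= orbit_count Y u)%E.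
Proof. by apply: esum_ge0 => g _; rewrite lee_fin indicE; case: (_ \in _). Qed.

Lemma orbit_count_left Y u g : Gam g -> orbit_count Y (gmul g u) = orbit_count Y u.
Proof.
have [_ GM GV] := sGam => Gg.
rewrite /orbit_count [RHS](@reindex_esum R _ _ Gam Gam (fun h => gmul h g)).
  by apply: eq_esum => h _; rewrite gmulA.
split.
- by move=> h Gh; exact: GM.
- by move=> h h' _ _ /(congr1 (fun z => gmul z (ginv g))); rewrite !gmulgK.
- by move=> h Gh; exists (gmul h (ginv g)); [exact/GM/GV|rewrite gmulgVK].
Qed.

Lemma orbit_count_eq0 Y u : (forall g, Gam g -> ~ Y (gmul g u)) -> orbit_count Y u = 0%E.
Proof.
by move=> h; apply: esum1 => g /h nY; rewrite indicE memNset.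
Qed.

Lemma orbit_count_gt0 Y u g : Gam g -> Y (gmul g u) -> (1 <= orbit_count Y u)%E.
Proof.
move=> Gg Yg; apply: esum_ge; exists [set g]; first by split=> // _ ->.
by rewrite fsbig_set1 indicE mem_set.
Qed.

Lemma measurable_left (Y : set bG) g : measurable Y -> measurable ([set u | Y (gmul g u)] : set bG).
Proof.
by apply: borel_preimage => O; exact: (mulg_open hdim hft).
Qed.

Lemma qh_supported (Y : set bG) : measurable Y -> mu Y = mu (Y `&` V).
Proof.
move=> mY; have mV : measurable (V : set bG) by exact: borel_closed.
rewrite (measureDI mu mY mV) [X in (X + _)%E](_ : _ = 0%E) ?add0e//.
apply/eqP; rewrite eq_le measure_ge0 andbT -(qh_carried q).
apply: le_measure; rewrite ?inE; [exact: measurableD|exact: measurableC|by move=> ? []].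
Qed.

Lemma orbit_count_series : exists (e : nat -> apts D G) (P : set nat),
  set_bij P Gam e /\ forall Y u, orbit_count Y u =
    (\sum_(n <oo) (if n \in P then (\1_Y (gmul (e n) u))%:E else 0))%E.
Proof.
have [e [P bij]] := countable_enum; exists e, P; split=> // Y u.
rewrite nneseries_esumT; last first.
  by move=> n; case: ifP => // _; rewrite lee_fin indicE; case: (_ \in _).
by rewrite /orbit_count (reindex_esum P Gam e _ bij) esum_mkcond.
Qed.

Lemma measurable_orbit_count (Y E : set bG) : measurable Y ->
  measurable_fun E (orbit_count Y : bG -> \bar R).
Proof.
move=> mY; have [e [P [_ cnt]]] := orbit_count_series.
apply: (@measurable_funS _ _ _ _ setT) => //.
rewrite (_ : orbit_count Y = fun u => (\sum_(n <oo) (if n \in P then (\1_Y (gmul (e n) u))%:E else 0))%E); last first.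
  by apply/funext => u; exact: cnt.
apply: ge0_emeasurable_sum => [n u _ _|n _].
  by case: ifP => // _; rewrite lee_fin indicE; case: (_ \in _).
have [nP|nP] := boolP (n \in P) => /=; last exact: measurable_cst.
apply/measurable_EFinP.
rewrite (_ : (fun u => _) = \1_([set u | Y (gmul (e n) u)])).
  by apply: measurable_indic; exact: measurable_left.
by apply/funext => u; rewrite !indicE.
Qed.

(* [dom] represents the orbits, so [V] is the disjoint union of its translates. *)
Lemma unfolding_esum (Y : set bG) : measurable Y ->
  mu Y = (\esum_(g in Gam) mu ([set u | Y (gmul g u)] `&` dom))%E.
Proof.
move=> mY; have [e [P bij]] := countable_enum.
have [eG einj esurj] := bij.
have md := qh_dom_meas q.
have mL n : measurable ([set u | Y (gmul (e n) u)] : set bG) by exact: measurable_left.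
rewrite (reindex_esum P Gam e _ bij) esum_mkcond -nneseries_esumT; last by move=> n; case: ifP.
rewrite qh_supported//.
have -> : Y `&` V = \bigcup_(n in P) translL (e n) ([set u | Y (gmul (e n) u)] `&` dom).
  apply/seteqP; split=> [y [Yy Vy]|_ [n Pn [u [Yu du] <-]]].
    have [d [[dd [g Gg e1]] _]] := qh_domP q Vy.
    have [n Pn en] := esurj g Gg; exists n => //; exists d; last by rewrite en.
    by split=> //=; rewrite en -e1.
  split=> //; case: sV => _ VM _; apply: VM; last exact: (qh_dom_sub (q := q)).
  exact/GamV/eG.
rewrite measure_bigcup; first last.
- apply/trivIsetP => n m Pn Pm nm; apply/seteqP; split=> // y [[u [_ du] eu] [w [_ dw] ew]].
  have Vy : V y.
    rewrite -eu; case: sV => _ VM _; apply: VM; last exact: (qh_dom_sub (q := q)).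
    exact/GamV/eG.
  have [d [_ dq]] := qh_domP q Vy.
  have du' : d = u by apply: dq; split=> //; exists (e n) => //; exact: eG.
  have dw' : d = w by apply: dq; split=> //; exists (e m) => //; exact: eG.
  move: nm; rewrite (einj n m) ?eqxx//; [exact: mem_set|exact: mem_set|].
  have : gmul (e n) u = gmul (e m) u by rewrite eu -du' dw' ew.
  by move=> /(congr1 (fun z => gmul z (ginv u))); rewrite !gmulgK.
- move=> n _; rewrite translLE; apply: measurable_left.
  exact: measurableI.
rewrite eseries_mkcond; apply: eq_eseriesr => n _.
case: ifPn => // Pn; rewrite qh_invariant//; first exact/GamV/eG/set_mem.
exact: measurableI.
Qed.

Lemma unfolding (Y : set bG) : measurable Y ->
  mu Y = (\int[mu]_(u in dom) orbit_count Y u)%E.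
Proof.
move=> mY; have [e [P [bij cnt]]] := orbit_count_series.
have md := qh_dom_meas q.
under eq_integral do rewrite cnt.
have mL n : measurable ([set u | Y (gmul (e n) u)] : set bG) by exact: measurable_left.
pose t n u : \bar R := if n \in P then (\1_Y (gmul (e n) u))%:E else 0%E.
have tE n : t n = if n \in P then (fun u => (\1_[set u | Y (gmul (e n) u)] u)%:E) else cst 0%E.
  by apply/funext => u; rewrite /t; case: ifP => // _; rewrite !indicE.
rewrite (@integral_nneseries _ _ _ mu _ md t); first last.
- by move=> n u _; rewrite /t; case: ifP => // _; rewrite lee_fin indicE; case: (_ \in _).
- move=> n; rewrite tE; case: ifP => // _.
  by apply/measurable_EFinP; apply: measurable_indic.
rewrite unfolding_esum// (reindex_esum P Gam e _ bij) esum_mkcond -nneseries_esumT; last by move=> n; case: ifP.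
apply: eq_eseriesr => n _; rewrite tE; case: ifP => _; first by rewrite integral_indic.
by rewrite integral0.
Qed.

Lemma qh_dom_pos : (0 < mu dom)%E.
Proof.
rewrite lt0e measure_ge0 andbT; apply/eqP => d0; apply: (qh_nonzero (q := q)).
have mV : measurable (V : set bG) by exact: borel_closed.
rewrite (unfolding_esum mV); apply: esum1 => g _; apply/eqP.
rewrite eq_le measure_ge0 andbT -d0; apply: le_measure; rewrite ?inE.
- by apply: measurableI; [exact: measurable_left|exact: qh_dom_meas].
- exact: qh_dom_meas.
- by move=> ? [].
Qed.

Lemma qh_translL x (Y : set bG) : V x -> measurable Y -> mu (translL x Y) = mu Y.
Proof. by move=> Vx mY; rewrite qh_invariant. Qed.

Lemma fin_partition (E : set bG) (Ws : seq (set (apts D G))) :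
  measurable E -> (mu E < +oo)%E ->
  (forall A, A \in Ws -> measurable (A : set bG)) -> uniq Ws ->
  (forall A B, A \in Ws -> B \in Ws -> A <> B -> A `&` B = set0) ->
  (forall u, E u -> exists A, A \in Ws /\ A u) ->
  fine (mu E) = \sum_(A <- Ws) fine (mu (E `&` A)).
Proof.
move=> mE fE mWs uWs dWs cWs.
have m1 : measurable_fun E (cst 1 : bG -> R) by exact: measurable_cst.
have [|_] := @partition_integral _ _ _ mu E Ws _ (fun=> 1) mE fE
  m1 mWs uWs dWs _ (fun _ _ _ _ _ => erefl).
  rewrite (_ : mkset _ = set0) ?measure0//; apply/seteqP; split=> // u [Eu h].
  by have [A [AW Au]] := cWs u Eu; exact: (h A).
rewrite Rintegral_cst// mul1r => ->.
by apply: eq_bigr => A _; rewrite mul1r.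
Qed.

Section OpenSubgroup.
Variables (O : set (apts D G)) (oO : open_subgroup O) (fO : (mu O < +oo)%E).

Let fdom : (mu dom < +oo)%E. Proof. exact: quotient_haar_fin. Qed.

Let mtr x v : measurable (translR (translL x O) v : set bG).
Proof.
apply: borel_open; apply: (translR_open hdim hft); apply: (translL_open hdim hft).
by case: oO.
Qed.

Let mO : measurable (O : set bG). Proof. by apply: borel_open; case: oO. Qed.

(** Finitely many cosets of [O] cover [dom]. If [O] were null, left invariance would make [dom] null
    as well. *)
Lemma qh_open_pos : (0 < mu O)%E.
Proof.
rewrite lt0e measure_ge0 andbT; apply/eqP => O0.
have [Ds [cDs hDs]] := quotient_haar_cover hdim hft q oO.
have mDs A : A \in Ds -> measurable (A : set bG).
  by move=> /cDs.2[x ->]; apply: borel_open; apply: (translL_open hdim hft); case: oO.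
have := fin_partition (qh_dom_meas q) fdom mDs cDs.1
  (coset_seq_disjoint oO.1 cDs) hDs.
rewrite big1_seq => [|A /= ADs].
  move=> /eqP; rewrite fine_eq0 ?ge0_fin_numE//.
  by have := qh_dom_pos; rewrite lt0e => /andP[/negbTE->].
(* Invariance holds only under V, so the coset is rewritten as y O with y in [dom]. *)
have [[y [dy Ay]]|no] := pselect (exists y, dom y /\ A y); last first.
  by rewrite (_ : _ `&` _ = set0) ?measure0//; apply/seteqP; split=> // y [? ?]; apply: no; exists y.
have -> : mu (dom `&` A) = 0%E; last by [].
apply/eqP; rewrite eq_le measure_ge0 andbT -O0.
have [x Ax] := cDs.2 A ADs.
have AE : A = translL y O by rewrite Ax; apply: (coset_eq oO.1); rewrite -Ax.
rewrite -(qh_translL (qh_dom_sub dy) mO).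
rewrite -AE; apply: le_measure; rewrite ?inE; last by move=> ? [].
  by apply: measurableI; [exact: qh_dom_meas|exact: mDs].
exact: mDs.
Qed.

(** The double coset Gam x O. *)
Definition dcoset x : set (apts D G) :=
  [set u | exists2 g, Gam g & translL x O (gmul g u)].

Lemma dcoset_open x : open (dcoset x).
Proof.
apply: open_locally => u [g Gg xg]; exists [set w | translL x O (gmul g w)]; split=> //.
  by apply: (mulg_open hdim hft); apply: (translL_open hdim hft); case: oO.
by move=> w xw; exists g.
Qed.

Lemma dcoset_left x g u : Gam g -> dcoset x (gmul g u) <-> dcoset x u.
Proof.
have [_ GM GV] := sGam => Gg; split=> [[h Gh xh]|[h Gh xh]].
  by exists (gmul h g); [exact: GM|rewrite -gmulA].
exists (gmul h (ginv g)); first exact/GM/GV.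
by rewrite -gmulA [gmul (ginv g) _]gmulA gmulVg gmul1g.
Qed.

Lemma dcoset_right x k u : O k -> dcoset x (gmul u k) <-> dcoset x u.
Proof.
have [[Oone OM OV] _] := oO => Ok; split=> -[h Gh [k' Ok' e]]; exists h => //.
  exists (gmul k' (ginv k)); first exact/OM/OV.
  by rewrite gmulA e gmulA gmulgK.
by exists (gmul k' k); [exact: OM|rewrite gmulA e gmulA].
Qed.

Lemma dcoset_self x : dcoset x x.
Proof.
have [G1 _ _] := sGam; exists (gone G (adele D)) => //.
by rewrite gmul1g; exact: coset1 oO.1.
Qed.

Lemma dcoset_eq x y : dcoset x y -> dcoset x = dcoset y.
Proof.
move=> [g Gg xg]; have [_ GM GV] := sGam.
have e : translL x O = translL (gmul g y) O by exact: coset_eq oO.1 xg.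
apply/seteqP; split=> u [h Gh].
  rewrite e => -[k Ok ek]; exists (gmul (ginv g) h); first exact/GM/Gh/GV.
  by exists k => //; rewrite -gmulA -ek -gmulA gmulKg.
move=> [k Ok ek]; exists (gmul g h); first exact: GM.
by rewrite e; exists k => //; rewrite -!gmulA ek.
Qed.

Lemma orbit_count_translR (Y : set (apts D G)) u v :
  orbit_count (translR Y v) u = orbit_count Y (gmul u (ginv v)).
Proof. by apply: eq_esum => g _; rewrite !indicE translRE gmulA. Qed.

(** The count depends only on the double coset, as x O is right invariant under [O] and a shift by
    Gam reorders the sum. Its value is the order of the intersection of Gam with x O x^-1. *)
Lemma orbit_count_coset x u : orbit_count (translL x O) u =
  if u \in dcoset x then orbit_count (translL x O) x else 0%E.
Proof.
have [[Oone OM OV] _] := oO.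
case: ifPn => [/set_mem[g Gg [k Ok e]]|/negP nu]; last first.
  by apply: orbit_count_eq0 => g Gg xg; apply: nu; apply/mem_set; exists g.
rewrite -(orbit_count_left _ _ Gg) -e; apply: eq_esum => h _.
congr (_%:E); rewrite !indicE; congr (_%:R); congr (nat_of_bool _).
apply/idP/idP => /set_mem[k' Ok' e']; apply/mem_set.
  exists (gmul k' (ginv k)); first exact/OM/OV.
  by rewrite gmulA e' gmulA gmulgK.
by exists (gmul k' k); [exact: OM|rewrite gmulA e' gmulA].
Qed.

Lemma measurable_dcosetR x v : measurable ([set u | dcoset x (gmul u (ginv v))] : set bG).
Proof. by apply: borel_open; apply: (gmul_open hdim hft); exact: dcoset_open. Qed.

(** Unfolding an integrand that is constant on the translated double coset and zero outside it. *)
Lemma qh_translR_dcoset x v : mu (translR (translL x O) v) =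
  (orbit_count (translL x O) x * mu (dom `&` [set u | dcoset x (gmul u (ginv v))]))%E.
Proof.
rewrite unfolding//.
rewrite -(integral_cst mu (measurableI _ _ (qh_dom_meas q) (measurable_dcosetR x v))).
rewrite integral_mkcondr; apply: eq_integral => u _.
rewrite orbit_count_translR orbit_count_coset patchE.
by congr (if _ then _ else _); apply/idP/idP => /set_mem h; exact/mem_set.
Qed.

Lemma orbit_count_fin x : V x -> exists2 n : R, 0 < n & orbit_count (translL x O) x = n%:E.
Proof.
move=> Vx; have [G1 _ _] := sGam.
have := qh_translR_dcoset x (gone G (adele D)).
rewrite translR_gone qh_invariant//.
have n1 : (1 <= orbit_count (translL x O) x)%E.
  by apply: (orbit_count_gt0 G1); rewrite gmul1g; exact: coset1 oO.1.
case: (orbit_count _ _) n1 => [n n1 _|_ e|//]; first by exists n => //; rewrite lee_fin in n1; exact: lt_le_trans n1.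
(* An infinite count would make the measure of [O] zero or infinite. *)
exfalso; have := qh_open_pos; have := fO; rewrite e.
have [->|ne] := eqVneq (mu (dom `&` [set u | dcoset x (gmul u (ginv (gone G (adele D))))])) 0%E.
  by rewrite mule0 ltxx.
by rewrite gt0_mulye ?ltxx// lt0e ne measure_ge0.
Qed.

Lemma dcoset_cover : exists Ws : seq (set (apts D G)), [/\ uniq Ws,
  forall W, W \in Ws -> exists x, V x /\ W = dcoset x &
  forall v, V v -> exists W, W \in Ws /\ W v].
Proof.
have [Ds [cDs hDs]] := quotient_haar_cover hdim hft q oO.
have [_ GM GV] := sGam.
pose rep A := xget (gone G (adele D)) (A `&` V).
have V1 : V (gone G (adele D)) by case: sV.
have repV A : V (rep A) by rewrite /rep; case: xgetP => [z _ []|].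
exists (undup [seq dcoset (rep A) | A <- Ds]); split; first exact: undup_uniq.
  by move=> W; rewrite mem_undup => /mapP[A _ ->]; exists (rep A).
move=> v Vv; have [d [[dd [g Gg e]] _]] := qh_domP q Vv.
have [A [ADs Ad]] := hDs d dd; exists (dcoset (rep A)).
split; first by rewrite mem_undup; apply/mapP; exists A.
rewrite e; apply/dcoset_left => //.
have Arep : A (rep A).
  rewrite /rep; case: xgetP => [z _ []//|/(_ d) h]; case: h; split=> //.
  exact: (qh_dom_sub (q := q)).
have [x Ax] := cDs.2 A ADs; case: sGam => G1 _ _.
exists (gone G (adele D)) => //; rewrite gmul1g.
by rewrite -(coset_eq oO.1 (_ : translL x O (rep A))) -?Ax.
Qed.

Lemma dcoset_disjoint (Ws : seq (set (apts D G))) : (forall W, W \in Ws -> exists x, V x /\ W = dcoset x) ->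
  forall A B, A \in Ws -> B \in Ws -> A <> B -> A `&` B = set0.
Proof.
move=> h A B /h[x [_ ->]] /h[y [_ ->]] ne; apply/seteqP; split=> // u [xu yu].
by apply: ne; rewrite (dcoset_eq xu) (dcoset_eq yu).
Qed.

Lemma qh_dom_translR_partition (E : set bG) v (Ws : seq (set (apts D G))) : V v -> measurable E -> E `<=` dom ->
  uniq Ws -> (forall W, W \in Ws -> exists x, V x /\ W = dcoset x) ->
  (forall v, V v -> exists W, W \in Ws /\ W v) ->
  fine (mu E) = \sum_(W <- Ws) fine (mu (E `&` [set u | W (gmul u (ginv v))])).
Proof.
move=> Vv mE Ed uW hW cW; case: (sV) => _ VM VV.
pose sh (W : set (apts D G)) : set (apts D G) := [set u | W (gmul u (ginv v))].
have shK : injective sh.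
  move=> A B /seteqP[AB BA]; apply/seteqP; split=> u.
    by move: (AB (gmul u v)); rewrite /sh /= gmulgK.
  by move: (BA (gmul u v)); rewrite /sh /= gmulgK.
rewrite (@fin_partition E (map sh Ws)) ?big_map//.
- by apply: le_lt_trans fdom; apply: le_measure; rewrite ?inE//; exact: qh_dom_meas.
- by move=> _ /mapP[W /hW[x [_ ->]] ->]; exact: measurable_dcosetR.
- by rewrite map_inj_uniq.
- move=> _ _ /mapP[A AW ->] /mapP[B BW ->] ne.
  have AB : A <> B by move=> AB; apply: ne; rewrite AB.
  have := dcoset_disjoint hW AW BW AB => /seteqP[d _].
  by apply/seteqP; split=> // u [Au Bu]; exact: (d (gmul u (ginv v))).
- move=> u /Ed du; have [W [WW Wu]] := cW (gmul u (ginv v)) (VM _ _ (qh_dom_sub du) (VV _ Vv)).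
  by exists (sh W); split=> //; exact: map_f.
Qed.

(** By left invariance x O w has the measure of O w, so each piece of [dom] in Gam x O w has mass
    mu(O w) / n x. Adding up over the double cosets gives mu(dom), whatever w is, which determines
    mu(O w). *)
Lemma qh_unimodular v : V v -> mu (translR O v) = mu O /\
  forall x, V x -> mu (dom `&` [set u | dcoset x (gmul u (ginv v))]) = mu (dom `&` dcoset x).
Proof.
move=> Vv; have [Ws [uW hW cW]] := dcoset_cover.
have V1 : V (gone G (adele D)) by case: sV.
have fle (A : set bG) : measurable A -> (mu (dom `&` A) \is a fin_num).
  move=> mA; rewrite ge0_fin_numE//; apply: le_lt_trans fdom; apply: le_measure; rewrite ?inE.
  - by apply: measurableI => //; exact: qh_dom_meas.
  - exact: qh_dom_meas.
  - by move=> ? [].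
have /choice[n hn] : forall x, exists n : R, V x -> 0 < n /\ orbit_count (translL x O) x = n%:E.
  move=> x; have [/orbit_count_fin[n n0 e]|nV] := pselect (V x); first by exists n.
  by exists 0.
have key w x : V w -> V x -> mu (translR O w) =
    ((n x)%:E * mu (dom `&` [set u | dcoset x (gmul u (ginv w))]))%E.
  move=> Vw Vx; rewrite -(hn x Vx).2 -qh_translR_dcoset.
  rewrite (_ : translR (translL x O) w = translL x (translR O w)).
    rewrite qh_invariant//; apply: borel_open; apply: (translR_open hdim hft).
    by case: oO.
  apply/seteqP; split=> [_ [_ [k Ok <-] <-]|_ [_ [k Ok <-] <-]].
    by exists (gmul k w); [exists k|rewrite gmulA].
  by exists (gmul x k); [exists k|rewrite gmulA].
have fOw w : V w -> mu (translR O w) \is a fin_num.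
  by move=> Vw; rewrite (key w w Vw Vw) fin_numM// fle//; exact: measurable_dcosetR.
have keyf w x : V w -> V x -> fine (mu (dom `&` [set u | dcoset x (gmul u (ginv w))])) =
    fine (mu (translR O w)) * (n x)^-1.
  move=> Vw Vx; have [n0 _] := hn x Vx.
  rewrite (key w x Vw Vx) fineM//; last by apply: fle; exact: measurable_dcosetR.
  by rewrite mulrAC mulfV ?mul1r// gt_eqF.
pose rep W := xget (gone G (adele D)) [set x | V x /\ W = dcoset x].
have repP W : W \in Ws -> V (rep W) /\ W = dcoset (rep W).
  by move=> /hW[x xW]; rewrite /rep; case: xgetP => // /(_ x).
(* [mu dom] is [mu (translR O w)] times a sum that does not depend on [w]. *)
pose s := \sum_(W <- Ws) (n (rep W))^-1.
have tot w : V w -> fine (mu dom) = fine (mu (translR O w)) * s.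
  move=> Vw; rewrite (qh_dom_translR_partition Vw (qh_dom_meas q) _ uW hW cW)//.
  rewrite mulr_sumr big_seq [RHS]big_seq; apply: eq_bigr => W WW.
  by have [Vr eW] := repP W WW; rewrite -keyf// -eW.
have d0 : fine (mu dom) != 0.
  by rewrite gt_eqF// fine_gt0// qh_dom_pos fdom.
have O1 := translR_gone O.
have s0 : s != 0 by apply: contra_neq d0 => s0; rewrite (tot _ V1) s0 mulr0.
have e : mu (translR O v) = mu O.
  rewrite -{2}O1 -(fineK (fOw v Vv)) -(fineK (fOw _ V1)); congr (_%:E).
  by apply: (mulIf s0); rewrite /= -(tot v Vv) -(tot _ V1).
split=> // x Vx.
have dE : dcoset x = [set u | dcoset x (gmul u (ginv (gone G (adele D))))].
  by apply/seteqP; split=> u; rewrite /= ginv1 gmulg1.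
rewrite {2}dE -[LHS]fineK; last by apply: fle; exact: measurable_dcosetR.
rewrite -[RHS]fineK; last by apply: fle; exact: measurable_dcosetR.
by rewrite !keyf// e O1.
Qed.

(** [B] is a union of double cosets Gam x O, whose masses in [dom] do not change under right
    translation. *)
Lemma qh_right_inv (B : set (apts D G)) v : V v ->
  (forall g u, Gam g -> B (gmul g u) <-> B u) ->
  (forall k u, O k -> B (gmul u k) <-> B u) ->
  mu (dom `&` [set u | B (gmul u (ginv v))]) = mu (dom `&` B).
Proof.
move=> Vv BG BO; have [Ws [uW hW cW]] := dcoset_cover.
have V1 : V (gone G (adele D)) by case: sV.
have oB : open B.
  apply: open_locally => u Bu; exists (translL u O); split.
  - by apply: (translL_open hdim hft); case: oO.
  - exact: coset1 oO.1.
  - by move=> _ [k Ok <-]; apply/BO.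
have mB w : measurable ([set u | B (gmul u (ginv w))] : set bG).
  by apply: borel_open; exact: (gmul_open hdim hft).
have mdB w : measurable (dom `&` [set u | B (gmul u (ginv w))] : set bG).
  by apply: measurableI => //; exact: qh_dom_meas.
have BE : B = [set u | B (gmul u (ginv (gone G (adele D))))].
  by apply/seteqP; split=> u; rewrite /= ginv1 gmulg1.
have fin w : mu (dom `&` [set u | B (gmul u (ginv w))]) \is a fin_num.
  rewrite ge0_fin_numE//; apply: le_lt_trans fdom; apply: le_measure; rewrite ?inE//.
  exact: qh_dom_meas.
have part w : V w -> fine (mu (dom `&` [set u | B (gmul u (ginv w))])) =
    \sum_(W <- Ws) (if `[< W `<=` B >] then fine (mu (dom `&` W)) else 0).
  move=> Vw; rewrite (qh_dom_translR_partition Vw (mdB w) _ uW hW cW); last by move=> ? [].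
  rewrite big_seq [RHS]big_seq; apply: eq_bigr => W WW.
  have [x [Vx eW]] := hW W WW; subst W.
  case: ifPn => [/asboolP sub|/asboolP nsub].
    rewrite -(qh_unimodular Vw).2//; congr (fine (mu _)); apply/seteqP; split=> u.
      by move=> [[du _] Wu].
    by move=> [du Wu]; split=> //; split=> //; exact: sub.
  rewrite (_ : _ `&` _ = set0) ?measure0//; apply/seteqP; split=> // u [[_ Bu] Wu].
  apply: nsub; rewrite (dcoset_eq Wu) => z [g Gg [k Ok e]].
  by apply/(BG g z Gg); rewrite -e; apply/BO.
have finB := fin (gone G (adele D)); rewrite -BE in finB.
have partB := part _ V1; rewrite -BE in partB.
by rewrite -[LHS](fineK (fin v)) -[RHS](fineK finB) (part v Vv) partB.
Qed.

End OpenSubgroup.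
End QuotientHaar.

Lemma open_subgroupI (X : scheme) (D : adelic_data X) (G : affGroup)
    (O1 O2 : set (apts D G)) :
  open_subgroup O1 -> open_subgroup O2 -> open_subgroup (O1 `&` O2).
Proof.
move=> [[a1 a2 a3] a4] [[b1 b2 b3] b4]; split; last exact: openI.
by split; [split|move=> ? ? [? ?] [? ?]; split; [exact: a2|exact: b2]
  |move=> ? [? ?]; split; [exact: a3|exact: b3]].
Qed.

Section CosetIndex.
Variables (X : scheme) (hdim : dim_one X) (hft : finite_type_Z X).
Variables (D : adelic_data X) (G : affGroup) (R : realType).
Local Notation bG := (borelG D G).
Variables (V Gam : set (apts D G)) (q : quotient_haar R V Gam).
Hypotheses (sV : subgroup V) (sGam : subgroup Gam) (GamV : Gam `<=` V).
Hypotheses (cGam : countable Gam) (clV : closed V).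
Local Notation mu := (qh_mu q).
Local Notation dom := (qh_dom q).

Lemma translR_eq (M : set (apts D G)) x y : subgroup M -> translR M x y ->
  translR M x = translR M y.
Proof.
move=> [M1 MM MV] [k Mk <-]; apply/seteqP; split=> _ [k' Mk' <-].
  by exists (gmul k' (ginv k)); [exact/MM/MV|rewrite gmulA gmulgVK].
by exists (gmul k' k); [exact: MM|rewrite gmulA].
Qed.

Lemma translR1 (M : set (apts D G)) y : subgroup M -> translR M y y.
Proof. by move=> [M1 _ _]; exists (gone G (adele D)) => //; rewrite gmul1g. Qed.

(** Cosets M y have the same measure as M by unimodularity, so only finitely many fit into O. They
    are right translates of M because that is the first invariance available for the set function to
    be compared with mu'. *)
Lemma coset_index (O M : set (apts D G)) : open_subgroup O -> open_subgroup M ->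
  M `<=` O -> (mu O < +oo)%E ->
  exists Ds : seq (set (apts D G)), [/\ uniq Ds,
    forall A, A \in Ds -> exists y, [/\ V y, O y & A = translR M y],
    forall A B, A \in Ds -> B \in Ds -> A <> B -> A `&` B = set0,
    forall u, V u -> O u -> exists A, A \in Ds /\ A u
    & fine (mu O) = (size Ds)%:R * fine (mu M)].
Proof.
move=> oO oM MO fO.
have [[Oone OM OV] oO'] := oO; have [sM oM'] := oM.
have mO : measurable (O : set bG) by exact: borel_open.
have mM : measurable (M : set bG) by exact: borel_open.
have fM : (mu M < +oo)%E by apply: le_lt_trans fO; apply: le_measure; rewrite ?inE.
have muM := qh_open_pos hdim hft q sV GamV cGam clV oM.
pose P (Ds : seq (set (apts D G))) := uniq Ds /\
  forall A, A \in Ds -> exists y, [/\ V y, O y & A = translR M y].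
have mA Ds A : P Ds -> A \in Ds -> measurable (A : set bG).
  by move=> [_ h] /h[y [_ _ ->]]; apply: borel_open; exact: (translR_open hdim hft).
have disj Ds A B : P Ds -> A \in Ds -> B \in Ds -> A <> B -> A `&` B = set0.
  move=> [_ h] /h[x [_ _ ->]] /h[y [_ _ ->]] ne; apply/seteqP; split=> // u [xu yu].
  by apply: ne; rewrite (translR_eq sM xu) (translR_eq sM yu).
have muA Ds A : P Ds -> A \in Ds -> mu (O `&` A) = mu M.
  move=> [_ h] /h[y [Vy Oy ->]].
  rewrite -(qh_unimodular hdim hft sV sGam GamV cGam clV oM fM Vy).1; congr (mu _).
  by apply: setIidr => _ [k /MO Ok <-]; exact: OM.
have tot Ds : P Ds -> let E := [set u | O u /\ exists A, A \in Ds /\ A u] in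
    [/\ measurable (E : set bG), fine (mu E) = (size Ds)%:R * fine (mu M)
      & (mu E <= mu O)%E].
  move=> PD E.
  have mE : measurable (E : set bG).
    apply: borel_open; apply: open_locally => u [Ou [A [ADs Au]]].
    exists (O `&` A); split=> //.
      apply: openI => //; have [y [_ _ ->]] := PD.2 A ADs; exact: (translR_open hdim hft).
    by move=> w [Ow Aw]; split=> //; exists A.
  have EO : (mu E <= mu O)%E by apply: le_measure; rewrite ?inE// => u [].
  split=> //; rewrite (@fin_partition _ _ _ _ _ _ q E Ds)//.
  - rewrite big_seq (eq_bigr (fun=> fine (mu M))).
      by rewrite -big_seq big_const_seq count_predT iter_addr_0 mulr_natl.
    move=> A ADs; rewrite -(muA Ds A PD ADs); congr (fine (mu _)).
    by apply/seteqP; split=> u; [move=> [[]]|move=> [Ou Au]; split=> //; split=> //; exists A].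
  - exact: le_lt_trans fO.
  - by move=> A; exact: mA.
  - by case: PD.
  - by move=> A B; exact: disj.
  - by move=> u [].
have [Ds [PD cov]] : exists Ds, P Ds /\ forall u, V u -> O u -> exists A, A \in Ds /\ A u.
  apply: contrapT => no.
  have big n : exists Ds, P Ds /\ size Ds = n.
    elim: n => [|n [Ds [PD sD]]]; first by exists [::]; split.
    have [u [Vu Ou nu]] : exists u, [/\ V u, O u & forall A, A \in Ds -> ~ A u].
      apply: contrapT => no'; apply: no; exists Ds; split=> // u Vu Ou.
      apply: contrapT => nA; apply: no'; exists u; split=> // A ADs Au.
      by apply: nA; exists A.
    exists (translR M u :: Ds); split; last by rewrite /= sD.
    split=> [|A].
      rewrite /= PD.1 andbT; apply/negP => uD; apply: (nu _ uD); exact: translR1.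
    by rewrite inE => /orP[/eqP->|/PD.2//]; exists u.
  (* One more coset than the quotient of the measures allows: their union would have measure greater
     than that of [O]. *)
  have [Ds [PD sD]] := big (Num.trunc (fine (mu O) / fine (mu M))).+1.
  have [_ e le] := tot Ds PD.
  have M0 : 0 < fine (mu M) by rewrite fine_gt0// muM fM.
  have : fine (mu O) < (size Ds)%:R * fine (mu M).
    by rewrite -ltr_pdivrMr// sD truncnS_gt.
  rewrite -e ltNge => /negP; apply; apply: fine_le => //.
    by rewrite ge0_fin_numE//; exact: le_lt_trans fO.
  by rewrite ge0_fin_numE.
exists Ds; split=> //; [by case: PD|by case: PD|by move=> A B; exact: disj|].
have [mE <- _] := tot Ds PD.
rewrite (qh_supported q clV mO) (qh_supported q clV mE).
congr (fine (mu _)); apply/seteqP; split=> u; last by move=> [[Ou _] Vu].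
by move=> [Ou Vu]; split=> //; split=> //; exact: cov.
Qed.

End CosetIndex.

(** * Comparison of two quotient integrals along a homomorphism *)

Section HaarRatio.
Variables (X X' : scheme) (hdim : dim_one X) (hft : finite_type_Z X).
Variables (hdim' : dim_one X') (hft' : finite_type_Z X').
Variables (D : adelic_data X) (D' : adelic_data X') (G : affGroup) (R : realType).
Local Notation C := (complex R).
Local Notation bG := (borelG D G).
Local Notation bG' := (borelG D' G).
Variables (V Gam : set (apts D G)) (q : quotient_haar R V Gam).
Hypotheses (sV : subgroup V) (sGam : subgroup Gam) (GamV : Gam `<=` V).
Hypotheses (cGam : countable Gam) (clV : closed V).
Variables (V' Gam' : set (apts D' G)) (q' : quotient_haar R V' Gam').
Hypotheses (sV' : subgroup V') (sGam' : subgroup Gam') (GamV' : Gam' `<=` V').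
Hypotheses (cGam' : countable Gam') (clV' : closed V').
Local Notation mu := (qh_mu q).
Local Notation mu' := (qh_mu q').
Local Notation dom := (qh_dom q).
Local Notation dom' := (qh_dom q').
Variable rho : apts D G -> apts D' G.
Hypothesis rhoM : forall x y, rho (gmul x y) = gmul (rho x) (rho y).
Hypothesis rhoVinv : forall x, rho (ginv x) = ginv (rho x).
Hypothesis rho1 : rho (gone G (adele D)) = gone G (adele D').
Hypothesis rho_open : forall O, open O -> open (rho @^-1` O).
Hypothesis rhoV : forall x, V x -> V' (rho x).
Hypothesis rhoV_surj : forall x', V' x' -> exists2 x, V x & rho x = x'.
Hypothesis rhoGam : forall x, Gam x -> Gam' (rho x).
Variables (O0 : set (apts D G)) (oO0 : open_subgroup O0) (fO0 : (mu O0 < +oo)%E).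

Local Notation count' := (@orbit_count X' D' G R Gam').

(** The preimage of O' contains the kernel of [rho] and may have infinite measure, hence the
    intersection with [O0]. *)
Let pre_subgroup O' : open_subgroup O' -> open_subgroup (rho @^-1` O' `&` O0).
Proof.
move=> [[Oone OM OV] oO']; have [[Q1 QM QV] oQ] := oO0; split; last first.
  by apply: openI => //; exact: rho_open.
split; first by split=> //=; rewrite rho1.
- by move=> x y [? ?] [? ?]; split; [rewrite /= rhoM; exact: OM|exact: QM].
- by move=> x [? ?]; split; [rewrite /= rhoVinv; exact: OV|exact: QV].
Qed.

Let pre_fin O' : open O' -> (mu (rho @^-1` O' `&` O0) < +oo)%E.
Proof.
move=> oO'; apply: le_lt_trans fO0; apply: le_measure; rewrite ?inE; last by move=> ? [].
  by apply: borel_open; apply: openI; [exact: rho_open|case: oO0].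
by apply: borel_open; case: oO0.
Qed.

Let mpre (Y : set bG') : measurable Y -> measurable (rho @^-1` Y : set bG).
Proof.
by apply: borel_preimage; exact: rho_open.
Qed.

(* On cosets of open subgroups [theta] will be additive and invariant under both
   translations, hence proportional to [mu']. *)
Let theta (Y : set bG') : \bar R := (\int[mu]_(u in dom) count' Y (rho u))%E.

Let mcount (Y : set bG') : measurable Y ->
  measurable_fun dom ((fun u => count' Y (rho u)) : bG -> \bar R).
Proof.
move=> mY md B mB; apply: measurableI => //.
have := measurable_orbit_count hdim' hft' cGam' mY measurableT mB.
by rewrite setTI => /mpre.
Qed.

Section Level.
Variables (O' : set (apts D' G)) (oO' : open_subgroup O') (fO' : (mu' O' < +oo)%E).

Let dc x := @dcoset X' D' G Gam' O' x.

(** v is lifted to some w in V, and right translation by w does not change the mass in [dom] of the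
    preimage of a double coset. The result no longer involves v, which yields right invariance. *)
Lemma theta_coset x v : V' x -> V' v ->
  theta (translR (translL x O') v) = (count' (translL x O') x * mu (dom `&` rho @^-1` (dc x)))%E.
Proof.
move=> Vx Vv; have [w Vw ew] := rhoV_surj Vv.
have inv : mu (dom `&` [set u | (rho @^-1` (dc x)) (gmul u (ginv w))]) = mu (dom `&` rho @^-1` (dc x)).
  apply: (qh_right_inv hdim hft sV sGam GamV cGam clV (pre_subgroup oO') (pre_fin oO'.2) Vw).
    by move=> g u Gg; rewrite /= rhoM; apply: (dcoset_left sGam' O'); exact: rhoGam.
  by move=> k u [Ok _]; rewrite /= rhoM; exact: (dcoset_right Gam' oO').
rewrite -inv; set E := [set u | _].
have mE : measurable (E : set bG).
  apply: borel_open; apply: (gmul_open hdim hft); apply: rho_open.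
  exact: (dcoset_open hdim' hft' Gam' oO').
rewrite -(integral_cst mu (measurableI _ _ (qh_dom_meas q) mE)) integral_mkcondr.
apply: eq_integral => u _.
rewrite orbit_count_translR (orbit_count_coset R sGam' oO') patchE.
congr (if _ then _ else _); apply/idP/idP => /set_mem h; apply/mem_set; move: h;
  by rewrite /E /= rhoM rhoVinv ew.
Qed.

Lemma theta_translR x v : V' x -> V' v ->
  theta (translR (translL x O') v) = theta (translL x O').
Proof.
move=> Vx Vv; have V1 : V' (gone G (adele D')) by case: sV'.
by rewrite -[in RHS](translR_gone (translL x O')) !theta_coset.
Qed.

End Level.

Let theta_open_translR (M : set (apts D' G)) v : open_subgroup M ->
  V' v -> theta (translR M v) = theta M.
Proof.
move=> oM Vv; have V1 : V' (gone G (adele D')) by case: sV'.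
by have := theta_translR oM V1 Vv; rewrite translL_gone.
Qed.

Lemma orbit_count_partition (Y : set (apts D' G)) Ds w : V' w -> uniq Ds ->
  (forall A, A \in Ds -> A `<=` Y) ->
  (forall A B, A \in Ds -> B \in Ds -> A <> B -> A `&` B = set0) ->
  (forall u, V' u -> Y u -> exists A, A \in Ds /\ A u) ->
  count' Y w = (\sum_(A <- Ds) count' A w)%E.
Proof.
move=> Vw uDs sub dis cov; rewrite /orbit_count big_seq -esum_sum => [|g A _ _]; last first.
  by rewrite lee_fin indicE; case: (_ \in _).
apply: eq_esum => g Gg; rewrite -big_seq sumEFin; congr (_%:E).
have [Yg|nY] := pselect (Y (gmul g w)); last first.
  rewrite indicE memNset// big1_seq// => A /= ADs.
  by rewrite indicE memNset// => /(sub A ADs).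
have [A [ADs Ag]] : exists A, A \in Ds /\ A (gmul g w).
  by apply: cov => //; case: sV' => _ VM _; apply: VM => //; exact: GamV'.
rewrite (bigD1_seq A)//= !indicE !mem_set// big1_seq ?addr0// => B /andP[/eqP BA BDs].
rewrite indicE memNset// => Bg.
have : (A `&` B) (gmul g w) by [].
by rewrite dis// => e; apply: BA.
Qed.

Lemma theta_index (O1 M : set (apts D' G)) : open_subgroup O1 -> open_subgroup M ->
  M `<=` O1 -> (mu' O1 < +oo)%E ->
  exists n : nat, fine (mu' O1) = n%:R * fine (mu' M) /\ theta O1 = (n%:R%:E * theta M)%E.
Proof.
move=> oO1 oM MO fO1.
have [Ds [uDs hDs dDs cDs e]] :=
  coset_index hdim' hft' sV' sGam' GamV' cGam' clV' oO1 oM MO fO1.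
have [[_ OM' _] _] := oO1.
exists (size Ds); split=> //.
have mDs A : A \in Ds -> measurable (A : set bG').
  move=> /hDs[y [_ _ ->]]; apply: borel_open; apply: (translR_open hdim' hft').
  by case: oM.
pose F A (u : bG) : \bar R := if A \in Ds then count' A (rho u) else 0%E.
have mF A : measurable_fun dom (F A).
  by rewrite /F; have [/mDs/mcount//|_] := boolP (A \in Ds); exact: measurable_cst.
have F0 A u : (0 <= F A u)%E by rewrite /F; case: ifP => // _; exact: orbit_count_ge0.
have -> : theta O1 = (\int[mu]_(u in dom) (\sum_(A <- Ds) F A u))%E.
  apply: eq_integral => u /set_mem du.
  rewrite (@orbit_count_partition _ Ds)//.
  - by rewrite big_seq [RHS]big_seq; apply: eq_bigr => A ADs; rewrite /F ADs.
  - exact/rhoV/(qh_dom_sub (q := q)).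
  - by move=> A /hDs[y [_ Oy ->]] _ [k Mk <-]; apply: OM' => //; exact: MO.
rewrite (ge0_integral_sum mu (qh_dom_meas q) mF) => [|A u _]; last exact: F0.
rewrite big_seq (eq_bigr (fun=> theta M)) => [|A ADs].
  by rewrite -big_seq big_const_seq count_predT iter_addr_0 mule_natl.
rewrite -(_ : theta A = theta M).
  by apply: eq_integral => u _; rewrite /F ADs.
by have [y [Vy _ ->]] := hDs A ADs; exact: theta_open_translR.
Qed.

Section Ratio.
Variables (O' : set (apts D' G)) (oO' : open_subgroup O') (fO' : (mu' O' < +oo)%E).

(** Right invariance turns x O' into the conjugate x O' x^-1, which is compared with O' through
    their intersection. *)
Lemma theta_translL x : V' x -> theta (translL x O') = theta O'.
Proof.
move=> Vx; have [_ _ VV] := sV'.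
rewrite -(theta_translR oO' Vx (VV x Vx)).
have -> : translR (translL x O') (ginv x) = conj_set x O'.
  apply/seteqP; split=> [_ [_ [k Ok <-] <-]|u Ou].
    by rewrite /conj_set /= gmulgVK gmulKg.
  by exists (gmul u x); [exists (gmul (ginv x) (gmul u x)); rewrite ?gmulVKg|rewrite gmulgK].
have oc := conj_subgroup hdim' hft' x oO'.
have ec : mu' (conj_set x O') = mu' O'.
  have <- : translL x (translR O' (ginv x)) = conj_set x O'.
    apply/seteqP; split=> [_ [_ [k Ok <-] <-]|u Ou].
      by rewrite /conj_set /= -!gmulA gmulVg gmulg1 gmulKg.
    exists (gmul (ginv x) u); last by rewrite gmulVKg.
    by exists (gmul (ginv x) (gmul u x)) => //; rewrite gmulA gmulgK.
  rewrite qh_invariant//.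
    by rewrite (qh_unimodular hdim' hft' sV' sGam' GamV' cGam' clV' oO' fO' (VV x Vx)).1.
  by apply: borel_open; apply: (translR_open hdim' hft'); case: oO'.
pose M := O' `&` conj_set x O'.
have oM : open_subgroup M by exact: open_subgroupI.
have mM : measurable (M : set bG') by apply: borel_open; case: oM.
have fM : (mu' M < +oo)%E.
  apply: le_lt_trans fO'; apply: le_measure; rewrite ?inE//; last by move=> ? [].
  by apply: borel_open; case: oO'.
have M0 : 0 < fine (mu' M).
  by rewrite fine_gt0// fM (qh_open_pos hdim' hft' q' sV' GamV' cGam' clV' oM).
(* [O'] and its conjugate have the same index over [M], as [mu'] is unimodular. *)
have [n [en tn]] := theta_index oO' oM (@subIsetl _ _ _) fO'.
have fc : (mu' (conj_set x O') < +oo)%E by rewrite ec.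
have [m [em tm]] := theta_index oc oM (@subIsetr _ _ _) fc.
rewrite tm tn; congr (_%:E * _)%E.
by apply: (mulIf (lt0r_neq0 M0)); rewrite -em -en ec.
Qed.

Let dc x : set (apts D' G) := @dcoset X' D' G Gam' O' x.

Let fin_sub (E : set bG) : measurable E -> mu (dom `&` E) \is a fin_num.
Proof.
move=> mE; rewrite ge0_fin_numE//; apply: le_lt_trans (quotient_haar_fin q).
apply: le_measure; rewrite ?inE; [|exact: qh_dom_meas|by move=> ? []].
by apply: measurableI => //; exact: qh_dom_meas.
Qed.

Let fin_sub' (E : set bG') : measurable E -> mu' (dom' `&` E) \is a fin_num.
Proof.
move=> mE; rewrite ge0_fin_numE//; apply: le_lt_trans (quotient_haar_fin q').
apply: le_measure; rewrite ?inE; [|exact: qh_dom_meas|by move=> ? []].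
by apply: measurableI => //; exact: qh_dom_meas.
Qed.

Let mdc x : measurable (dc x : set bG').
Proof. by apply: borel_open; exact: (dcoset_open hdim' hft' Gam' oO'). Qed.

(** With the same orbit count n, both theta(x O') and mu'(x O') are n times the mass of the double
    coset, and neither depends on x. So the ratio of masses is theta(O') / mu'(O') throughout. *)
Lemma haar_ratio : exists2 kap : R, 0 < kap & forall x, V' x ->
  fine (mu (dom `&` rho @^-1` dc x)) = kap * fine (mu' (dom' `&` dc x)).
Proof.
have V1 : V' (gone G (adele D')) by case: sV'.
have mO' : measurable (O' : set bG') by apply: borel_open; case: oO'.
have cnt x (Vx : V' x) := orbit_count_fin hdim' hft' sV' sGam' GamV' cGam' clV' oO' fO' Vx.
have th x n : V' x -> count' (translL x O') x = n%:E -> theta O' = (n%:E * mu (dom `&` rho @^-1` dc x))%E.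
  by move=> Vx e; rewrite -(theta_translL Vx) -(translR_gone (translL x O')) (theta_coset oO' Vx V1) e.
have om x n : V' x -> count' (translL x O') x = n%:E -> mu' O' = (n%:E * mu' (dom' `&` dc x))%E.
  move=> Vx e; rewrite -(qh_invariant q' Vx mO') -(translR_gone (translL x O')).
  rewrite (qh_translR_dcoset hdim' hft' q' sV' sGam' GamV' cGam' clV' oO') e.
  by congr (_ * mu' _)%E; congr (_ `&` _); apply/seteqP; split=> u; rewrite /= ginv1 gmulg1.
have O0' : 0 < fine (mu' O').
  by rewrite fine_gt0// fO' (qh_open_pos hdim' hft' q' sV' GamV' cGam' clV' oO').
exists (fine (theta O') / fine (mu' O')); last first.
  move=> x Vx; have [n n0 e] := cnt x Vx.
  rewrite {1}(th x n Vx e) (om x n Vx e) !fineM ?fin_sub ?fin_sub'//=; last exact: mpre.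
  have := O0'; rewrite (om x n Vx e) fineM ?fin_sub'//= => h.
  rewrite invfM mulrACA divff ?gt_eqF// mul1r -mulrA mulVf ?mulr1//.
  by apply: contraTneq h => ->; rewrite mulr0 ltxx.
apply: divr_gt0 => //; rewrite lt0r fine_ge0 ?andbT; last first.
  by apply: integral_ge0 => u _; exact: orbit_count_ge0.
(* If theta(O') vanished, the preimages of all double cosets would be null in [dom], which they
   cover. *)
apply/eqP => t0.
have [Ws [uW hW cW]] := dcoset_cover hdim' hft' q' sV' sGam' oO'.
have dW := dcoset_disjoint sGam' oO' hW.
pose S := undup [seq rho @^-1` W | W <- Ws].
have SP A : A \in S -> exists2 W, W \in Ws & A = rho @^-1` W.
  by rewrite mem_undup => /mapP[W WW ->]; exists W.
have := @fin_partition X D G R V Gam q dom S (qh_dom_meas q) (quotient_haar_fin q).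
rewrite big_seq big1 => [h|A /SP[W /hW[x [Vx eW]] ->]].
  have : fine (mu dom) = 0.
    apply: h; rewrite ?undup_uniq//.
    - by move=> A /SP[W /hW[x [_ eW]] ->]; apply: mpre; rewrite eW.
    - move=> A B /SP[W WW ->] /SP[W' WW' ->] ne; rewrite -preimage_setI dW ?preimage_set0// => e.
      by apply: ne; rewrite e.
    - move=> u du; have [W [WW Wu]] := cW _ (rhoV (qh_dom_sub du)).
      by exists (rho @^-1` W); split=> //; rewrite mem_undup; exact: map_f.
  by apply/eqP; rewrite gt_eqF// fine_gt0// quotient_haar_fin (qh_dom_pos hdim hft q sV GamV cGam clV).
have [n n0 e] := cnt x Vx; move: t0; rewrite (th x n Vx e) fineM ?fin_sub//; last exact: mpre.
by rewrite eW => /eqP; rewrite mulf_eq0 /= gt_eqF//= => /eqP.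
Qed.

(** phi is constant on the double cosets, so both integrals are finite sums over them and are
    compared term by term. *)
Lemma integral_ratio : exists2 kap : R, 0 < kap & forall phi : apts D' G -> C,
  right_inv O' phi -> (forall g u, Gam' g -> phi (gmul g u) = phi u) ->
  quotient_integral q (phi \o rho) = kap%:C%C * quotient_integral q' phi.
Proof.
have [kap kap0 hk] := haar_ratio; exists kap => // phi ri li.
have [Ws [uW hW cW]] := dcoset_cover hdim' hft' q' sV' sGam' oO'.
have dW := dcoset_disjoint sGam' oO' hW.
have mW A : A \in Ws -> measurable (A : set bG') by move=> /hW[x [_ ->]].
pose z A := phi (coset_rep A).
have val A x : A \in Ws -> A x -> phi x = z A.
  move=> AW Ax; have Ar : A (coset_rep A) by rewrite /coset_rep; case: xgetP => // /(_ x).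
  have [y [_ eA]] := hW A AW; have e u : A u -> phi u = phi y.
    by rewrite eA => -[g Gg [k Ok e]]; rewrite -(li g u Gg) -e ri.
  by rewrite /z !e.
have riF (T : Type) (F : C -> T) : right_inv O' (F \o phi) by move=> x k Ok; rewrite /= ri.
rewrite {2}/quotient_integral.
have [|_ ->] := @Cintegral_partition X' D' G R mu' dom' Ws phi z (qh_dom_meas q')
    (quotient_haar_fin q') (right_inv_measurable hdim' hft' oO' (riF _ (fun z => complex.Re z)))
    (right_inv_measurable hdim' hft' oO' (riF _ (fun z => complex.Im z))) mW uW dW _
    (fun A x AW _ => val A x AW).
  rewrite (_ : mkset _ = set0) ?measure0//; apply/seteqP; split=> // x [dx h].
  by have [A [AW Ax]] := cW x (qh_dom_sub dx); exact: (h A).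
(* Distinct double cosets have distinct preimages because [rho] maps V onto V'. *)
have pinj : {in Ws &, injective (fun W => rho @^-1` W)}.
  move=> A B AW BW e; apply: contrapT => ne.
  have [x [Vx eA]] := hW A AW; have Ax : A x by rewrite eA; exact: (dcoset_self sGam' oO' x).
  have [y Vy ey] := rhoV_surj Vx; have : (rho @^-1` A) y by rewrite /= ey.
  rewrite e /= ey => Bx; have : (A `&` B) x by [].
  by rewrite dW.
pose S := [seq rho @^-1` W | W <- Ws].
pose z' A := phi (rho (coset_rep A)).
have riF' (T : Type) (F : C -> T) : right_inv (rho @^-1` O' `&` O0) (F \o (phi \o rho)).
  by move=> x k [Ok _]; rewrite /= rhoM ri.
have oP := pre_subgroup oO'.
rewrite /quotient_integral.
have [|||||_ ->] := @Cintegral_partition X D G R mu dom S (phi \o rho) z' (qh_dom_meas q)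
    (quotient_haar_fin q) (right_inv_measurable hdim hft oP (riF' _ (fun z => complex.Re z)))
    (right_inv_measurable hdim hft oP (riF' _ (fun z => complex.Im z))).
- by move=> _ /mapP[W WW ->]; apply: mpre; exact: mW.
- by rewrite map_inj_in_uniq.
- move=> _ _ /mapP[A AW ->] /mapP[B BW ->] ne; rewrite -preimage_setI dW ?preimage_set0// => e.
  by apply: ne; rewrite e.
- rewrite (_ : mkset _ = set0) ?measure0//; apply/seteqP; split=> // x [dx h].
  have [A [AW Ax]] := cW _ (rhoV (qh_dom_sub dx)).
  by apply: (h (rho @^-1` A)) => //; exact: map_f.
- move=> _ x /mapP[A AW ->] _ Ax; rewrite /= (val A _ AW Ax) /z'.
  rewrite -(val A (rho (coset_rep (rho @^-1` A))))//.
  by rewrite -/((rho @^-1` A) _) /coset_rep; case: xgetP => // /(_ x).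
rewrite big_map mulr_sumr big_seq [RHS]big_seq; apply: eq_bigr => A AW.
have [x [Vx eA]] := hW A AW.
have -> : z' (rho @^-1` A) = z A.
  rewrite /z' (val A)//; have [y Vy ey] := rhoV_surj Vx.
  rewrite -/((rho @^-1` A) _) /coset_rep; case: xgetP => // /(_ y).
  by rewrite /= ey eA; case; exact: (dcoset_self sGam' oO' x).
by rewrite eA hk// rmorphM mulrA.
Qed.

End Ratio.

End HaarRatio.

(** * Countability of the rational points *)

Section Countability.

Lemma countable_image (S T : Type) (f : S -> T) (Z : set S) :
  countable Z -> countable (f @` Z).
Proof. by apply: sub_countable; exact: card_image_le. Qed.

Lemma fin_gen_Z_countable (A : comPzRingType) : fin_gen_Z A -> countable [set: A].
Proof.
move=> [l gen].
(* Ring expressions in integers and generators: label 0 is addition, any other binary node is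
   multiplication, and malformed trees evaluate to 0. *)
pose fix eval (t : GenTree.tree (int + nat)) : A := match t with
  | GenTree.Leaf (inl c) => c%:~R
  | GenTree.Leaf (inr n) => nth 0 l n
  | GenTree.Node 0 [:: t1; t2] => eval t1 + eval t2
  | GenTree.Node _ [:: t1; t2] => eval t1 * eval t2
  | GenTree.Node _ _ => 0 end.
apply: (@sub_countable _ _ _ (range eval)); last exact/countable_image/countableP.
rewrite (_ : setT = range eval) ?card_lexx//; apply/seteqP; split=> // a _.
apply: (gen (range eval)).
- by move=> c; exists (GenTree.Leaf (inl c)).
- by move=> b /(nthP 0)[n _ <-]; exists (GenTree.Leaf (inr n)).
- by move=> _ _ [t _ <-] [u _ <-]; exists (GenTree.Node 0 [:: t; u]).
- by move=> _ _ [t _ <-] [u _ <-]; exists (GenTree.Node 1 [:: t; u]).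
Qed.

Lemma stalk_countable (X : scheme) (x : X) (S : stalk x) : finite_type_Z X ->
  countable [set: S].
Proof.
move=> [_ /(_ x)[U [aU Ux fU]]]; have oU : open U by case: aU.
pose g := germ S oU Ux.
pose h (w : sec U * sec U) : S := xget 0 [set s | s * g w.2 = g w.1].
apply: (@sub_countable _ _ _ (range h)); last first.
  apply: countable_image; rewrite -setXTT; apply: countableX; exact: fin_gen_Z_countable.
rewrite (_ : setT = range h) ?card_lexx//; apply/seteqP; split=> // s _.
have [a [f [fi e]]] := stalk_frac aU Ux oU s.
exists (a, f) => //; rewrite /h; case: xgetP => [s' _ /= e'|/(_ s)//].
have [b gb] := (germ_inv S Ux oU f).1 fi.
by rewrite -[s']mulr1 -gb mulrA e' -e -mulrA gb mulr1.
Qed.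

(** A point is determined by its values on a finite set of generators. *)
Lemma pts_countable (A R : comPzRingType) : fin_gen_Z A -> countable [set: R] ->
  countable [set: pts A R].
Proof.
move=> [l gen] /countable_injP[enc einj]; apply/countable_injP.
exists (fun x : pts A R => pickle [seq enc (x a) | a <- l]) => x y _ _ /(pcan_inj pickleK) e.
apply: rmorph_ext; apply: gen => [c|a al|a b ea eb|a b ea eb].
- by rewrite !rmorph_int.
- have n : (index a l < size l)%N by rewrite index_mem.
  have := congr1 (fun s => nth 0%N s (index a l)) e.
  by rewrite !(nth_map a)// nth_index// => /einj->//; rewrite inE.
- by rewrite !rmorphD ea eb.
- by rewrite !rmorphM ea eb.
Qed.

End Countability.

Section AdelicSubgroups.
Variables (X : scheme) (D : adelic_data X) (G : affGroup).
Variables (U : set (gring G)).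

Lemma sub_F_countable : finite_type_Z X -> fin_gen_Z (gring G) ->
  countable (sub_F U : set (apts D G)).
Proof.
move=> hft hfg; apply: countable_image.
apply: (@sub_countable _ _ _ [set: pts (gring G) (ad_F D)]).
  exact: subset_card_le.
by apply: pts_countable => //; exact: stalk_countable.
Qed.

Lemma sub_F_sub_A : sub_F U `<=` (sub_A U : set (apts D G)).
Proof. by move=> _ [x Ux <-] a Ua; rewrite /= Ux// rmorph0. Qed.

Lemma sub_A_subgroup : closed_subgroup U -> subgroup (sub_A U : set (apts D G)).
Proof. by move=> [_ sU]; exact: sU. Qed.

Lemma sub_F_subgroup : closed_subgroup U -> subgroup (sub_F U : set (apts D G)).
Proof.
move=> [_ /(_ (ad_F D))[U1 UM UV]]; split.
- exists (gone G (ad_F D)) => //.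
  exact: (@push_one G (ad_F D) (adele D) (ad_diag D)).
- move=> _ _ [x Ux <-] [y Uy <-]; exists (gmul x y); first exact: UM.
  exact: (@gmul_nat G (ad_F D) (adele D) (ad_diag D)).
- move=> _ [x Ux <-]; exists (ginv x); first exact: UV.
  exact: (@push_inv G (ad_F D) (adele D) (ad_diag D)).
Qed.

End AdelicSubgroups.

(** * Constant terms of pull-backs *)

Lemma sub_F_GF (X : scheme) (D : adelic_data X) (G : affGroup) (U : set (gring G)) :
  sub_F U `<=` @GF X D G.
Proof. by move=> _ [x _ <-]; exists x. Qed.

(** The measure is carried by U_P(A), so the normalization is also the measure of the open subgroup
    G(O) of G(A). *)
Lemma haar_GO (X : scheme) (D : adelic_data X) (G : affGroup) (R : realType)
    (B : set (gring G)) (H : haar_data D R B) (P : std_parabolic B) :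
  fin_gen_Z (gring G) -> qh_mu (hd H P) (GO D G) = 1%E.
Proof.
move=> hfg; rewrite (qh_supported _ (@sub_A_closed X D G _)).
  by rewrite setIC; exact: hd_normalized.
by apply: borel_open; exact: GO_open.
Qed.

Section ConstantTermReduction.
Variables (Y X : scheme) (f : sch_mor Y X).
Hypotheses (emb : closed_embedding f) (surj : forall z, exists w, f w = z).
Hypotheses (hdX : dim_one X) (hfX : finite_type_Z X).
Hypotheses (hdY : dim_one Y) (hfY : finite_type_Z Y).
Variables (D' : adelic_data Y) (D : adelic_data X).
Variables (r : {rmorphism adele D -> adele D'}) (hr : induced_map f r).
Variables (G : affGroup) (B : set (gring G)) (R : realType).
Variables (H : haar_data D R B) (H' : haar_data D' R B).

Lemma constant_term_pullback (P : std_parabolic B) (g : apts D G) :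
  exists2 kap : R, 0 < kap & forall phi : apts D' G -> complex R,
    Bun_fun (GO D' G) phi ->
    constant_term H P (pullback r phi) g =
    kap%:C%C * constant_term H' P phi (push_adele r g).
Proof.
have [cU smU _ _] := sp_radP P; have hfg := smU.1.
pose g' := push_adele r g.
have oGO : open_subgroup (GO D G) by split; [exact: GO_subgroup|exact: GO_open].
have oGO' : open_subgroup (GO D' G) by split; [exact: GO_subgroup|exact: GO_open].
have fGO : (qh_mu (hd H P) (GO D G) < +oo)%E by rewrite haar_GO// ltry.
(* The conjugate makes u -> phi (u g') right invariant; the intersection with G(O) ensures finite
   measure. *)
pose O' := conj_set g' (GO D' G) `&` GO D' G.
have oO' : open_subgroup O' by apply: open_subgroupI => //; exact: conj_subgroup.
have fO' : (qh_mu (hd H' P) O' < +oo)%E.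
  apply: (@le_lt_trans _ _ (qh_mu (hd H' P) (GO D' G))); last by rewrite haar_GO// ltry.
  by apply: le_measure; rewrite ?inE; [apply: borel_open; case: oO'
    |apply: borel_open; case: oGO'|move=> ? []].
have [kap kap0 hk] := @integral_ratio X Y hdX hfX hdY hfY D D' G R _ _ (hd H P)
  (@sub_A_subgroup X D G _ cU) (@sub_F_subgroup X D G _ cU) (@sub_F_sub_A X D G _)
  (@sub_F_countable X D G _ hfX hfg) (@sub_A_closed X D G _)
  _ _ (hd H' P)
  (@sub_A_subgroup Y D' G _ cU) (@sub_F_subgroup Y D' G _ cU) (@sub_F_sub_A Y D' G _)
  (@sub_F_countable Y D' G _ hfY hfg) (@sub_A_closed Y D' G _)
  (@push_adele _ _ D' D r G) (@push_adeleM _ _ D' D r G) (@push_adeleV _ _ D' D r G)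
  (push_adele1 r G) (@push_adele_open _ _ f emb surj D' D r hr G)
  (fun x => @push_adele_A _ _ D' D r G _ x)
  (fun x' Ux' => let: ex_intro x (conj Ux e) := push_adele_surj emb surj hdX hfX hr smU Ux' in
     ex_intro2 _ _ x Ux e)
  (fun x => @push_adele_F _ _ f emb surj D' D r hr G _ x) _ oGO fGO O' oO' fO'.
exists kap => // phi bphi.
have := hk (fun u => phi (gmul u g')) _ _.
rewrite (_ : _ \o _ = fun u => pullback r phi (gmul u g)); last first.
  by apply/funext => u; rewrite /= -push_adeleM.
apply.
- move=> x k [Ok _]; exact: (right_inv_conj (Bun_fun_right_inv bphi) x Ok).
- move=> gam u Fgam; rewrite -gmulA (Bun_fun_left_inv _ (GO_subgroup D' G) bphi)//.
  exact: sub_F_GF Fgam.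
Qed.

Lemma pullback_Bun phi : Bun_fun (GO D' G) phi ->
  Bun_fun (GO D G) (pullback r phi : apts D G -> complex R).
Proof.
move=> bphi gam g k hgam hk; change (phi (push_adele r (gmul (gmul gam g) k)) = phi (push_adele r g)).
rewrite !push_adeleM.
by apply: bphi; [exact: (push_adele_GF emb surj hr hgam)|exact: (push_adele_GO emb hr hk)].
Qed.

(** G is its own closed subscheme with ideal 0, so smoothness makes G(A_C) -> G(A_C') surjective. *)
Lemma pullback_inj : smooth_sub (G := G) [set 0] ->
  injective (pullback r : (apts D' G -> complex R) -> apts D G -> complex R).
Proof.
move=> smG phi psi e; apply/funext => x'.
have [x [_ <-]] := @push_adele_surj _ _ f emb surj hdX hfX D' D r hr G _ x' smG
  (fun a (a0 : a = 0) => etrans (congr1 x' a0) (rmorph0 x')).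
exact: (congr1 (fun h => h x) e).
Qed.

Lemma pullback_S_cusp phi : smooth_sub (G := G) [set 0] -> Bun_fun (GO D' G) phi ->
  S_cusp H (GO D G) (pullback r phi) <-> S_cusp H' (GO D' G) phi.
Proof.
move=> smG bphi; split=> -[_ cusp]; (split; first by [exact: bphi|exact: pullback_Bun]) => P.
  move=> x'; have [x [_ <-]] := @push_adele_surj _ _ f emb surj hdX hfX D' D r hr G _ x' smG
    (fun a (a0 : a = 0) => etrans (congr1 x' a0) (rmorph0 x')).
  have [kap kap0 e] := constant_term_pullback P x.
  have /eqP := cusp P x; rewrite e// mulf_eq0 => /orP[|/eqP//].
  by rewrite eq_complex /= eqxx andbT gt_eqF.
by move=> g; have [kap _ ->//] := constant_term_pullback P g; rewrite cusp mulr0.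
Qed.

End ConstantTermReduction.

(** * Stability under the Hecke algebra, and cuspidality on C' and on C *)

Theorem propositionA (R : realType) (k : finFieldType) (Cbar : kScheme k)
    (hCbar : smooth_proper_curve Cbar)
    (C : scheme) (j : sch_mor Cbar C) (hC : nilpotent_extension j)
    (D : adelic_data C)
    (G : affGroup) (T B : set (gring G)) (hG : reductive G)
    (hT : split_maximal_torus T) (hB : borel_subgroup B) (hTB : B `<=` T)
    (H : haar_data D R B) :
  (forall K : set (apts D G), compact_open_subgroup K ->
   forall h : hecke R K,
     (forall f, S_cusp H K f -> S_cusp H K (hecke_act h f)) /\
     (forall (i : nat) f, S_cusp_nil H i K f ->
        S_cusp_nil H i K (hecke_act h f))) /\
  (forall (C' : scheme) (j' : sch_mor Cbar C') (hC' : nilpotent_extension j')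
     (iota : sch_mor C' C) (hiota : closed_embedding iota)
     (D' : adelic_data C') (H' : haar_data D' R B)
     (r : {rmorphism adele D -> adele D'}) (hr : induced_map iota r),
   let Bun' : set (apts D' G -> complex R) := Bun_fun (GO D' G) in
   let Bun : set (apts D G -> complex R) := Bun_fun (GO D G) in
   [/\ pullback r @` Bun' `<=` Bun,
       {in Bun' &, injective (pullback r)}
     & pullback r @` S_cusp H' (GO D' G) =
       (pullback r @` Bun') `&` S_cusp H (GO D G)]).
Proof.
(* Only the reduced curve is assumed to have dimension one; its homeomorphism with a nilpotent
   extension transfers this. *)
have dim1 (Z : scheme) (i : sch_mor Cbar Z) : nilpotent_extension i -> dim_one Z.
  move=> [_ _ [inj cl _] surj]; case: hCbar => _ _ _.
  exact: dim_one_image (@mor_cont _ _ i) inj cl surj.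
have hdC := dim1 _ _ hC; have [hfC _ _ _] := hC.
split=> [K cK h|C' j' hC' iota hiota D' H' r hr Bun' Bun].
  split=> [f [bf cusp]|i f [bf cusp]]; (split; first exact: hecke_act_Bun) => P g.
    exact: (hecke_act_quotient_integral hdC hfC cK h (Bun_fun_right_inv bf) (cusp P) g).
  exact: (hecke_act_quotient_integral hdC hfC cK h (Bun_fun_right_inv bf) (cusp P) g).
have hdC' := dim1 _ _ hC'; have [hfC' _ _ _] := hC'.
(* C is the closure of its general point, hence irreducible, and C' has the same dimension, so the
   closed embedding is surjective. *)
have surj : forall z, exists w, iota w = z.
  have [inj cl _] := hiota.
  apply: (closed_embedding_surj (@mor_cont _ _ iota) inj cl hdC' hdC).
  by rewrite -(ad_genP D); exact: irreducible_closure1.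
have smG := hG.1.
split.
- by move=> _ [phi bphi <-]; exact: (pullback_Bun hiota surj hr bphi).
- by move=> phi psi _ _; exact: (pullback_inj hiota surj hdC hfC hr smG).
apply/seteqP; split=> [_ [phi cphi <-]|_ [[phi bphi <-] cusp]].
  have bphi : Bun' phi := cphi.1; split; first by exists phi.
  exact: (pullback_S_cusp hiota surj hdC hfC hdC' hfC' hr H H' smG bphi).2.
exists phi => //.
exact: (pullback_S_cusp hiota surj hdC hfC hdC' hfC' hr H H' smG bphi).1.
Qed.
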